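(* Let $E,E_*$ be separable complex Hilbert spaces, let $\Phi\in\mathcal{S}_2(E,E_* )$ and let $(K_1,K_2)$ be Agler kernels of $\Phi$. For $j=1,2$ put $$H_j=\mathcal{H}\left(\frac{K_j(z,w)}{1-z_j\bar w_j}\right).$$ Then $H_1\subseteq H_1^{max}$ and $H_2\subseteq H_2^{max}$, and these containments are contractive, i.e. for $j=1,2$ $$\|f\|_{H_j^{max}}\le\|f\|_{H_j}\qquad\forall f\in H_j.$$
   Context: Schur class and kernels. $\mathcal{S}_2(E,E_* )$ is the set of holomorphic $\Phi:\mathbb{D}^2\to\mathcal{L}(E,E_* )$ with every $\Phi(z)$ a contraction. A function $K:\mathbb{D}^2\times\mathbb{D}^2\to\mathcal{L}(E_* )$ is a positive kernel if $\sum_{i,j=1}^N\langle K(x_i,x_j)\eta_j,\eta_i\rangle\ge 0$ for all $N$, $x_i\in\mathbb{D}^2$, $\eta_i\in E_*$; $\mathcal{H}(K)$ is its reproducing kernel Hilbert space of $E_*$-valued functions. Positive kernels $(K_1,K_2)$ are Agler kernels of $\Phi$ if $I_{E_*}-\Phi(z)\Phi(w)^*=(1-z_1\bar w_1)K_2(z,w)+(1-z_2\bar w_2)K_1(z,w)$ for all $z,w\in\mathbb{D}^2$. Scattering subspace. $L^2(E)=L^2(\mathbb{T}^2)\otimes E$; $H^2(E)=H^2(\mathbb{D}^2)\otimes E$, viewed through boundary values as a subspace of $L^2(E)$. $Z_j$ is the coordinate function $Z_j(z)=z_j$. $\Phi$ also denotes multiplication by its boundary values, $L^2(E)\to L^2(E_*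 )$, and $\Phi^*$ the adjoint. The operator range of a bounded operator $T$ is the image of $T$ with the inner product $\langle Tx,Ty\rangle=\langle P_{(\ker T)^\perp}x,y\rangle$. $\mathscr{H}$ is the operator range of $\begin{bmatrix} I&\Phi\\ \Phi^*&I\end{bmatrix}^{1/2}$ on $L^2(E_* )\oplus L^2(E)$; multiplication by $Z_j$ is unitary on $\mathscr{H}$. $\mathcal{K}_\Phi=\{\begin{bmatrix} f\\ g\end{bmatrix}\in\mathscr{H}: f\in H^2(E_* ),\ g\in L^2(E)\ominus H^2(E)\}$, a closed subspace of $\mathscr{H}$, and $S_j^{max}=\{F\in\mathcal{K}_\Phi:Z_j^kF\in\mathcal{K}_\Phi\ \forall k\in\mathbb{N}\}$. $H_j^{max}$ is the operator range of the map $S_j^{max}\ni\begin{bmatrix} f\\ g\end{bmatrix}\mapsto f$: $f\in H_j^{max}$ iff there is $g$ with $\begin{bmatrix} f\\ g\end{bmatrix}\in S_j^{max}$, and $\|f\|_{H_j^{max}}=\min\{\|\begin{bmatrix} f\\ g\end{bmatrix}\|_{\mathscr{H}}:\begin{bmatrix} f\\ g\end{bmatrix}\in S_j^{max}\}$. *)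

(* Defs.v *)
From HB Require Import structures.
From mathcomp Require Import all_boot all_order all_algebra.
From mathcomp Require Import all_classical all_reals all_analysis.
From mathcomp Require Import measurable_realfun complex ring lra.
Set Implicit Arguments. Unset Strict Implicit. Unset Printing Implicit Defensive.
Import Order.TTheory GRing.Theory Num.Theory.
Import numFieldNormedType.Exports.
Local Open Scope classical_set_scope.
Local Open Scope ring_scope.

HB.mixin Record isInner (R : realType) V of GRing.Lmodule R[i] V := {
  inner : V -> V -> R[i];
  innerDl : forall x y z, inner (x + y) z = inner x z + inner y z;
  innerZl : forall a x z, inner (a *: x) z = a * inner x z;
  innerC : forall x y, inner y x = (inner x y)^*;
  inner_ge0 : forall x, 0 <= inner x x;
  inner_eq0 : forall x, inner x x = 0 -> x = 0 }.

#[short(type=innerType)]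
HB.structure Definition InnerSpace (R : realType) :=
  {V of GRing.Lmodule R[i] V & isInner R V}.

HB.mixin Record isHilbert (R : realType) V
    of CompleteNormedModule R[i] V & InnerSpace R V := {
  normr_inner : forall x : V, `|x| ^+ 2 = inner x x }.

#[short(type=hilbertType)]
HB.structure Definition Hilbert (R : realType) :=
  {V of CompleteNormedModule R[i] V & InnerSpace R V & isHilbert R V}.

HB.mixin Record isSeparable (R : realType) V of Hilbert R V := {
  separable : exists d : nat -> V, dense (range d) }.

#[short(type=sepHilbertType)]
HB.structure Definition SeparableHilbert (R : realType) :=
  {V of Hilbert R V & isSeparable R V}.


Section InnerTheory.
Context (R : realType) (V : innerType R).
Implicit Types x y z : V.

Definition sqnorm x : R := complex.Re (inner x x).

Definition hnorm x : R := Num.sqrt (sqnorm x).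

Lemma Re_conj (a : R[i]) : complex.Re a^* = complex.Re a.
Proof. by case: a. Qed.

Lemma Re_innerC x y : complex.Re (inner y x) = complex.Re (inner x y).
Proof. by rewrite innerC Re_conj. Qed.

Lemma innerDr x y z : inner z (x + y) = inner z x + inner z y.
Proof. by rewrite innerC innerDl rmorphD /= -!innerC. Qed.

Lemma innerZr (a : R[i]) x z : inner z (a *: x) = a^* * inner z x.
Proof. by rewrite innerC innerZl rmorphM /= -innerC. Qed.

Lemma inner0l z : inner 0 z = 0.
Proof. by rewrite -(scale0r 0) innerZl mul0r. Qed.

Lemma innerNl x z : inner (- x) z = - inner x z.
Proof. by rewrite -scaleN1r innerZl mulN1r. Qed.

Lemma innerNr x z : inner z (- x) = - inner z x.
Proof. by rewrite innerC innerNl rmorphN /= -innerC. Qed.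

Lemma sqnorm_ge0 x : 0 <= sqnorm x.
Proof. by have := inner_ge0 x; rewrite lecE => /andP[]. Qed.

Lemma inner_sqnorm x : inner x x = (sqnorm x)%:C%C.
Proof.
have := inner_ge0 x; rewrite lecE /sqnorm => /andP[/eqP /= + _].
by case: (inner x x) => a b /= ->.
Qed.

Lemma sqnorm0 : sqnorm 0 = 0.
Proof. by rewrite /sqnorm inner0l. Qed.

Lemma sqnorm_eq0 x : sqnorm x = 0 -> x = 0.
Proof. by move=> x0; apply: inner_eq0; rewrite inner_sqnorm x0. Qed.

Lemma sqnormD x y :
  sqnorm (x + y) = sqnorm x + sqnorm y + complex.Re (inner x y) *+ 2.
Proof.
rewrite /sqnorm innerDl !innerDr !raddfD /= (Re_innerC x y) mulr2n.
by rewrite addrACA [X in _ + X]addrC addrACA addrA.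
Qed.

Lemma sqnormN x : sqnorm (- x) = sqnorm x.
Proof. by rewrite /sqnorm innerNl innerNr opprK. Qed.

Lemma sqnormZ (a : R[i]) x :
  sqnorm (a *: x) = complex.Re (a * a^*) * sqnorm x.
Proof.
rewrite /sqnorm innerZl innerZr mulrA inner_sqnorm.
by case: (a * a^*) => p q /=; rewrite mulr0 subr0.
Qed.

Lemma Re_polar x y :
  complex.Re (inner x y) = 4^-1 * (sqnorm (x + y) - sqnorm (x - y)).
Proof. by rewrite !sqnormD sqnormN innerNr raddfN /=; field. Qed.

Lemma Im_inner x y :
  complex.Im (inner x y) = complex.Re (inner x ('i%C *: y)).
Proof. by rewrite innerZr; case: (inner x y) => a b /=; ring. Qed.

Lemma ler_Re_inner x y :
  `|complex.Re (inner x y)| *+ 2 <= sqnorm x + sqnorm y.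
Proof.
have := sqnorm_ge0 (x + y); have := sqnorm_ge0 (x - y).
rewrite !sqnormD sqnormN innerNr raddfN /=.
by case: (ler0P (complex.Re (inner x y))) => _; lra.
Qed.

Lemma ler_sqnormD x y : sqnorm (x + y) <= (sqnorm x + sqnorm y) *+ 2.
Proof.
have := ler_Re_inner x y; rewrite sqnormD.
have := ler_norm (complex.Re (inner x y)); lra.
Qed.

End InnerTheory.

(* The torus is parametrised by [t |-> (e^{2 pi i t_1}, e^{2 pi i t_2})] on the
   unit square, so that Lebesgue measure is the normalised Haar measure. *)
Section Torus.
Context (R : realType).

Definition angles := (measurableTypeR R * measurableTypeR R)%type.

Definition mu2 : set angles -> \bar R :=
  (@lebesgue_measure R \x @lebesgue_measure R)%E.
HB.instance Definition _ := Measure.on mu2.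

Definition square : set angles := `[0, 1]%classic `*` `[0, 1]%classic.

Lemma measurable_square : measurable square.
Proof. by apply: measurableX; exact: measurable_itv. Qed.

End Torus.
Arguments mu2 {R} : simpl never.
Arguments square {R}.
#[global] Hint Resolve measurable_square : core.

Section SquareIntegrable.
Context (R : realType) (E : sepHilbertType R).
Implicit Types f g : angles R -> E.

(* Since [E] is separable, weak and strong measurability agree (Pettis). *)
Definition weakly_measurable f := forall y : E,
  measurable_fun square (fun t => complex.Re (inner (f t) y)) /\
  measurable_fun square (fun t => complex.Im (inner (f t) y)).

Definition square_integrable f :=
  weakly_measurable f /\
  (\int[mu2]_(t in square) (sqnorm (f t))%:E < +oo)%E.

Lemma weakly_measurableD f g :
  weakly_measurable f -> weakly_measurable g -> weakly_measurable (f + g).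
Proof.
move=> mf mg y; have [mf1 mf2] := mf y; have [mg1 mg2] := mg y.
split; under eq_fun do rewrite innerDl raddfD /=; exact: measurable_funD.
Qed.

Lemma weakly_measurableZ a f :
  weakly_measurable f -> weakly_measurable (a *: f).
Proof.
move=> mf y; have [mf1 mf2] := mf y; split; under eq_fun.
- move=> t; rewrite innerZl.
  rewrite (_ : complex.Re _ = complex.Re a * complex.Re (inner (f t) y) -
    complex.Im a * complex.Im (inner (f t) y)); first over.
  by case: a (inner _ _) => ? ? [].
- by apply: measurable_funB; exact: measurable_funM.
- move=> t; rewrite innerZl.
  rewrite (_ : complex.Im _ = complex.Re a * complex.Im (inner (f t) y) +
    complex.Im a * complex.Re (inner (f t) y)); first over.
  by case: a (inner _ _) => ? ? [].
- by apply: measurable_funD; exact: measurable_funM.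
Qed.

Lemma sqnorm_dense_sup (d : nat -> E) x : dense (range d) ->
  sups (fun n => complex.Re (inner x (d n)) *+ 2 - sqnorm (d n)) 0 = sqnorm x.
Proof.
move=> dd; set u := fun n => _.
have uE n : u n = sqnorm x - sqnorm (x - d n).
  by rewrite /u sqnormD sqnormN innerNr raddfN /=; lra.
have ub : ubound (sdrop u 0) (sqnorm x).
  by move=> _ [n _ <-]; rewrite uE gerBl ?sqnorm_ge0.
have ub0 : has_ubound (sdrop u 0) by exists (sqnorm x).
apply/eqP; rewrite eq_le; apply/andP; split.
  by apply: ge_sup => //; exists (u 0%N), 0%N.
rewrite leNgt; apply/negP => lt_x.
set e := sqnorm x - sups u 0; have e0 : 0 < e by rewrite subr_gt0.
have r0 : 0 < (Num.sqrt e)%:C%C by rewrite ltcR sqrtr_gt0.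
have [y [xy [n _ def_y]]] : (ball x (Num.sqrt e)%:C%C) `&` (range d) !=set0.
  by apply: dd; [exists x; exact: ballxx|exact: ball_open].
move: xy; rewrite -def_y -ball_normE /= => xd.
have : sqnorm (x - d n) < e.
  have : `|x - d n| ^+ 2 < (Num.sqrt e)%:C%C ^+ 2.
    by rewrite ltr_pXn2r// nnegrE ?normr_ge0 ?(ltW r0).
  by rewrite normr_inner inner_sqnorm -rmorphXn /= sqr_sqrtr ?ltcR// ltW.
have : u n <= sups u 0 by apply: ub_le_sup => //; exists n.
by rewrite uE /e; lra.
Qed.

Lemma measurable_sqnorm f :
  weakly_measurable f -> measurable_fun square (fun t => sqnorm (f t)).
Proof.
move=> mf; have [d dd] := @separable _ E.
rewrite (_ : (fun t => sqnorm (f t)) = fun t => sups (fun n =>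
   complex.Re (inner (f t) (d n)) *+ 2 - sqnorm (d n)) 0); last first.
  by apply/funext => t; rewrite sqnorm_dense_sup.
apply: (measurable_fun_sups
  (h := fun n t => complex.Re (inner (f t) (d n)) *+ 2 - sqnorm (d n))).
  move=> t _; exists (sqnorm (f t)) => _ [n _ <-].
  have := sqnorm_ge0 (f t - d n).
  by rewrite sqnormD sqnormN innerNr raddfN /=; lra.
move=> n; apply: measurable_funB => //; under eq_fun do rewrite mulr2n.
by apply: measurable_funD; exact: (mf _).1.
Qed.

Lemma square_integrableD f g :
  square_integrable f -> square_integrable g -> square_integrable (f + g).
Proof.
move=> [mf fi] [mg gi]; have mfg := weakly_measurableD mf mg.
have mE h : weakly_measurable h ->
    measurable_fun square (fun t => (sqnorm (h t))%:E).
  by move=> mh; apply/measurable_EFinP; exact: measurable_sqnorm.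
split=> //; apply: (@le_lt_trans _ _ (\int[mu2]_(t in square)
    (2%:E * ((sqnorm (f t))%:E + (sqnorm (g t))%:E)))%E).
  apply: ge0_le_integral => //.
  - by move=> t _; rewrite lee_fin sqnorm_ge0.
  - exact: mE.
  - apply: emeasurable_funM => //; apply: emeasurable_funD; exact: mE.
  move=> t _; rewrite -EFinD -EFinM lee_fin mulrC mulr_natr.
  exact: ler_sqnormD.
have ge0 h t : (0 <= (sqnorm (h t))%:E :> \bar R)%E by rewrite lee_fin sqnorm_ge0.
rewrite ge0_integralZl//.
- rewrite ge0_integralD//; try exact: mE.
  by rewrite lte_mul_pinfty // lte_add_pinfty.
- by apply: emeasurable_funD; exact: mE.
- by move=> t _; rewrite adde_ge0// ge0.
Qed.

Lemma square_integrableZ a f : square_integrable f -> square_integrable (a *: f).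
Proof.
move=> [mf fi]; split; first exact: weakly_measurableZ.
have a0 : 0 <= complex.Re (a * a^*).
  by have := mul_conjC_ge0 a; rewrite lecE => /andP[].
under eq_integral do rewrite sqnormZ EFinM.
rewrite ge0_integralZl//.
- by rewrite lte_mul_pinfty.
- by apply/measurable_EFinP; exact: measurable_sqnorm.
- by move=> t _; rewrite lee_fin sqnorm_ge0.
Qed.

Lemma square_integrable0 : square_integrable 0.
Proof.
split.
  by move=> y; split; under eq_fun do rewrite inner0l; exact: measurable_cst.
under eq_integral do rewrite sqnorm0.
by rewrite integral0.
Qed.

Lemma integrable_inner f g : square_integrable f -> square_integrable g ->
  mu2.-integrable square (EFin \o (fun t => complex.Re (inner (f t) (g t)))) /\
  mu2.-integrable square (EFin \o (fun t => complex.Im (inner (f t) (g t)))).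
Proof.
have key h k : square_integrable h -> square_integrable k ->
    mu2.-integrable square (EFin \o (fun t => complex.Re (inner (h t) (k t)))).
  move=> sh sk; have [mh ih] := sh; have [mk ik] := sk.
  have mN : weakly_measurable (h - k).
    by rewrite -scaleN1r; apply/weakly_measurableD/weakly_measurableZ.
  have mRe : measurable_fun square (fun t => complex.Re (inner (h t) (k t))).
    under eq_fun do rewrite Re_polar; apply: measurable_funM => //.
    apply: measurable_funB.
      exact: (measurable_sqnorm (weakly_measurableD mh mk)).
    exact: (measurable_sqnorm mN).
  apply: (@le_integrable _ _ _ mu2 _ _ _
    (fun t => (sqnorm (h t))%:E + (sqnorm (k t))%:E)%E) => //.
  - exact/measurable_EFinP.
  - move=> t _ /=; rewrite lee_fin [leRHS]ger0_norm ?addr_ge0 ?sqnorm_ge0//.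
    have := ler_Re_inner (h t) (k t).
    have := normr_ge0 (complex.Re (inner (h t) (k t))); lra.
  - have iE l : square_integrable l ->
        mu2.-integrable square (fun t => (sqnorm (l t))%:E).
      move=> [ml il]; apply/integrableP; split.
        by apply/measurable_EFinP; exact: measurable_sqnorm.
      by under eq_integral do rewrite gee0_abs ?lee_fin ?sqnorm_ge0//.
    by apply: integrableD => //; exact: iE.
move=> sf sg; split; first exact: key.
under eq_fun => t do rewrite /= Im_inner.
exact: (key f ('i%C *: g) sf (square_integrableZ _ sg)).
Qed.

End SquareIntegrable.

Section L2.
Context (R : realType) (E : sepHilbertType R).

Record preL2 := PreL2 {
  preL2_fun : angles R -> E;
  preL2P : square_integrable preL2_fun }.

HB.instance Definition _ := gen_eqMixin preL2.
HB.instance Definition _ := gen_choiceMixin preL2.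

Definition preL2_eq (f g : preL2) : bool :=
  `[< preL2_fun f = preL2_fun g %[ae mu2 in square] >].

Let preL2_eq_refl : reflexive preL2_eq.
Proof. by move=> f; apply/asboolP; exact: ae_eq_refl. Qed.

Let preL2_eq_sym : symmetric preL2_eq.
Proof.
by move=> f g; apply/idP/idP => /asboolP h; apply/asboolP; exact: ae_eq_sym.
Qed.

Let preL2_eq_trans : transitive preL2_eq.
Proof.
by move=> g f h /asboolP fg /asboolP gh; apply/asboolP; exact: ae_eq_trans gh.
Qed.

Canonical preL2_equiv :=
  EquivRel preL2_eq preL2_eq_refl preL2_eq_sym preL2_eq_trans.

Local Open Scope quotient_scope.

Definition L2 := {eq_quot preL2_eq}.
HB.instance Definition _ := Choice.on L2.
HB.instance Definition _ := EqQuotient.on L2.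

(* A representative of the class [u]. *)
Definition L2fun (u : L2) : angles R -> E := preL2_fun (repr u).

Lemma L2funP u : square_integrable (L2fun u).
Proof. exact: preL2P. Qed.

Definition L2class f (fP : square_integrable f) : L2 := \pi_L2 (PreL2 fP).

Lemma L2fun_class f (fP : square_integrable f) :
  L2fun (L2class fP) = f %[ae mu2 in square].
Proof.
rewrite /L2fun /L2class.
have : repr (\pi_L2 (PreL2 fP)) = PreL2 fP %[mod L2] by rewrite reprK.
by move=> /eqmodP /asboolP.
Qed.

Lemma L2ext u v : L2fun u = L2fun v %[ae mu2 in square] -> u = v.
Proof.
move=> uv; rewrite -[u]reprK -[v]reprK; apply/eqmodP; exact/asboolP.
Qed.

Definition L2add u v := L2class (square_integrableD (L2funP u) (L2funP v)).
Definition L2scale a u := L2class (square_integrableZ a (L2funP u)).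
Definition L2zero := L2class (square_integrable0 E).
Definition L2opp u := L2scale (-1) u.

Lemma L2addE u v : L2fun (L2add u v) = (fun t => L2fun u t + L2fun v t) %[ae mu2 in square].
Proof. exact: L2fun_class. Qed.

Lemma L2scaleE a u : L2fun (L2scale a u) = (fun t => a *: L2fun u t) %[ae mu2 in square].
Proof. exact: L2fun_class. Qed.

Lemma L2zeroE : L2fun L2zero = cst 0 %[ae mu2 in square].
Proof. exact: L2fun_class. Qed.

Let filterS5 (P1 P2 P3 P4 P5 P : set (angles R)) :
  (forall t, P1 t -> P2 t -> P3 t -> P4 t -> P5 t -> P t) ->
  (\forall t \near almost_everywhere mu2, P1 t) ->
  (\forall t \near almost_everywhere mu2, P2 t) ->
  (\forall t \near almost_everywhere mu2, P3 t) ->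
  (\forall t \near almost_everywhere mu2, P4 t) ->
  (\forall t \near almost_everywhere mu2, P5 t) ->
  \forall t \near almost_everywhere mu2, P t.
Proof.
move=> h h1 h2 h3 h4; apply: filterS2 (filterI (filterI h1 h2) (filterI h3 h4)).
by move=> t [[p1 p2] [p3 p4]]; exact: h.
Qed.

Let L2addA : associative L2add.
Proof.
move=> u v w; apply: L2ext.
move: (L2addE u (L2add v w)) (L2addE v w) (L2addE (L2add u v) w)
  (L2addE u v) (L2addE u v).
apply: filterS5 => t h1 h2 h3 h4 _ tS.
by rewrite h1//= h3//= h2//= h4//= addrA.
Qed.

Let L2addC : commutative L2add.
Proof.
move=> u v; apply: L2ext; move: (L2addE u v) (L2addE v u).
by apply: filterS2 => t h1 h2 tS; rewrite h1//= h2//= addrC.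
Qed.

Let L2add0 : left_id L2zero L2add.
Proof.
move=> u; apply: L2ext; move: (L2addE L2zero u) L2zeroE.
by apply: filterS2 => t h1 h2 tS; rewrite h1//= h2//= add0r.
Qed.

Let L2addN : left_inverse L2zero L2opp L2add.
Proof.
move=> u; apply: L2ext.
move: (L2addE (L2opp u) u) (L2scaleE (-1) u) L2zeroE.
by apply: filterS3 => t h1 h2 h3 tS; rewrite h1//= h2//= h3//= scaleN1r addNr.
Qed.

HB.instance Definition _ := GRing.isZmodule.Build L2 L2addA L2addC L2add0 L2addN.

Let L2scaleA a b u : L2scale a (L2scale b u) = L2scale (a * b) u.
Proof.
apply: L2ext.
move: (L2scaleE a (L2scale b u)) (L2scaleE b u) (L2scaleE (a * b) u).
by apply: filterS3 => t h1 h2 h3 tS; rewrite h1//= h2//= h3//= scalerA.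
Qed.

Let L2scale1 : left_id 1 L2scale.
Proof.
move=> u; apply: L2ext; move: (L2scaleE 1 u).
by apply: filterS => t h1 tS; rewrite h1//= scale1r.
Qed.

Let L2scaleDr : right_distributive L2scale +%R.
Proof.
move=> a u v; apply: L2ext.
move: (L2scaleE a (u + v)) (L2addE u v) (L2scaleE a u) (L2scaleE a v)
  (L2addE (L2scale a u) (L2scale a v)).
apply: filterS5 => t h1 h2 h3 h4 h5 tS.
by rewrite h1//= h5//= h2//= h3//= h4//= scalerDr.
Qed.

Let L2scaleDl u : {morph L2scale^~ u : a b / a + b}.
Proof.
move=> a b; apply: L2ext.
move: (L2scaleE (a + b) u) (L2scaleE a u) (L2scaleE b u)
  (L2addE (L2scale a u) (L2scale b u)) (L2scaleE a u).
apply: filterS5 => t h1 h2 h3 h4 _ tS.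
by rewrite h1//= h4//= h2//= h3//= scalerDl.
Qed.

HB.instance Definition _ := GRing.Zmodule_isLmodule.Build R[i] L2
  L2scaleA L2scale1 L2scaleDr L2scaleDl.

Lemma L2funD (u v : L2) :
  L2fun (u + v) = (fun t => L2fun u t + L2fun v t) %[ae mu2 in square].
Proof. exact: L2addE. Qed.

Lemma L2funZ (a : R[i]) (u : L2) :
  L2fun (a *: u) = (fun t => a *: L2fun u t) %[ae mu2 in square].
Proof. exact: L2scaleE. Qed.

Lemma L2fun0 : L2fun 0 = cst 0 %[ae mu2 in square].
Proof. exact: L2zeroE. Qed.

Definition L2inner (u v : L2) : R[i] :=
  ((\int[mu2]_(t in square) complex.Re (inner (L2fun u t) (L2fun v t)))%R +i*
   (\int[mu2]_(t in square) complex.Im (inner (L2fun u t) (L2fun v t)))%R)%C.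

Lemma Re_L2inner u v : complex.Re (L2inner u v) =
  \int[mu2]_(t in square) complex.Re (inner (L2fun u t) (L2fun v t)).
Proof. by []. Qed.

Lemma Im_L2inner u v : complex.Im (L2inner u v) =
  \int[mu2]_(t in square) complex.Im (inner (L2fun u t) (L2fun v t)).
Proof. by []. Qed.

Let complex_ext (a b : R[i]) :
  complex.Re a = complex.Re b -> complex.Im a = complex.Im b -> a = b.
Proof. by case: a b => ? ? [? ?] /= -> ->. Qed.

Let ReD (a b : R[i]) : complex.Re (a + b) = complex.Re a + complex.Re b.
Proof. exact: raddfD. Qed.

Let ImD (a b : R[i]) : complex.Im (a + b) = complex.Im a + complex.Im b.
Proof. exact: raddfD. Qed.

Let ReM (a b : R[i]) : complex.Re (a * b) =
  complex.Re a * complex.Re b - complex.Im a * complex.Im b.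
Proof. by case: a b => ? ? []. Qed.

Let ImM (a b : R[i]) : complex.Im (a * b) =
  complex.Re a * complex.Im b + complex.Im a * complex.Re b.
Proof. by case: a b => ? ? []. Qed.

Lemma ae_eq_Rintegral (f g : angles R -> R) :
  mu2.-integrable square (EFin \o f) -> mu2.-integrable square (EFin \o g) ->
  f = g %[ae mu2 in square] ->
  \int[mu2]_(t in square) f t = \int[mu2]_(t in square) g t.
Proof.
move=> /integrableP[mf _] /integrableP[mg _] fg; congr fine.
by apply: ae_eq_integral => //; exact: ae_eq_comp fg.
Qed.

Let L2int (u v : L2) := integrable_inner (L2funP u) (L2funP v).

Let L2innerDl (u v w : L2) : L2inner (u + v) w = L2inner u w + L2inner v w.
Proof.
have [iu iu'] := L2int u w; have [iv iv'] := L2int v w.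
have [iuv iuv'] := L2int (u + v) w.
apply: complex_ext; rewrite (ReD, ImD) !(Re_L2inner, Im_L2inner).
- rewrite -RintegralD//; apply: ae_eq_Rintegral => //.
    exact: (integrableD _ iu iv).
  move: (L2funD u v); apply: filterS => t h tS.
  by rewrite h//= innerDl ReD.
- rewrite -RintegralD//; apply: ae_eq_Rintegral => //.
    exact: (integrableD _ iu' iv').
  move: (L2funD u v); apply: filterS => t h tS.
  by rewrite h//= innerDl ImD.
Qed.

Let L2innerZl a (u v : L2) : L2inner (a *: u) v = a * L2inner u v.
Proof.
have [iu iu'] := L2int u v; have [iau iau'] := L2int (a *: u) v.
have iZ (r : R) (f : angles R -> R) :
    mu2.-integrable square (EFin \o f) ->
    mu2.-integrable square (EFin \o (fun t => r * f t)).
  by move=> fi; exact: (integrableZl _ r fi).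
apply: complex_ext; rewrite (ReM, ImM) !(Re_L2inner, Im_L2inner).
- rewrite -!RintegralZl// -RintegralB//; [|exact: iZ|exact: iZ].
  apply: ae_eq_Rintegral => //.
    exact: (integrableB _ (iZ _ _ iu) (iZ _ _ iu')).
  move: (L2funZ a u); apply: filterS => t h tS.
  by rewrite h//= innerZl ReM.
- rewrite -!RintegralZl// -RintegralD//; [|exact: iZ|exact: iZ].
  apply: ae_eq_Rintegral => //.
    exact: (integrableD _ (iZ _ _ iu') (iZ _ _ iu)).
  move: (L2funZ a u); apply: filterS => t h tS.
  by rewrite h//= innerZl ImM.
Qed.

Let L2innerC (u v : L2) : L2inner v u = (L2inner u v)^*.
Proof.
have [iu iu'] := L2int u v; have [iv iv'] := L2int v u.
apply: complex_ext; first rewrite Re_conj !Re_L2inner.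
  by apply: eq_Rintegral => t _; rewrite Re_innerC.
rewrite (_ : complex.Im (L2inner u v)^* = - complex.Im (L2inner u v)) //.
rewrite !Im_L2inner -mulN1r -RintegralZl//; apply: eq_Rintegral => t _.
by rewrite innerC mulN1r; case: (inner _ _).
Qed.

Lemma L2inner_sqnorm (u : L2) :
  L2inner u u = (\int[mu2]_(t in square) sqnorm (L2fun u t))%:C%C.
Proof.
apply: complex_ext => //; rewrite Im_L2inner /Rintegral.
by under eq_integral do rewrite inner_sqnorm; rewrite integral0.
Qed.

Let L2inner_ge0 (u : L2) : 0 <= L2inner u u.
Proof.
by rewrite L2inner_sqnorm lecR Rintegral_ge0// => t _; exact: sqnorm_ge0.
Qed.

Let L2inner_eq0 (u : L2) : L2inner u u = 0 -> u = 0.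
Proof.
have [iu _] := L2int u u; rewrite L2inner_sqnorm => /eqP.
rewrite eq_complex /= eqxx andbT => /eqP u0; apply: L2ext.
have mu : measurable_fun square (fun t => (sqnorm (L2fun u t))%:E).
  by apply/measurable_EFinP; exact: measurable_sqnorm (L2funP u).1.
have : ae_eq mu2 square (fun t => (sqnorm (L2fun u t))%:E) (cst 0%E).
  apply/ae_eq_integral_abs => //.
  under eq_integral do rewrite gee0_abs ?lee_fin ?sqnorm_ge0//.
  rewrite -[LHS]fineK; last exact: integrable_fin_num.
  by rewrite [fine _]u0.
move: L2fun0; apply: filterS2 => t h1 h2 tS; rewrite h1//=.
by apply: sqnorm_eq0; have [] := h2 tS.
Qed.

HB.instance Definition _ := isInner.Build R L2
  L2innerDl L2innerZl L2innerC L2inner_ge0 L2inner_eq0.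

(* The class of [f], when [f] agrees a.e. with a square-integrable function. *)
Definition toL2 (f : angles R -> E) : L2 :=
  xget 0 [set u | L2fun u = f %[ae mu2 in square]].

End L2.

Section DirectSum.
Context (R : realType) (V W : innerType R).

Definition pair_inner (x y : V * W) : R[i] := inner x.1 y.1 + inner x.2 y.2.

Let pair_innerDl x y z :
  pair_inner (x + y) z = pair_inner x z + pair_inner y z.
Proof. by rewrite /pair_inner !innerDl addrACA. Qed.

Let pair_innerZl a x z : pair_inner (a *: x) z = a * pair_inner x z.
Proof. by rewrite /pair_inner !innerZl mulrDr. Qed.

Let pair_innerC x y : pair_inner y x = (pair_inner x y)^*.
Proof. by rewrite /pair_inner rmorphD /= -!innerC. Qed.

Let pair_inner_ge0 x : 0 <= pair_inner x x.
Proof. by rewrite addr_ge0 ?inner_ge0. Qed.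

Let pair_inner_eq0 x : pair_inner x x = 0 -> x = 0.
Proof.
move=> /eqP; rewrite paddr_eq0 ?inner_ge0// => /andP[/eqP x1 /eqP x2].
by rewrite [x]surjective_pairing; congr (_, _); exact: inner_eq0.
Qed.

HB.instance Definition _ := isInner.Build R (V * W)%type
  pair_innerDl pair_innerZl pair_innerC pair_inner_ge0 pair_inner_eq0.

End DirectSum.

Section Operators.
Context (R : realType) (V W : innerType R).

Definition bounded_operator (T : V -> W) : Prop :=
  linear T /\ exists M : R, forall x, hnorm (T x) <= M * hnorm x.

(* Unique when it exists, and it does for bounded operators on Hilbert spaces. *)
Definition adjoint (T : V -> W) (y : W) : V :=
  xget 0 [set x | forall u, inner (T u) y = inner u x].

End Operators.

Section OperatorRange.
Context (R : realType) (V W : innerType R).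

Definition positive_operator (T : V -> V) : Prop :=
  bounded_operator T /\ forall x, 0 <= inner (T x) x.

(* The unique positive square root of a positive operator. *)
Definition sqrt_operator (T : V -> V) : V -> V :=
  xget (fun=> 0) [set S | positive_operator S /\ S \o S = T].

(* The orthogonal projection of [x] onto the orthocomplement of [ker T]. *)
Definition proj_kerperp (T : V -> W) (x : V) : V :=
  xget 0 [set p | T (x - p) = 0 /\ forall k, T k = 0 -> inner p k = 0].

Definition preimage_choice (T : V -> W) (y : W) : V := xget 0 [set x | T x = y].

(* The operator range of [T] is the set [range T] with the inner product
   [<T x, T y> = <P x, y>], with [P = proj_kerperp T]. *)
Definition range_inner (T : V -> W) (F G : W) : R[i] :=
  inner (proj_kerperp T (preimage_choice T F)) (preimage_choice T G).

Definition range_norm (T : V -> W) (F : W) : R :=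
  Num.sqrt (complex.Re (range_inner T F F)).

End OperatorRange.

Section Bidisk.
Context (R : realType).

Definition C2 := (R[i]^o * R[i]^o)%type.

Definition bidisk : set C2 := [set z | `|z.1| < 1 /\ `|z.2| < 1].

Definition cis (s : R) : R[i] := (cos (2 * pi * s) +i* sin (2 * pi * s))%C.

Definition torus (t : angles R) : C2 := (cis t.1, cis t.2).

Definition radial (r : R) (t : angles R) : C2 :=
  (r%:C%C * cis t.1, r%:C%C * cis t.2).

End Bidisk.
Arguments bidisk {R}.

Section Multiplication.
Context (R : realType) (E Es : sepHilbertType R).

Definition mulop (A : angles R -> E -> Es) (u : L2 E) : L2 Es :=
  toL2 (fun t => A t (L2fun u t)).

End Multiplication.

Section Hardy.
Context (R : realType) (E : sepHilbertType R).

Definition hardy_space : set (C2 R -> E) := [set F |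
  (* [differentiable] is over the field [R[i]], hence complex *)
  (forall z, bidisk z -> differentiable F z) /\
  exists M : R, forall r : R, 0 <= r < 1 ->
    (\int[mu2]_(t in square) (sqnorm (F (radial r t)))%:E <= M%:E)%E].

(* [u] is the a.e. radial limit on the torus of the Hardy space function [F]. *)
Definition boundary_function (F : C2 R -> E) (u : L2 E) : Prop :=
  hardy_space F /\
  {ae mu2, forall t, square t -> F (radial r t) @[r --> 1^'-] --> L2fun u t}.

Definition H2_subspace : set (L2 E) := [set u | exists F, boundary_function F u].

Definition H2perp : set (L2 E) :=
  [set u | forall v, H2_subspace v -> inner u v = 0].

(* Multiplication by the coordinate function [p], which is [fst] or [snd]. *)
Definition Zmul (p : C2 R -> R[i]^o) : L2 E -> L2 E :=
  mulop (fun t x => (p (torus t) : R[i]) *: x).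

End Hardy.

Section Schur.
Context (R : realType) (E Es : sepHilbertType R).
Implicit Types Phi : C2 R -> E -> Es.

(* Complex differentiability with respect to the operator norm. *)
Definition operator_holomorphic Phi : Prop := forall z, bidisk z ->
  exists A1 A2 : E -> Es, [/\ bounded_operator A1, bounded_operator A2 &
    forall e : R[i], 0 < e -> \forall h \near (0 : C2 R), forall x : E,
      `|Phi (z + h) x - Phi z x - ((h.1 : R[i]) *: A1 x + (h.2 : R[i]) *: A2 x)|
        <= e * `|h| * `|x|].

(* Functions on [C2] are only constrained on the bidisk. *)
Definition Schur_class Phi : Prop :=
  (forall z, bidisk z ->
    bounded_operator (Phi z) /\ forall x, `|Phi z x| <= `|x|) /\
  operator_holomorphic Phi.

(* Strong radial limit; it exists for a.e. [t] when [Phi] is in the Schur class. *)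
Definition boundary_value Phi (t : angles R) (x : E) : Es :=
  lim (Phi (radial r t) x @[r --> 1^'-]).

Definition bmul Phi : L2 E -> L2 Es := mulop (boundary_value Phi).

Definition scattering_block Phi (F : L2 Es * L2 E) : L2 Es * L2 E :=
  (F.1 + bmul Phi F.2, adjoint (bmul Phi) F.1 + F.2).

Definition scattering_root Phi := sqrt_operator (scattering_block Phi).

(* Underlying set and norm of the operator range of [scattering_root Phi]. *)
Definition scattering_space Phi : set (L2 Es * L2 E) :=
  range (scattering_root Phi).

Definition scattering_norm Phi (F : L2 Es * L2 E) : R :=
  range_norm (scattering_root Phi) F.

Definition scattering_subspace Phi : set (L2 Es * L2 E) :=
  [set F | [/\ scattering_space Phi F, H2_subspace F.1 & H2perp F.2]].

Definition Zpair (p : C2 R -> R[i]^o) (F : L2 Es * L2 E) : L2 Es * L2 E :=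
  (Zmul p F.1, Zmul p F.2).

Definition Smax Phi p : set (L2 Es * L2 E) :=
  [set F | scattering_subspace Phi F /\
    forall k : nat, scattering_subspace Phi (iter k (Zpair p) F)].

Definition Hmax Phi p : set (L2 Es) := [set f | exists g, Smax Phi p (f, g)].

(* The norm [c] of [f] is the minimum, attained, over the fibre of [f]. *)
Definition is_Hmax_norm Phi p (f : L2 Es) (c : R) : Prop :=
  (exists g, Smax Phi p (f, g) /\ scattering_norm Phi (f, g) = c) /\
  (forall g, Smax Phi p (f, g) -> c <= scattering_norm Phi (f, g)).

End Schur.

Section Kernels.
Context (R : realType) (E Es : sepHilbertType R).
Implicit Types K : C2 R -> C2 R -> Es -> Es.

Definition positive_kernel K : Prop :=
  (forall z w, bidisk z -> bidisk w -> bounded_operator (K z w)) /\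
  (forall (N : nat) (x : 'I_N -> C2 R) (eta : 'I_N -> Es),
    (forall i, bidisk (x i)) ->
    0 <= \sum_(i < N) \sum_(j < N) inner (K (x i) (x j) (eta j)) (eta i)).

Definition Agler_kernels (Phi : C2 R -> E -> Es) K1 K2 : Prop :=
  [/\ positive_kernel K1, positive_kernel K2 &
    forall z w, bidisk z -> bidisk w -> forall eta : Es,
      eta - Phi z (adjoint (Phi w) eta) =
      (1 - (z.1 : R[i]) * (w.1 : R[i])^* ) *: K2 z w eta +
      (1 - (z.2 : R[i]) * (w.2 : R[i])^* ) *: K1 z w eta].

Definition szego_quotient (p : C2 R -> R[i]^o) K : C2 R -> C2 R -> Es -> Es :=
  fun z w eta => (1 - (p z : R[i]) * (p w : R[i])^* )^-1 *: K z w eta.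

(* [H] with evaluation [ev] is a realisation of the reproducing kernel Hilbert
   space of [K]; it is unique up to an isometry compatible with [ev].  Functions
   are only constrained on the bidisk. *)
Definition is_RKHS K (H : hilbertType R) (ev : H -> C2 R -> Es) : Prop :=
  [/\ forall z, bidisk z -> linear (ev ^~ z),
      forall f, (forall z, bidisk z -> ev f z = 0) -> f = 0 &
      forall w eta, bidisk w -> exists k : H,
        (forall z, bidisk z -> ev k z = K z w eta) /\
        (forall f, inner f k = inner (ev f w) eta)].

End Kernels.

(* Main.v *)
(* Let [T = [[I, Phi], [Phi^*, I]]], let [s_w eta] be the Szego kernel of the
   bidisk and [k_w eta] the kernel of [H_j].  Summing the Agler identity over
   points [w_i] gives, for [x = sum s_{w_i} eta_i] and [h] in [H2],

     <T (x, h), (x, h)> >= |x|^2 - |sum s_{w_i} Phi(w_i)^* eta_i|^2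
                        >= |sum k_{w_i} eta_i|^2
                        >= |sum conj(w_{i,j})^k k_{w_i} eta_i|^2,

   the second step dropping the other Agler summand, the last one using
   [K_j >= 0].  Pairing with [f] in [H_j], whose boundary function [u] exists by
   the case [h = 0], [k = 0], one gets [|<x, Z_j^k u>| <= |f| |T^{1/2} (x, h)|],
   first for such [x], then for all [x].  As [Z_j] is unitary and commutes with
   [Phi], [|<x, u>| <= |f| |T^{1/2} (x, y)|] as soon as [Z_j^k y] is in [H2] for
   some [k].  The Riesz representative [q] of [T^{1/2} (x, y) |-> <x, u>] on these
   pairs has norm at most [|f|], and [T^{1/2} q = (u, g)] with [g] orthogonal to
   all [Z_j^-k H2]: this is an element of [S_j^max] above [u], and it has minimal
   norm since [q] lies in the closure of the pairs used.

   For the Hardy space itself, Cauchy's formula (by a Goursat bisection on the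
   segments from [w] to the circle) is applied one variable at a time, and radial
   limits come from a maximal inequality for vector-valued polynomials.  The
   latter is proved on the grids of roots of unity along the diagonal circles, by
   a [T T^*] argument for the linearised Poisson maximal operator. *)
Require Import Defs.
From HB Require Import structures.
From mathcomp Require Import all_boot all_order all_algebra.
From mathcomp Require Import all_classical all_reals all_analysis.
From mathcomp Require Import measurable_realfun complex ring lra.
Set Implicit Arguments. Unset Strict Implicit. Unset Printing Implicit Defensive.
Import Order.TTheory GRing.Theory Num.Theory.
Import numFieldNormedType.Exports.
Local Open Scope classical_set_scope.
Local Open Scope ring_scope.

(** [H2_subspace] is defined by almost everywhere radial limits, while the Hilbert space argument
    needs a closed subspace containing the Szego kernels. [H2_subspaceP] identifies it with the
    closure of the polynomials, and going from mean convergence of polynomials to radial convergence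
    at almost every point is what calls for the maximal inequality. Since both coordinates are
    scaled by the same [r], only the one-variable slice along the diagonal circle through a point
    matters, and rotation invariance averages the estimates on slices. On a slice a polynomial is
    known from its values at [N]-th roots of unity, with [N] above its degree, so the maximal
    operator, linearised by one radius per root, is a finite nonnegative matrix [A]. A
    quasi-triangle inequality for Poisson kernels bounds the entries of [A A^T] by those of
    [A + A^T], which gives the mean square bound without a covering lemma. Adjoints, projections and
    square roots are values of [xget], hence meaningful only once existence is proved: a variational
    Riesz theorem and an explicit iteration serve for this. *)

Lemma cvg_dist0 (R : realType) (f g : nat -> R) l :
  (forall n, `|f n - l| <= g n) -> g @ \oo --> 0 -> f @ \oo --> l.
Proof.
move=> fg /cvgrPdist_lt g0; apply/cvgrPdist_lt => e /g0; apply: filterS => n.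
rewrite sub0r normrN distrC => ge; apply: (le_lt_trans (fg n)).
exact: le_lt_trans (ler_norm _) ge.
Qed.

(** * Inner product spaces *)

Section InnerMore.
Context (R : realType) (V : innerType R).
Implicit Types x y z : V.

(** The underlying real inner product. Estimates and representation theorems are stated for it, and
    complex identities are recovered by multiplying one argument by [i]. *)
Definition Rin x y : R := complex.Re (inner x y).

Lemma RinC x y : Rin x y = Rin y x.
Proof. exact: Re_innerC. Qed.

Lemma RinDl x y z : Rin (x + y) z = Rin x z + Rin y z.
Proof. by rewrite /Rin innerDl raddfD. Qed.

Lemma RinDr x y z : Rin z (x + y) = Rin z x + Rin z y.
Proof. by rewrite /Rin innerDr raddfD. Qed.

Lemma RinNl x y : Rin (- x) y = - Rin x y.
Proof. by rewrite /Rin innerNl raddfN. Qed.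

Lemma RinNr x y : Rin x (- y) = - Rin x y.
Proof. by rewrite /Rin innerNr raddfN. Qed.

Lemma RinBl x y z : Rin (x - y) z = Rin x z - Rin y z.
Proof. by rewrite RinDl RinNl. Qed.

Lemma RinBr x y z : Rin z (x - y) = Rin z x - Rin z y.
Proof. by rewrite RinDr RinNr. Qed.

Lemma Rin0l x : Rin 0 x = 0.
Proof. by rewrite /Rin inner0l. Qed.

Lemma RinZl (a : R) x y : Rin (a%:C%C *: x) y = a * Rin x y.
Proof. by rewrite /Rin innerZl; case: (inner x y) => p q /=; ring. Qed.

Lemma RinZr (a : R) x y : Rin x (a%:C%C *: y) = a * Rin x y.
Proof. by rewrite RinC RinZl RinC. Qed.

Lemma Rinxx x : Rin x x = sqnorm x.
Proof. by []. Qed.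

Lemma sqnormZR (a : R) x : sqnorm (a%:C%C *: x) = a ^+ 2 * sqnorm x.
Proof. by rewrite -Rinxx RinZl RinZr Rinxx mulrA. Qed.

Lemma sqnormB x y : sqnorm (x - y) = sqnorm x + sqnorm y - Rin x y *+ 2.
Proof. by rewrite sqnormD sqnormN innerNr raddfN /= mulNrn. Qed.

Lemma hnorm_ge0 x : 0 <= hnorm x.
Proof. exact: sqrtr_ge0. Qed.

Lemma hnorm_sqr x : hnorm x ^+ 2 = sqnorm x.
Proof. by rewrite sqr_sqrtr// sqnorm_ge0. Qed.

Lemma hnorm0 : hnorm (0 : V) = 0.
Proof. by rewrite /hnorm sqnorm0 sqrtr0. Qed.

Lemma hnorm_eq0 x : hnorm x = 0 -> x = 0.
Proof. by move=> x0; apply: sqnorm_eq0; rewrite -hnorm_sqr x0 expr0n. Qed.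

Lemma hnorm_gt0 x : x != 0 -> 0 < hnorm x.
Proof.
move=> x0; rewrite lt_def hnorm_ge0 andbT.
by apply/eqP => /hnorm_eq0/eqP; rewrite (negbTE x0).
Qed.

Lemma hnorm_opp x : hnorm (- x) = hnorm x.
Proof. by rewrite /hnorm sqnormN. Qed.

Lemma hnorm_distC x y : hnorm (x - y) = hnorm (y - x).
Proof. by rewrite -opprB hnorm_opp. Qed.

Lemma hnormZR (a : R) x : hnorm (a%:C%C *: x) = `|a| * hnorm x.
Proof. by rewrite /hnorm sqnormZR sqrtrM ?sqr_ge0// sqrtr_sqr. Qed.

Lemma ler_hnorm x c : 0 <= c -> (hnorm x <= c) = (sqnorm x <= c ^+ 2).
Proof. by move=> c0; rewrite -hnorm_sqr ler_pXn2r// nnegrE hnorm_ge0. Qed.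

Lemma ltr_hnorm x c : 0 <= c -> (hnorm x < c) = (sqnorm x < c ^+ 2).
Proof. by move=> c0; rewrite -hnorm_sqr ltr_pXn2r// nnegrE hnorm_ge0. Qed.

(** Cauchy-Schwarz, by expanding the squared norm of [|y| x - |x| y] and dividing by [2 |x| |y|]. *)
Lemma Rin_le_hnorm x y : Rin x y <= hnorm x * hnorm y.
Proof.
have [->|x0] := eqVneq x 0; first by rewrite hnorm0 Rin0l mul0r lexx.
have [->|y0] := eqVneq y 0.
  by rewrite hnorm0 RinC Rin0l mulr0 lexx.
have := sqnorm_ge0 ((hnorm y)%:C%C *: x - (hnorm x)%:C%C *: y).
rewrite sqnormB !sqnormZR RinZl RinZr -!hnorm_sqr => h.
have px : 0 < hnorm x by exact: hnorm_gt0.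
have py : 0 < hnorm y by exact: hnorm_gt0.
have pxy := mulr_gt0 px py.
rewrite -(ler_pM2l pxy); nra.
Qed.

Lemma normr_Rin_le x y : `|Rin x y| <= hnorm x * hnorm y.
Proof.
by rewrite ler_norml Rin_le_hnorm andbT lerNl -RinNl -hnorm_opp Rin_le_hnorm.
Qed.

Lemma ler_hnormD x y : hnorm (x + y) <= hnorm x + hnorm y.
Proof.
rewrite ler_hnorm ?addr_ge0 ?hnorm_ge0// sqnormD -!hnorm_sqr.
by have := Rin_le_hnorm x y; rewrite /Rin => h; nra.
Qed.

Lemma ler_hnormB x y : hnorm (x - y) <= hnorm x + hnorm y.
Proof. by rewrite -(hnorm_opp y) ler_hnormD. Qed.

Lemma ler_hnorm_distD x y z : hnorm (x - z) <= hnorm (x - y) + hnorm (y - z).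
Proof. by rewrite (le_trans _ (ler_hnormD _ _))// addrA subrK. Qed.

Lemma Rin_eq0 x : (forall y, Rin y x = 0) -> x = 0.
Proof. by move=> h; apply: sqnorm_eq0; rewrite -Rinxx h. Qed.

Lemma Rin_inj x y : (forall z, Rin z x = Rin z y) -> x = y.
Proof.
move=> h; apply/eqP; rewrite -subr_eq0; apply/eqP/Rin_eq0 => z.
by rewrite RinBr h subrr.
Qed.

Lemma Im_inner_Rin x y : complex.Im (inner x y) = Rin x ('i%C *: y).
Proof. exact: Im_inner. Qed.

Definition hcvg (u : nat -> V) l := (fun n => hnorm (u n - l)) @ \oo --> (0 : R).

Definition hcauchy (u : nat -> V) := forall e : R, 0 < e ->
  exists N, forall m n, (N <= m)%N -> (N <= n)%N -> hnorm (u m - u n) < e.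

Lemma hcvgP u l : hcvg u l <-> (forall e, 0 < e ->
  exists N, forall n, (N <= n)%N -> hnorm (u n - l) < e).
Proof.
split=> [/cvgrPdist_lt h e e0|h].
  have [N _ hN] := h e e0; exists N => n Nn.
  by have := hN n Nn; rewrite /= sub0r normrN ger0_norm ?hnorm_ge0.
apply/cvgrPdist_lt => e e0; have [N hN] := h e e0; exists N => // n /= Nn.
by rewrite sub0r normrN ger0_norm ?hnorm_ge0 // hN.
Qed.

Lemma hcvg_Rin u l y : hcvg u l -> (fun n => Rin (u n) y) @ \oo --> Rin l y.
Proof.
move=> ul; apply: (@cvg_dist0 R _ (fun n => hnorm (u n - l) * hnorm y)).
  by move=> n; rewrite -RinBl normr_Rin_le.
by rewrite -(mul0r (hnorm y)); apply: cvgMl; exact: ul.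
Qed.

Lemma hcvg_hnorm u l : hcvg u l -> (fun n => hnorm (u n)) @ \oo --> hnorm l.
Proof.
move=> ul; apply: (@cvg_dist0 R _ (fun n => hnorm (u n - l))) => // n.
have := ler_hnorm_distD (u n) l 0; have := ler_hnorm_distD l (u n) 0; rewrite !subr0.
by rewrite (hnorm_distC l) ler_norml; lra.
Qed.

Lemma hcvg_sqnorm u l : hcvg u l -> (fun n => sqnorm (u n)) @ \oo --> sqnorm l.
Proof.
move=> /hcvg_hnorm h; under eq_fun do rewrite -hnorm_sqr.
by rewrite -hnorm_sqr; apply: cvgM.
Qed.

Lemma hcvg_uniq u l l' : hcvg u l -> hcvg u l' -> l = l'.
Proof.
move=> h h'; apply: Rin_inj => z; rewrite !(RinC z).
have /cvg_lim <- // := hcvg_Rin (y := z) h; have /cvg_lim -> // := hcvg_Rin (y := z) h'.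
Qed.

End InnerMore.

(** [L2] and its products carry an inner product but no norm structure, so completeness is expressed
    through [hnorm]. *)
Definition hcomplete (R : realType) (V : innerType R) :=
  forall u : nat -> V, hcauchy u -> exists l, hcvg u l.

(** * Riesz representation by minimisation *)

Section Riesz.
Context (R : realType).

(** The first variation vanishes at a minimum: test with [t = - b / c] if [c > 0], and with [t = b]
    and [t = - b] otherwise. *)
Lemma Rin_quadratic_eq0 (b c : R) :
  (forall t : R, 0 <= t * b *+ 2 + t ^+ 2 * c) -> b = 0.
Proof.
move=> h; have [c0|c0] := leP c 0.
  have := h b; have := h (- b); have := sqr_ge0 b; nra.
have := h (- b / c).
have -> : - b / c * b *+ 2 + (- b / c) ^+ 2 * c = - (b ^+ 2 / c) by field; lra.
rewrite oppr_ge0 pmulr_lle0 ?invr_gt0// => b2.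
by apply/eqP; rewrite -sqrf_eq0 eq_le b2 sqr_ge0.
Qed.

(* The functional [l] is represented by minimising [|S x|^2 - 2 l x]. *)
Lemma riesz_variational (X : lmodType R[i]) (V : innerType R) (D : set X)
    (S : X -> V) (l : X -> R) (c : R) :
  hcomplete V -> D 0 -> (forall a x y, D x -> D y -> D (a *: x + y)) ->
  linear S ->
  (forall (a : R) x y, D x -> D y -> l (a%:C%C *: x + y) = a * l x + l y) ->
  (forall x, D x -> l x <= c * hnorm (S x)) -> 0 <= c ->
  exists p, [/\ hnorm p <= c, forall x, D x -> Rin (S x) p = l x &
    forall e, 0 < e -> exists2 x, D x & hnorm (p - S x) < e].
Proof.
move=> hV D0 DD lS ll lc c0.
have SD x y : S (x + y) = S x + S y.
  by have := lS 1 x y; rewrite !scale1r.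
have S0 : S 0 = 0 by apply: (addrI (S 0)); rewrite -SD !addr0.
have SZ a x : S (a *: x) = a *: S x by have := lS a x 0; rewrite S0 !addr0.
have l0 : l 0 = 0.
  by have := ll 1 0 0 D0 D0; rewrite scaler0 addr0 mul1r; lra.
have lZ a x : D x -> l (a%:C%C *: x) = a * l x.
  by move=> Dx; have := ll a x 0 Dx D0; rewrite l0 !addr0.
have DZ a x : D x -> D (a *: x).
  by move=> Dx; have := DD a x 0 Dx D0; rewrite addr0.
pose J x := sqnorm (S x) - l x *+ 2.
have Jlb x : D x -> - c ^+ 2 <= J x.
  move=> Dx; rewrite /J -hnorm_sqr; have := lc x Dx.
  have := sqr_ge0 (hnorm (S x) - c); nra.
pose m := inf (J @` D).
have hinf : has_inf (J @` D).
  split; first by exists (J 0), 0.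
  by exists (- c ^+ 2) => _ [x Dx <-]; exact: Jlb.
have mJ x : D x -> m <= J x.
  by move=> Dx; apply: ge_inf; [exact: hinf.2|exists x].
pose d n : R := n.+1%:R^-1.
have d0 n : 0 < d n by rewrite invr_gt0.
have /choice[u hu] : forall n, exists x, D x /\ J x < m + d n.
  move=> n; have [_ [x Dx <-] Jx] := inf_adherent (d0 n) hinf.
  by exists x.
(* Parallelogram law at the midpoint [z]: as [J z >= m], two near minimisers have close images under
   [S]. *)
have par x y ex : D x -> D y -> J x < m + ex -> J y < m + ex ->
    sqnorm (S x - S y) <= 4 * ex.
  move=> Dx Dy Jx Jy; pose z := (2^-1)%:C%C *: x + (2^-1)%:C%C *: y.
  have Dz : D z by apply: DD => //; exact: DZ.
  have := mJ _ Dz; move: Jx Jy; rewrite /J sqnormB ll ?lZ//; last exact: DZ.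
  rewrite /z SD !SZ sqnormD !sqnormZR -/(Rin _ _) RinZl RinZr; lra.
have cu : hcauchy (S \o u).
  move=> e e0; have [N hN] : exists N, 4 * d N < e ^+ 2.
    have e4 : 0 < e ^+ 2 / 4 by rewrite divr_gt0 ?exprn_gt0.
    exists (Num.trunc ((e ^+ 2 / 4)^-1)).
    rewrite mulrC -ltr_pdivlMr//; rewrite /d -ltf_pV2 ?posrE ?invr_gt0//.
    by rewrite invrK truncnS_gt.
  exists N => i j Ni Nj; rewrite ltr_hnorm ?(ltW e0)//.
  apply: le_lt_trans hN; apply: par; [exact: (hu _).1|exact: (hu _).1| |];
    (apply: lt_le_trans (hu _).2 _; rewrite lerD2l lef_pV2 ?posrE//);
    by rewrite ler_nat.
have [p up] := hV _ cu.
have dn0 : d @ \oo --> (0 : R) by exact: (@cvg_harmonic R).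
have key x : D x -> Rin (S x) p = l x.
  move=> Dx; apply/eqP; rewrite -subr_eq0; apply/eqP.
  apply: (@Rin_quadratic_eq0 _ (sqnorm (S x))) => t.
  (* Compare [J (t x + u n) >= m] with [J (u n) < m + d n]: the variation at [u n] in the direction
     [x] is nonnegative up to [d n], which vanishes in the limit. *)
  have h n : 0 <= (t * (Rin (S (u n)) (S x) - l x) *+ 2 + t ^+ 2 * sqnorm (S x)) + d n.
    have Du := (hu n).1; have := mJ _ (DD t%:C%C _ _ Dx Du).
    have := (hu n).2; rewrite /J SD SZ ll// sqnormD sqnormZR -/(Rin _ _) RinZl.
    rewrite (RinC (S x)); lra.
  have cv : (fun n => (t * (Rin (S (u n)) (S x) - l x) *+ 2 +
      t ^+ 2 * sqnorm (S x)) + d n) @ \oo -->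
      (t * (Rin p (S x) - l x) *+ 2 + t ^+ 2 * sqnorm (S x)) + 0.
    apply: cvgD => //; apply: cvgD; last exact: cvg_cst.
    apply: cvgMn; apply: cvgMr; apply: cvgB; last exact: cvg_cst.
    exact: (hcvg_Rin up).
  rewrite RinC -[leRHS]addr0 -(cvg_lim (@Rhausdorff R) cv).
  apply: limr_ge; first by apply/cvg_ex; eexists; exact: cv.
  by near=> n; exact: h.
exists p; split => //.
(* The inequality [<S (u n), p> = l (u n) <= c |S (u n)|] becomes [|p|^2 <= c |p|] in the limit. *)
- have pc : sqnorm p <= c * hnorm p.
    have h1 : (fun n => Rin (S (u n)) p) @ \oo --> Rin p p by exact: (hcvg_Rin up).
    have h2 : (fun n => c * hnorm (S (u n))) @ \oo --> c * hnorm p.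
      by apply: cvgMr; exact: (hcvg_hnorm up).
    rewrite -Rinxx; apply: ler_cvg_to h1 h2 _.
    by near=> n; rewrite key ?lc//; exact: (hu _).1.
  rewrite -hnorm_sqr in pc; have := hnorm_ge0 p; nra.
- move=> e e0; move/hcvgP: up => /(_ e e0)[N hN].
  by exists (u N); [exact: (hu _).1|rewrite hnorm_distC; exact: hN].
Unshelve. all: by end_near. Qed.

End Riesz.

(** * Adjoints and orthogonal projections *)

Section Operators.
Context (R : realType).
Implicit Types V W : innerType R.

Lemma Im_inner_Rinl V (x y : V) : complex.Im (inner x y) = Rin ((- 'i)%C *: x) y.
Proof. by rewrite /Rin innerZl; case: (inner x y) => a b /=; ring. Qed.

(** The imaginary part of [<x, y>] is the real part of [<- i x, y>], so representing a real
    functional on a complex subspace represents the complex one. *)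
Lemma inner_ext V W (x y : V) (x' y' : W) : Rin x y = Rin x' y' ->
  Rin ((- 'i)%C *: x) y = Rin ((- 'i)%C *: x') y' -> inner x y = inner x' y'.
Proof.
rewrite -!Im_inner_Rinl /Rin.
by case: (inner x y) (inner x' y') => a b [c d] /= -> ->.
Qed.

Lemma linear_add (V W : lmodType R[i]) (T : V -> W) : linear T -> {morph T : x y / x + y}.
Proof. by move=> lT x y; have := lT 1 x y; rewrite !scale1r. Qed.

Lemma linear_zero (V W : lmodType R[i]) (T : V -> W) : linear T -> T 0 = 0.
Proof. by move=> lT; apply: (addrI (T 0)); rewrite -(linear_add lT) !addr0. Qed.

Lemma linear_scale (V W : lmodType R[i]) (T : V -> W) a x : linear T -> T (a *: x) = a *: T x.
Proof. by move=> lT; have := lT a x 0; rewrite (linear_zero lT) !addr0. Qed.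

Lemma linear_opp (V W : lmodType R[i]) (T : V -> W) x : linear T -> T (- x) = - T x.
Proof. by move=> lT; rewrite -scaleN1r (linear_scale _ _ lT) scaleN1r. Qed.

Lemma linear_sub (V W : lmodType R[i]) (T : V -> W) : linear T -> {morph T : x y / x - y}.
Proof. by move=> lT x y; rewrite (linear_add lT) (linear_opp _ lT). Qed.

Lemma adjoint_bounded V W (T : V -> W) y : hcomplete V -> bounded_operator T ->
  forall u, inner (T u) y = inner u (adjoint T y).
Proof.
move=> hV [lT [M hM]].
have M0 x : hnorm (T x) <= `|M| * hnorm x.
  by apply: le_trans (hM x) _; rewrite ler_wpM2r ?hnorm_ge0// ler_norm.
have [//|//|//|a x z _ _|x _||p [_ hp _]] := @riesz_variational R V V setT id
  (fun x => Rin (T x) y) (`|M| * hnorm y) hV.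
- by rewrite lT RinDl RinZl.
- apply: le_trans (Rin_le_hnorm _ _) _.
  by rewrite mulrAC ler_wpM2r ?hnorm_ge0.
- by rewrite mulr_ge0 ?hnorm_ge0.
rewrite /adjoint; case: xgetP => [x _ //|/(_ p)]; case => u.
have hp' v : Rin v p = Rin (T v) y by exact: hp.
by apply: inner_ext; rewrite hp'// (linear_scale _ _ lT).
Qed.

Lemma Rin_adjoint V W (T : V -> W) y u : hcomplete V -> bounded_operator T ->
  Rin (T u) y = Rin u (adjoint T y).
Proof. by move=> hV bT; rewrite /Rin adjoint_bounded. Qed.

Lemma adjoint_linear V W (T : V -> W) : hcomplete V -> bounded_operator T ->
  linear (adjoint T).
Proof.
move=> hV bT a x y; apply: Rin_inj => z.
by rewrite /Rin -adjoint_bounded// innerDr innerZr innerDr innerZr -!adjoint_bounded.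
Qed.

Lemma adjoint_contraction V W (T : V -> W) : hcomplete V -> linear T ->
  (forall x, hnorm (T x) <= hnorm x) -> forall y, hnorm (adjoint T y) <= hnorm y.
Proof.
move=> hV lT cT y.
have bT : bounded_operator T by split=> //; exists 1 => x; rewrite mul1r.
have : sqnorm (adjoint T y) <= hnorm (adjoint T y) * hnorm y.
  rewrite -Rinxx -Rin_adjoint//; apply: le_trans (Rin_le_hnorm _ _) _.
  by rewrite ler_wpM2r ?hnorm_ge0.
rewrite -hnorm_sqr; have := hnorm_ge0 (adjoint T y); have := hnorm_ge0 y; nra.
Qed.

Definition is_subspace V (D : set V) := D 0 /\ forall a x y, D x -> D y -> D (a *: x + y).

(** [D] need not be closed: the Riesz vector of [d |-> <d, x>] on [D] lies in the closure of [D],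
    which is what the last clause records. *)
Lemma orthogonal_projection V (D : set V) x : hcomplete V -> is_subspace D ->
  exists p, [/\ hnorm p <= hnorm x, forall d, D d -> Rin d (x - p) = 0 &
    forall e, 0 < e -> exists2 d, D d & hnorm (p - d) < e].
Proof.
move=> hV [D0 DD].
have [//|//|//|a y z _ _|d _||p [cp hp clp]] := @riesz_variational R V V D id
  (fun d => Rin d x) (hnorm x) hV.
- by rewrite RinDl RinZl.
- by rewrite mulrC Rin_le_hnorm.
- exact: hnorm_ge0.
by exists p; split => // d Dd; rewrite RinBr -(hp d Dd) subrr.
Qed.

Lemma orthogonal_closure V (D : set V) p q :
  (forall e, 0 < e -> exists2 d, D d & hnorm (p - d) < e) ->
  (forall d, D d -> Rin d q = 0) -> Rin p q = 0.
Proof.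
move=> clp Dq; have [->|q0] := eqVneq q 0; first by rewrite RinC Rin0l.
have q1 : 0 < hnorm q by rewrite hnorm_gt0.
apply/eqP/negPn/negP => pq; have pq0 : 0 < `|Rin p q| by rewrite normr_gt0.
have [d Dd pd] := clp (`|Rin p q| / hnorm q) (divr_gt0 pq0 q1).
have := normr_Rin_le (p - d) q; rewrite RinBl (Dq _ Dd) subr0.
by rewrite leNgt -ltr_pdivlMr// pd.
Qed.

End Operators.

(** * Positive square roots *)

Section SquareRoot.
Context (R : realType) (V : innerType R) (B : V -> V).
Context (hV : hcomplete V) (lB : linear B).
Context (saB : forall x y, Rin (B x) y = Rin x (B y)).
Context (cB : forall x, hnorm (B x) <= hnorm x).

Let h2 : R[i] := (2^-1)%:C%C.

(** Iteration for the fixed point equation [Y = (B + Y^2) / 2], which is equivalent to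
    [(I - Y)^2 = I - B]. *)
Fixpoint sqrt_iter (n : nat) (x : V) : V :=
  if n is m.+1 then h2 *: (B x + sqrt_iter m (sqrt_iter m x)) else 0.

(** The same recursion for the scalar [B = 1]. It increases, stays below 1, and majorises in norm
    both the iterates and their successive differences. *)
Fixpoint sqrt_bound (n : nat) : R :=
  if n is m.+1 then 2^-1 * (1 + sqrt_bound m ^+ 2) else 0.

Local Notation X := sqrt_iter.
Local Notation a := sqrt_bound.

Let a01 n : 0 <= a n <= 1.
Proof. by elim: n => [|n IH] /=; [rewrite lexx ler01|nra]. Qed.

Let a_incr n : a n <= a n.+1.
Proof. by elim: n => [|n IH] /=; [lra|have := a01 n; move: IH; rewrite /=; nra]. Qed.

Let lX n : linear (X n).
Proof.
elim: n => [|n IH] c x y /=; first by rewrite scaler0 addr0.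
by rewrite lB !IH scalerA mulrC -scalerA -scalerDr; congr (_ *: _);
  rewrite scalerDr addrACA.
Qed.

Let X_comm n (C : V -> V) : linear C -> (forall x, B (C x) = C (B x)) ->
  forall x, X n (C x) = C (X n x).
Proof.
move=> lC BC; elim: n => [|n IH] x /=; first by rewrite (linear_zero lC).
by rewrite (linear_scale _ _ lC) (linear_add lC) BC !IH.
Qed.

Let X_commX n m x : X n (X m x) = X m (X n x).
Proof. by apply: X_comm => // y; rewrite X_comm. Qed.

Let X_sa n x y : Rin (X n x) y = Rin x (X n y).
Proof.
elim: n x y => [|n IH] x y /=; first by rewrite Rin0l RinC Rin0l.
by rewrite RinZl RinZr RinDl RinDr saB !IH.
Qed.

Let X_bound n x : hnorm (X n x) <= a n * hnorm x.
Proof.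
elim: n x => [|n IH] x /=; first by rewrite hnorm0 mul0r.
rewrite hnormZR ger0_norm ?invr_ge0// -mulrA ler_wpM2l ?invr_ge0//.
apply: le_trans (ler_hnormD _ _) _; rewrite mulrDl mul1r lerD// expr2 -mulrA.
by apply: le_trans (IH _) _; rewrite ler_wpM2l ?IH//; have /andP[] := a01 n.
Qed.

(** The iterates commute, so a difference of squares factors as in the scalar case; each factor is
    then bounded by its scalar counterpart. *)
Let X_step n x : hnorm (X n.+1 x - X n x) <= (a n.+1 - a n) * hnorm x.
Proof.
elim: n x => [|n IH] x.
  by have := X_bound 1 x; rewrite /= !subr0.
have -> : X n.+2 x - X n.+1 x =
    h2 *: (X n.+1 (X n.+1 x - X n x) + X n (X n.+1 x - X n x)).
  transitivity (h2 *: ((B x + X n.+1 (X n.+1 x)) - (B x + X n (X n x)))).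
    by rewrite scalerBr.
  congr (_ *: _); rewrite (linear_sub (lX n.+1)) (linear_sub (lX n)).
  by rewrite opprD addrACA subrr add0r (X_commX n.+1 n) addrA subrK.
rewrite hnormZR ger0_norm ?invr_ge0//.
have h1 := X_bound n.+1 (X n.+1 x - X n x); have h0 := X_bound n (X n.+1 x - X n x).
have hD := ler_hnormD (X n.+1 (X n.+1 x - X n x)) (X n (X n.+1 x - X n x)).
have an := a01 n; have an1 := a01 n.+1; have ih := IH x.
have -> : a n.+2 - a n.+1 = 2^-1 * ((a n.+1 + a n) * (a n.+1 - a n)).
  transitivity (2^-1 * (1 + a n.+1 ^+ 2) - 2^-1 * (1 + a n ^+ 2)) => //; ring.
rewrite -mulrA ler_wpM2l ?invr_ge0//; apply: le_trans hD _.
apply: le_trans (lerD h1 h0) _; rewrite -mulrDl -mulrA ler_wpM2l//.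
by lra.
Qed.

Let X_dist n k x : hnorm (X (n + k) x - X n x) <= (a (n + k) - a n) * hnorm x.
Proof.
elim: k => [|k IH]; first by rewrite addn0 !subrr hnorm0 mul0r.
rewrite addnS; apply: le_trans (ler_hnorm_distD _ (X (n + k) x) _) _.
by have := X_step (n + k) x; move: IH; lra.
Qed.

Let X_cauchy x : hcauchy (X ^~ x).
Proof.
have ca : cvgn a.
  apply: nondecreasing_is_cvgn; first exact/nondecreasing_seqP.
  by exists 1 => _ [n _ <-]; have /andP[] := a01 n.
move=> e e0; have x1 : 0 < hnorm x + 1 by have := hnorm_ge0 x; lra.
have /cvgrPdist_lt/(_ (e / 2 / (hnorm x + 1)) ltac:(by rewrite !divr_gt0))[N _ hN] := ca.
have aN n m : (N <= n)%N -> (N <= m)%N -> (a n - a m) * hnorm x < e.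
  move=> /hN /= nN /hN /= mN; have : a n - a m < e / (hnorm x + 1).
    by move: nN mN; rewrite !ltr_norml mulrAC; lra.
  rewrite ltr_pdivlMr//; have := hnorm_ge0 x; have [|] := leP (a n - a m) 0; nra.
exists N => m n Nm Nn; have [mn|/ltnW nm] := leqP m n.
  rewrite hnorm_distC -(subnKC mn); apply: le_lt_trans (X_dist _ _ _) _.
  by rewrite subnKC// aN.
by rewrite -(subnKC nm); apply: le_lt_trans (X_dist _ _ _) _; rewrite subnKC// aN.
Qed.

(** The pointwise limit [L] of the iterates satisfies [2 L = B + L^2], so [I - L] squares to
    [I - B]; it is positive because [L] is a self-adjoint contraction. *)
Lemma sqrt_id_minus : exists S, positive_operator S /\ S \o S = (fun x => x - B x).
Proof.
have /choice[L XL] : forall x, exists l, hcvg (X ^~ x) l by move=> x; exact: hV.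
have Luniq x l : (forall z, (fun n => Rin (X n x) z) @ \oo --> Rin l z) -> L x = l.
  move=> h; apply: Rin_inj => z; rewrite !(RinC z).
  have /cvg_lim <- // := hcvg_Rin (y := z) (XL x).
  by have /cvg_lim -> // := h z.
have lL : linear L.
  move=> c x y; apply: Luniq => z; under eq_fun do rewrite lX RinDl.
  rewrite RinDl; apply: cvgD; last exact: (hcvg_Rin (XL y)).
  have E w : Rin (c *: w) z = Rin w (c^* *: z).
    by rewrite /Rin innerZl innerZr conjCK.
  by rewrite E; under eq_fun do rewrite E; exact: (hcvg_Rin (XL x)).
have cL x : hnorm (L x) <= hnorm x.
  have h1 : (fun n => hnorm (X n x)) @ \oo --> hnorm (L x) by exact: (hcvg_hnorm (XL x)).
  have h3 : (fun=> hnorm x) @ \oo --> hnorm x by exact: cvg_cst.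
  apply: ler_cvg_to h1 h3 _.
  near=> n; apply: le_trans (X_bound _ _) _; rewrite ler_piMl ?hnorm_ge0//.
  by have /andP[] := a01 n.
have saL x y : Rin (L x) y = Rin x (L y).
  have /cvg_lim <- // := hcvg_Rin (y := y) (XL x).
  under eq_fun do rewrite X_sa RinC.
  by have /cvg_lim -> // := hcvg_Rin (y := x) (XL y); rewrite RinC.
have L2 x : L x = h2 *: (B x + L (L x)).
  apply: Luniq => z; rewrite -cvg_shiftS /=.
  under eq_fun do rewrite RinZl RinDl.
  rewrite RinZl RinDl; apply: cvgMr; apply: cvgD; first exact: cvg_cst.
  apply: (@cvg_dist0 R _ (fun n => hnorm (X n x - L x) * hnorm z +
     hnorm (X n (L x) - L (L x)) * hnorm z)).
    move=> n; rewrite -RinBl; apply: le_trans (normr_Rin_le _ _) _.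
    rewrite -mulrDl ler_wpM2r ?hnorm_ge0//.
    apply: le_trans (ler_hnorm_distD _ (X n (L x)) _) _; rewrite lerD2r.
    rewrite -(linear_sub (lX n)); apply: le_trans (X_bound _ _) _.
    by rewrite ler_piMl ?hnorm_ge0//; have /andP[] := a01 n.
  rewrite [X in _ --> X](_ : 0 = 0 * hnorm z + 0 * hnorm z); last by ring.
  by apply: cvgD; apply: cvgMl; [exact: (XL x)|exact: (XL (L x))].
exists (fun x => x - L x); split; last first.
  apply/funext => x /=; rewrite (linear_sub lL) opprB.
  apply: Rin_inj => z; have := congr1 (Rin z) (L2 x).
  rewrite RinZr !(RinDr, RinNr); lra.
split; first split.
- by move=> c x y; rewrite lL scalerBr opprD addrACA.
- exists 2 => x; have := ler_hnormB x (L x); have := cL x; lra.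
move=> x; rewrite lecE /= -/(Rin _ _) Im_inner_Rin RinBl.
apply/andP; split; last first.
  rewrite RinBl Rinxx -hnorm_sqr subr_ge0.
  apply: le_trans (Rin_le_hnorm _ _) _; rewrite expr2.
  by rewrite ler_wpM2r ?hnorm_ge0.
(* A complex number is nonnegative only if its imaginary part vanishes; this comes from the
   self-adjointness of [L]. *)
have E (u v : V) : Rin u ('i%C *: v) = - Rin ('i%C *: u) v.
  by rewrite /Rin innerZr innerZl; case: (inner u v) => p q /=; ring.
have h1 : Rin x ('i%C *: x) = 0 by have := E x x; rewrite (RinC _ x); lra.
have h2' : Rin (L x) ('i%C *: x) = 0.
  have h3 : Rin ('i%C *: L x) x = Rin (L x) ('i%C *: x).
    by rewrite -(linear_scale _ _ lL) saL RinC.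
  by have := E (L x) x; rewrite h3; lra.
by rewrite h1 h2' subrr.
Unshelve. all: by end_near. Qed.

End SquareRoot.

(** * Completeness of Hilbert spaces and of their products *)

Section HilbertComplete.
Context (R : realType) (E : hilbertType R).

Lemma normr_hnorm (x : E) : `|x| = (hnorm x)%:C%C.
Proof.
apply/eqP; rewrite -(@eqrXn2 _ 2)// ?normr_ge0 ?lecR ?hnorm_ge0//.
by rewrite normr_inner inner_sqnorm -rmorphXn/= hnorm_sqr.
Qed.

Lemma gt0_complexE (e : R[i]) : 0 < e -> e = (complex.Re e)%:C%C /\ 0 < complex.Re e.
Proof. by rewrite ltcE => /andP[/eqP /= e0 ->]; split=> //; case: e e0 => a b /= ->. Qed.

Lemma hcvg_cvg (u : nat -> E) l : hcvg u l <-> u @ \oo --> l.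
Proof.
split=> [/hcvgP h|/cvgrPdist_lt h].
  apply/cvgrPdist_lt => e /gt0_complexE[-> e0]; have [N hN] := h _ e0.
  by exists N => // n /= Nn; rewrite distrC normr_hnorm ltcR hN.
apply/hcvgP => e e0; have [N _ hN] := h e%:C%C ltac:(by rewrite ltcR).
by exists N => n /hN /=; rewrite distrC normr_hnorm ltcR.
Qed.

Lemma hcomplete_hilbert : hcomplete E.
Proof.
move=> u cu; have : cauchy (u @ \oo).
  apply: cauchy_exP => e /gt0_complexE[-> e0]; have [N hN] := cu _ e0.
  exists (u N); exists N => // n /= Nn.
  by rewrite -ball_normE /= normr_hnorm ltcR hN.
by move=> /cauchy_cvgP/cvg_ex[l ul]; exists l; apply/hcvg_cvg.
Qed.

End HilbertComplete.

Section FastCauchy.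
Context (R : realType).

(** A Cauchy sequence converges once a subsequence does, and a subsequence can be chosen with
    increments of norm at most [2^-n], that is of squared norm at most [4^-n]. *)
Lemma hcomplete_fast (V : innerType R) :
  (forall u : nat -> V, (forall n, sqnorm (u n.+1 - u n) <= (4^-1) ^+ n) ->
     exists l, hcvg u l) -> hcomplete V.
Proof.
move=> fastV u cu.
have /choice[N hN] : forall n, exists N, forall i j, (N <= i)%N -> (N <= j)%N ->
    hnorm (u i - u j) < (2^-1) ^+ n by move=> n; apply: cu; rewrite exprn_gt0.
(* Partial sums give nondecreasing indices with [M n >= N n]. *)
pose M n := (\sum_(i < n.+1) N i)%N.
have MN n : (N n <= M n)%N by rewrite /M big_ord_recr /= leq_addl.
have MS n : (M n <= M n.+1)%N by rewrite /M [leqRHS]big_ord_recr /= leq_addr.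
have [|l hl] := fastV (u \o M).
  move=> n /=; have -> : 4^-1 ^+ n = (2^-1 ^+ n) ^+ 2 :> R.
    by rewrite -exprM mulnC exprM; congr (_ ^+ n); field.
  by rewrite -ler_hnorm ?exprn_ge0// ltW// hN// (leq_trans (MN n)).
exists l; apply/hcvgP => e e0.
have [n0 hn0] : exists n, hnorm (u (M n) - l) < e / 2 /\ (2^-1) ^+ n < e / 2.
  have [n1 hn1] := (hcvgP _ _).1 hl (e / 2) ltac:(lra).
  have /cvgrPdist_lt/(_ (e / 2) ltac:(lra))[n2 _ hn2] :=
    @cvg_expr R (2^-1) ltac:(by rewrite ger0_norm; lra).
  exists (maxn n1 n2); split; first by apply: hn1; rewrite leq_maxl.
  have := hn2 (maxn n1 n2) (leq_maxr _ _); rewrite /= sub0r normrN.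
  by rewrite ger0_norm// exprn_ge0.
exists (N n0) => n Nn; have := ler_hnorm_distD (u n) (u (M n0)) l.
have := hN n0 n (M n0) Nn (MN _); lra.
Qed.

Lemma hcomplete_pair (V W : innerType R) : hcomplete V -> hcomplete W ->
  hcomplete (V * W)%type.
Proof.
move=> hV hW u cu.
have sq x : sqnorm (x : V * W) = sqnorm x.1 + sqnorm x.2.
  by rewrite /sqnorm /= raddfD.
have n1 x : hnorm x.1 <= hnorm (x : V * W).
  by rewrite ler_hnorm ?hnorm_ge0// hnorm_sqr sq lerDl sqnorm_ge0.
have n2 x : hnorm x.2 <= hnorm (x : V * W).
  by rewrite ler_hnorm ?hnorm_ge0// hnorm_sqr sq lerDr sqnorm_ge0.
have [|l1 hl1] := hV (fun n => (u n).1).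
  move=> e /cu[N hN]; exists N => m n mN nN.
  exact: le_lt_trans (n1 (u m - u n)) (hN _ _ mN nN).
have [|l2 hl2] := hW (fun n => (u n).2).
  move=> e /cu[N hN]; exists N => m n mN nN.
  exact: le_lt_trans (n2 (u m - u n)) (hN _ _ mN nN).
exists (l1, l2); apply: (@cvg_dist0 R _
   (fun n => hnorm ((u n).1 - l1) + hnorm ((u n).2 - l2))).
  move=> n; rewrite subr0 ger0_norm ?hnorm_ge0// ler_hnorm ?addr_ge0 ?hnorm_ge0//.
  rewrite sq /= -!hnorm_sqr; have := hnorm_ge0 ((u n).1 - l1).
  have := hnorm_ge0 ((u n).2 - l2); nra.
by rewrite -[X in _ --> X](addr0 0); apply: cvgD.
Qed.

End FastCauchy.

(** * Almost everywhere convergence and completeness of L2 *)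

Section AlmostEverywhere.
Context (R : realType).
Local Open Scope ereal_scope.

(** As the limit exists only almost everywhere, [f] is replaced by the lower limit of the sequence
    before Fatou's lemma applies. *)
Lemma fatou_bound (g : nat -> angles R -> R) (f : angles R -> R) (M : \bar R) :
  (forall n, measurable_fun square (g n)) -> (forall n t, (0 <= g n t)%R) ->
  measurable_fun square f ->
  {ae mu2, forall t, square t -> g ^~ t @ \oo --> f t} ->
  (forall n, \int[mu2]_(t in square) (g n t)%:E <= M) ->
  \int[mu2]_(t in square) (f t)%:E <= M.
Proof.
move=> mg g0 mf gf gM.
have mE n : measurable_fun square (fun t => (g n t)%:E) by apply/measurable_EFinP.
have -> : \int[mu2]_(t in square) (f t)%:E =
    \int[mu2]_(t in square) limn_einf (fun n => (g n t)%:E).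
  apply: ae_eq_integral => //.
  - exact/measurable_EFinP.
  - apply: measurableT_comp => //; apply: measurable_fun_limn_esup => n.
    by apply: measurableT_comp => //; exact: mE.
  move: gf; apply: filterS => t gf tS /=; have {}gf := gf tS.
  have : (fun n => (g n t)%:E) @ \oo --> (f t)%:E.
    by apply: cvg_EFin; [exact: nearW|exact: gf].
  by move=> /cvg_limn_einf_sup[].
have g0E n t : square t -> 0 <= (g n t)%:E by rewrite lee_fin.
apply: (@le_trans _ _ (limn_einf (fun n => \int[mu2]_(t in square) (g n t)%:E))).
  exact: fatou.
rewrite limn_einf_lim; apply: lime_le; first exact: is_cvg_einfs.
apply: nearW => n; apply: le_trans (gM n); apply: ereal_inf_lbound.
exists n => //=.
Qed.

(** The series of the [2^n g n] has integral at most the sum of the [2^-n], so it is finite almost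
    everywhere; its sum at [t] serves as [C]. *)
Lemma ae_geometric_bound (g : nat -> angles R -> R) :
  (forall n, measurable_fun square (g n)) -> (forall n t, (0 <= g n t)%R) ->
  (forall n, \int[mu2]_(t in square) (g n t)%:E <= ((4^-1) ^+ n)%:E) ->
  {ae mu2, forall t, square t -> exists C, forall n, (g n t <= C * 2^-1 ^+ n)%R}.
Proof.
move=> mg g0 ig; pose G t := \sum_(n <oo) (2 ^+ n * g n t)%:E.
have m2g n : measurable_fun square (fun t => (2 ^+ n * g n t)%:E).
  by apply/measurable_EFinP; apply: measurable_funM.
have g20 n t : 0 <= (2 ^+ n * g n t)%:E by rewrite lee_fin mulr_ge0// exprn_ge0.
have mG : measurable_fun square G by apply: ge0_emeasurable_sum => // n t _ _.
have G0 t : 0 <= G t by apply: nneseries_ge0.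
have iG : mu2.-integrable square G.
  apply/integrableP; split => //; under eq_integral do rewrite gee0_abs//.
  rewrite integral_nneseries//.
  apply: (@le_lt_trans _ _ (\sum_(n <oo) ((2^-1) ^+ n)%:E)).
    apply: lee_nneseries => n *; first by apply: integral_ge0 => t _; exact: g20.
    under eq_integral do rewrite EFinM.
    have -> : \int[mu2]_(t in square) ((2 ^+ n)%:E * (g n t)%:E) =
        (2 ^+ n)%:E * \int[mu2]_(t in square) (g n t)%:E.
      apply: ge0_integralZl => //.
      - by apply/measurable_EFinP; exact: mg.
      - by move=> t _; rewrite lee_fin.
    apply: (le_trans (lee_wpmul2l _ (ig n))); first by rewrite lee_fin exprn_ge0.
    by rewrite -EFinM lee_fin -exprMn (_ : (2 * 4^-1 = 2^-1 :> R)%R)//; field.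
  apply: (@le_lt_trans _ _ 2%:E); last by rewrite ltry.
  apply: lime_le; first by apply: is_cvg_nneseries => n *; rewrite lee_fin exprn_ge0.
  apply: nearW => k; rewrite sumEFin lee_fin.
  suff -> : (\sum_(0 <= n < k) 2^-1 ^+ n = 2 - 2 * 2^-1 ^+ k :> R)%R.
    by rewrite gerBl mulr_ge0// exprn_ge0.
  elim: k => [|k IH]; first by rewrite big_geq// expr0; lra.
  by rewrite big_nat_recr//= IH exprS; field.
have : {ae mu2, forall t, square t -> G t \is a fin_num} by exact: integrable_ae.
apply: filterS => t h tS.
exists (fine (G t)) => n; rewrite -ler_pdivrMr ?exprn_gt0// exprVn invrK mulrC.
rewrite -lee_fin fineK ?h//.
apply: le_trans (nneseries_lim_ge n.+1 (fun i _ _ => g20 i t)).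
by rewrite big_nat_recr//= leeDr// sume_ge0.
Qed.

End AlmostEverywhere.

Section L2Complete.
Context (R : realType) (E : sepHilbertType R).
Implicit Types (u v : L2 E) (f g : angles R -> E).

Lemma weakly_measurable_Rin f : (forall y, measurable_fun square (fun t => Rin (f t) y)) ->
  weakly_measurable f.
Proof.
move=> mf y; split; first exact: mf.
by under eq_fun do rewrite Im_inner; exact: mf.
Qed.

Lemma weakly_measurableB f g :
  weakly_measurable f -> weakly_measurable g -> weakly_measurable (f - g).
Proof.
by move=> mf mg; rewrite -scaleN1r; apply/weakly_measurableD/weakly_measurableZ.
Qed.

Lemma sqnorm_L2 u : sqnorm u = \int[mu2]_(t in square) sqnorm (L2fun u t).
Proof. by rewrite /sqnorm -[inner u u]/(L2inner u u) L2inner_sqnorm. Qed.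

Lemma integrable_sqnorm f : square_integrable f ->
  mu2.-integrable square (fun t => (sqnorm (f t))%:E).
Proof.
move=> [mf fi]; apply/integrableP; split.
  by apply/measurable_EFinP; exact: measurable_sqnorm.
by under eq_integral do rewrite gee0_abs ?lee_fin ?sqnorm_ge0//.
Qed.

Lemma integral_sqnorm_L2 u :
  (\int[mu2]_(t in square) (sqnorm (L2fun u t))%:E)%E = (sqnorm u)%:E.
Proof.
rewrite sqnorm_L2 /Rintegral fineK//.
by apply: integrable_fin_num => //; exact: integrable_sqnorm (L2funP u).
Qed.

Lemma L2funB u v :
  L2fun (u - v) = (fun t => L2fun u t - L2fun v t) %[ae mu2 in square].
Proof.
rewrite -scaleN1r; move: (L2funD u (-1 *: v)) (L2funZ (-1) v).
by apply: filterS2 => t h1 h2 tS; rewrite h1// h2// scaleN1r.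
Qed.

(* The limit function is set to [0] on a measurable null set carrying the bad points. *)
Lemma weakly_measurable_lim (f : nat -> angles R -> E) (g : angles R -> E) :
  (forall n, weakly_measurable (f n)) ->
  {ae mu2, forall t, square t -> f ^~ t @ \oo --> g t} ->
  exists2 h, weakly_measurable h & {ae mu2, forall t, square t -> h t = g t}.
Proof.
move=> mf [N [mN N0 Nbad]].
have {}Nbad t : square t -> ~ N t -> f ^~ t @ \oo --> g t.
  by move=> tS Nt; apply: contrapT => h; apply: Nt; apply: Nbad => /= /(_ tS).
pose h t := if t \in N then 0 else g t.
exists h; last first.
  exists N; split=> // t /= ht; apply: contrapT => Nt; apply: ht => tS.
  by rewrite /h memNset.
apply: weakly_measurable_Rin => y.
apply: (@measurable_fun_cvg _ _ _ _ (fun n t => if t \in N then 0 else Rin (f n t) y)).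
  move=> n; apply: measurable_fun_if => //.
  - apply: (measurable_fun_bool true) => /=.
    rewrite (_ : _ @^-1` _ = N); first by apply: measurableI => //; exact: measurable_square.
    by apply/seteqP; split=> t /=; [move/set_mem|move/mem_set].
  - by apply: measurable_funS (mf n y).1 => // t [].
move=> t tS; rewrite /h; case: ifPn => tN; first by rewrite Rin0l; exact: cvg_cst.
have : hcvg (f ^~ t) (g t).
  by apply/hcvg_cvg/Nbad => //; move: tN; rewrite notin_setE.
exact: hcvg_Rin.
Qed.

Lemma geometric_bound_cauchy (u : nat -> E) C :
  (forall n, sqnorm (u n.+1 - u n) <= C * 2^-1 ^+ n) -> hcauchy u.
Proof.
move=> uC; have C0 : 0 <= C.
  by have := uC 0%N; rewrite expr0 mulr1; apply: le_trans; exact: sqnorm_ge0.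
(* A ratio [1/2] for squared norms is the ratio [q] for norms. *)
pose q : R := Num.sqrt 2^-1.
have q0 : 0 <= q by exact: sqrtr_ge0.
have q2 : q ^+ 2 = 2^-1 by rewrite sqr_sqrtr ?invr_ge0.
have q1 : q < 1 by rewrite -(@ltr_pXn2r _ 2)// ?nnegrE// q2 expr1n; lra.
pose D := Num.sqrt C / (1 - q).
have D0 : 0 <= D by rewrite divr_ge0 ?sqrtr_ge0//; lra.
have step n : hnorm (u n.+1 - u n) <= Num.sqrt C * q ^+ n.
  rewrite ler_hnorm ?mulr_ge0 ?sqrtr_ge0 ?exprn_ge0//.
  by rewrite exprMn sqr_sqrtr// -exprM mulnC exprM q2.
have dist n k : hnorm (u (n + k)%N - u n) <= D * q ^+ n - D * q ^+ (n + k).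
  elim: k => [|k IH]; first by rewrite addn0 !subrr hnorm0.
  rewrite addnS; apply: le_trans (ler_hnorm_distD _ (u (n + k)%N) _) _.
  have := step (n + k)%N.
  have -> : Num.sqrt C * q ^+ (n + k) = D * q ^+ (n + k) - D * q ^+ (n + k).+1.
    by rewrite exprS /D; field; lra.
  lra.
move=> e e0.
have /cvgrPdist_lt/(_ e e0)[N _ hN] : (fun n => D * q ^+ n) @ \oo --> D * 0.
  by apply: cvgMr; apply: cvg_expr; rewrite ger0_norm.
have {}hN n : (N <= n)%N -> D * q ^+ n < e.
  move=> /hN; rewrite /= mulr0 sub0r normrN ger0_norm// mulr_ge0// exprn_ge0//.
have Dq n : 0 <= D * q ^+ n by rewrite mulr_ge0// exprn_ge0.
exists N => m n Nm Nn; have [mn|/ltnW nm] := leqP m n.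
  rewrite hnorm_distC -(subnKC mn); apply: le_lt_trans (dist _ _) _.
  by have := hN _ Nm; have := Dq (m + (n - m))%N; lra.
rewrite -(subnKC nm); apply: le_lt_trans (dist _ _) _.
by have := hN _ Nn; have := Dq (n + (m - n))%N; lra.
Qed.

(** Riesz-Fischer: representatives of a fast sequence converge almost everywhere, and Fatou's lemma
    bounds the distance to their limit. *)
Lemma L2_complete : hcomplete (L2 E).
Proof.
apply: hcomplete_fast => u fu.
have mu n : weakly_measurable (L2fun (u n)) := (L2funP (u n)).1.
pose d n t := L2fun (u n.+1) t - L2fun (u n) t.
have md n : weakly_measurable (d n) by exact: weakly_measurableB (mu _) (mu _).
have dint m n : (\int[mu2]_(t in square) (sqnorm (L2fun (u m) t - L2fun (u n) t))%:E)%E =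
    (sqnorm (u m - u n))%:E.
  rewrite -integral_sqnorm_L2; apply: ae_eq_integral => //.
  - by apply/measurable_EFinP; apply: measurable_sqnorm; exact: weakly_measurableB (mu _) (mu _).
  - by apply/measurable_EFinP; apply: measurable_sqnorm (L2funP _).1.
  - by move: (L2funB (u m) (u n)); apply: filterS => t h tS; rewrite h.
have aecv : {ae mu2, forall t, square t ->
    (fun n => L2fun (u n) t) @ \oo --> lim ((fun n => L2fun (u n) t) @ \oo)}.
  have : {ae mu2, forall t, square t -> exists C, forall n, sqnorm (d n t) <= C * 2^-1 ^+ n}.
    apply: (@ae_geometric_bound _ (fun n t => sqnorm (d n t))).
    - by move=> n; exact: measurable_sqnorm.
    - by move=> n t; exact: sqnorm_ge0.
    - by move=> n; rewrite dint lee_fin.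
  apply: filterS => t h tS; have [C hC] := h tS.
  have [l /hcvg_cvg hl] := hcomplete_hilbert (geometric_bound_cauchy hC).
  by rewrite (cvg_lim _ hl).
have [h mh hE] := weakly_measurable_lim mu aecv.
(* Telescoping bounds distances in the sequence by [2 * 2^-n]; the square of this is at most
   [4 * 2^-n]. *)
have bound n : (\int[mu2]_(t in square) (sqnorm (L2fun (u n) t - h t))%:E <=
    (4 * 2^-1 ^+ n)%:E)%E.
  pose g k t := sqnorm (L2fun (u n) t - L2fun (u (n + k)%N) t).
  apply: (@fatou_bound _ g).
  - by move=> k; apply: measurable_sqnorm; exact: weakly_measurableB (mu _) (mu _).
  - by move=> k t; exact: sqnorm_ge0.
  - by apply: measurable_sqnorm; exact: weakly_measurableB (mu _) mh.
  - move: aecv hE; apply: filterS2 => t h1 h2 tS.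
    have {h1}/hcvg_cvg h1 := h1 tS; rewrite h2//.
    apply: hcvg_sqnorm.
    apply: (@cvg_dist0 R _ (fun k => hnorm (L2fun (u (n + k)%N) t -
       lim ((fun n => L2fun (u n) t) @ \oo)))).
      move=> k; rewrite subr0 ger0_norm ?hnorm_ge0// opprB addrC addrA subrK.
      by rewrite hnorm_distC.
    under eq_fun do rewrite addnC.
    by move: h1; rewrite /hcvg -(cvg_shiftn n).
  - move=> k; rewrite dint lee_fin.
    have step i : hnorm (u i.+1 - u i) <= 2^-1 ^+ i.
      rewrite ler_hnorm ?exprn_ge0// -exprM mulnC exprM.
      by rewrite (_ : 2^-1 ^+ 2 = 4^-1 :> R) ?fu//; field.
    have dist j : hnorm (u n - u (n + j)%N) <= 2 * 2^-1 ^+ n - 2 * 2^-1 ^+ (n + j).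
      elim: j => [|j IH]; first by rewrite addn0 !subrr hnorm0.
      rewrite addnS; apply: le_trans (ler_hnorm_distD _ (u (n + j)%N) _) _.
      by have := step (n + j)%N; rewrite (hnorm_distC _ (u (n + j).+1)) exprS; lra.
    have p0 m : 0 <= 2^-1 ^+ m :> R by rewrite exprn_ge0.
    have p1 : 2^-1 ^+ n <= 1 :> R by rewrite exprn_ile1//; lra.
    rewrite -hnorm_sqr; have := dist k; have := hnorm_ge0 (u n - u (n + k)%N).
    have := p0 n; have := p0 (n + k)%N; nra.
have hP : square_integrable h.
  have h0 : square_integrable (L2fun (u 0%N) - h).
    split; first exact: weakly_measurableB.
    by apply: le_lt_trans (bound 0%N) _; rewrite ltry.
  rewrite (_ : h = L2fun (u 0%N) + (-1) *: (L2fun (u 0%N) - h)).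
    by apply: square_integrableD; [exact: L2funP|exact: square_integrableZ].
  by rewrite scaleN1r opprB addrCA subrr addr0.
exists (L2class hP); apply: (@cvg_dist0 R _ (fun n => 2 * Num.sqrt 2^-1 ^+ n)).
  move=> n; rewrite subr0 ger0_norm ?hnorm_ge0//.
  rewrite ler_hnorm ?mulr_ge0 ?exprn_ge0 ?sqrtr_ge0// exprMn -exprM mulnC exprM.
  rewrite sqr_sqrtr ?invr_ge0// -lee_fin -integral_sqnorm_L2.
  rewrite (_ : 2 ^+ 2 = 4 :> R); last by rewrite -natrX.
  apply: le_trans (bound n); rewrite le_eqVlt; apply/orP; left; apply/eqP.
  apply: ae_eq_integral => //.
  - by apply/measurable_EFinP; apply: measurable_sqnorm (L2funP _).1.
  - by apply/measurable_EFinP; apply: measurable_sqnorm; exact: weakly_measurableB.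
  - move: (L2funB (u n) (L2class hP)) (L2fun_class hP).
    by apply: filterS2 => t h1 h2 tS; rewrite h1// h2.
rewrite -(mulr0 2); apply: cvgMr; apply: cvg_expr.
rewrite ger0_norm ?sqrtr_ge0// -(@ltr_pXn2r _ 2)// ?nnegrE ?sqrtr_ge0//.
by rewrite sqr_sqrtr ?invr_ge0// expr1n; lra.
Qed.

End L2Complete.

(** * Cauchy's formula on the unit disc *)

Section ComplexModulus.
Context (R : realType).
Implicit Types z w : R[i].

(** The norm of a complex number is itself of type [R[i]]; its real part is the form usable in real
    arithmetic. *)
Definition cabs z : R := complex.Re `|z|.

Lemma cabsE z : `|z| = (cabs z)%:C%C.
Proof. by rewrite /cabs normc_def. Qed.

Lemma cabs_ge0 z : 0 <= cabs z.
Proof. by rewrite -lecR -cabsE normr_ge0. Qed.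

Lemma cabs_eq0 z : (cabs z == 0) = (z == 0).
Proof. by rewrite -[RHS]normr_eq0 cabsE eq_complex /= eqxx andbT. Qed.

Lemma cabs_gt0 z : (0 < cabs z) = (z != 0).
Proof. by rewrite lt_def cabs_eq0 cabs_ge0 andbT. Qed.

Lemma cabs0 : cabs 0 = 0.
Proof. by apply/eqP; rewrite cabs_eq0. Qed.

Lemma cabs1 : cabs 1 = 1.
Proof. by rewrite /cabs normr1. Qed.

Lemma cabsM z w : cabs (z * w) = cabs z * cabs w.
Proof. by apply: complexI; rewrite -cabsE normrM !cabsE rmorphM. Qed.

Lemma cabsV z : cabs z^-1 = (cabs z)^-1.
Proof. by apply: complexI; rewrite -cabsE normfV cabsE fmorphV. Qed.

Lemma cabsX z n : cabs (z ^+ n) = cabs z ^+ n.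
Proof. by elim: n => [|n IH]; rewrite ?cabs1// !exprS cabsM IH. Qed.

Lemma cabsN z : cabs (- z) = cabs z.
Proof. by rewrite /cabs normrN. Qed.

Lemma cabsJ z : cabs z^* = cabs z.
Proof. by rewrite /cabs normcJ. Qed.

Lemma cabsR (a : R) : cabs a%:C%C = `|a|.
Proof. by rewrite /cabs normc_def /= expr0n addr0 sqrtr_sqr. Qed.

Lemma cabsD z w : cabs (z + w) <= cabs z + cabs w.
Proof. by rewrite -lecR rmorphD /= -!cabsE ler_normD. Qed.

Lemma cabsB z w : cabs (z - w) <= cabs z + cabs w.
Proof. by rewrite -(cabsN w) cabsD. Qed.

Lemma cabs_distC z w : cabs (z - w) = cabs (w - z).
Proof. by rewrite -opprB cabsN. Qed.

Lemma cabs_sqr z : cabs z ^+ 2 = complex.Re z ^+ 2 + complex.Im z ^+ 2.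
Proof. by rewrite /cabs normc_def /= sqr_sqrtr// addr_ge0 ?sqr_ge0. Qed.

Lemma cabs_sqrJ z : (cabs z ^+ 2)%:C%C = z * z^*.
Proof. by rewrite rmorphXn /= -cabsE sqr_normc. Qed.

Lemma normr_Re_le z : `|complex.Re z| <= cabs z.
Proof.
by rewrite -(@ler_pXn2r _ 2)// ?nnegrE ?cabs_ge0// cabs_sqr real_normK ?num_real// lerDl sqr_ge0.
Qed.

Lemma normr_Im_le z : `|complex.Im z| <= cabs z.
Proof.
by rewrite -(@ler_pXn2r _ 2)// ?nnegrE ?cabs_ge0// cabs_sqr real_normK ?num_real// lerDr sqr_ge0.
Qed.

Lemma cabs_le_ReIm z : cabs z <= `|complex.Re z| + `|complex.Im z|.
Proof.
rewrite -(@ler_pXn2r _ 2)// ?nnegrE ?cabs_ge0 ?addr_ge0// cabs_sqr sqrrD.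
rewrite !real_normK ?num_real// addrAC lerDl.
by rewrite mulrn_wge0// mulr_ge0.
Qed.

Lemma complex_eq z w : complex.Re z = complex.Re w -> complex.Im z = complex.Im w -> z = w.
Proof. by case: z w => a b [c d] /= -> ->. Qed.

End ComplexModulus.

Section ComplexContinuity.
Context (R : realType).

Lemma continuous_Re : continuous (fun z : R[i]^o => complex.Re z : R).
Proof.
move=> z; apply/(@cvgrPdist_lt _ _ _ (nbhs (z : R[i]^o)) (nbhs_filter (z : R[i]^o))) => e e0.
have ec : 0 < e%:C%C by rewrite ltcR.
have : nbhs z (ball z e%:C%C) by exact: nbhsx_ballx.
apply: filterS => w; rewrite -ball_normE /= cabsE ltcR -raddfB; apply: le_lt_trans.
exact: normr_Re_le.
Qed.

Lemma continuous_Im : continuous (fun z : R[i]^o => complex.Im z : R).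
Proof.
move=> z; apply/(@cvgrPdist_lt _ _ _ (nbhs (z : R[i]^o)) (nbhs_filter (z : R[i]^o))) => e e0.
have ec : 0 < e%:C%C by rewrite ltcR.
have : nbhs z (ball z e%:C%C) by exact: nbhsx_ballx.
apply: filterS => w; rewrite -ball_normE /= cabsE ltcR -raddfB; apply: le_lt_trans.
exact: normr_Im_le.
Qed.

Lemma cvg_complex (T : Type) (F : set_system T) (FF : Filter F) (f : T -> R[i]^o) (l : R[i]^o) :
  (fun x => complex.Re (f x)) @ F --> complex.Re l ->
  (fun x => complex.Im (f x)) @ F --> complex.Im l -> f @ F --> l.
Proof.
move=> /cvgrPdist_lt h1 /cvgrPdist_lt h2; apply/cvgrPdist_lt => e /gt0_complexE[-> e0].
near=> x; rewrite cabsE ltcR; apply: le_lt_trans (cabs_le_ReIm _) _.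
rewrite !raddfB /=; have -> : complex.Re e = complex.Re e / 2 + complex.Re e / 2 by lra.
by rewrite ltrD//; near: x; [apply: h1|apply: h2]; lra.
Unshelve. all: by end_near. Qed.

Lemma continuous_real_complex : continuous (fun a : R => a%:C%C : R[i]^o).
Proof. by move=> a; apply: cvg_complex => /=; [exact: cvg_id|exact: cvg_cst]. Qed.

Lemma continuous_conj : continuous (fun z : R[i]^o => z^* : R[i]^o).
Proof.
move=> z; apply/(@cvgrPdist_lt _ _ _ (nbhs (z : R[i]^o)) (nbhs_filter (z : R[i]^o))) => e e0.
have : nbhs z (ball z e) by exact: nbhsx_ballx.
by apply: filterS => w; rewrite -ball_normE /= -rmorphB /= normcJ.
Qed.

Lemma cos_cvg (a : R) : continuous (fun t : R => cos (a * t)).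
Proof.
move=> t; apply: (@continuous_comp _ _ _ (fun t => a * t) cos).
  by apply: cvgM; [exact: cvg_cst|exact: cvg_id].
exact: continuous_cos.
Qed.

Lemma sin_cvg (a : R) : continuous (fun t : R => sin (a * t)).
Proof.
move=> t; apply: (@continuous_comp _ _ _ (fun t => a * t) sin).
  by apply: cvgM; [exact: cvg_cst|exact: cvg_id].
exact: continuous_sin.
Qed.

Lemma continuous_cis : continuous (@cis R : R -> R[i]^o).
Proof. by move=> t; apply: cvg_complex => /=; [exact: cos_cvg|exact: sin_cvg]. Qed.

Lemma cabs_cis (t : R) : cabs (cis t) = 1.
Proof.
apply/eqP; rewrite -(@eqrXn2 _ 2)// ?cabs_ge0// cabs_sqr /=.
by rewrite cos2Dsin2 expr1n.
Qed.

Lemma cisJ (t : R) : cis t * (cis t)^* = 1.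
Proof. by rewrite -cabs_sqrJ cabs_cis expr1n. Qed.

Lemma cis0 : cis (0 : R) = 1.
Proof. by rewrite /cis mulr0 cos0 sin0. Qed.

Lemma cis1 : cis (1 : R) = 1.
Proof. by rewrite /cis mulr1 mulr_natl cos2pi sin2pi. Qed.

Lemma cisD (s t : R) : cis (s + t) = cis s * cis t.
Proof.
rewrite /cis mulrDr cosD sinD; apply: complex_eq => //=; ring.
Qed.

End ComplexContinuity.

(** * Integrals of continuous complex functions *)

Section ComplexIntegral.
Context (R : realType).
Implicit Types (a b c d : R) (f g : R -> R[i]^o).

Local Notation mu := (@lebesgue_measure R).

Definition cint a b f : R[i] :=
  ((\int[mu]_(x in `[a, b]) complex.Re (f x)) +i*
   (\int[mu]_(x in `[a, b]) complex.Im (f x)))%C.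

Definition ccont a b f := forall x, a <= x <= b -> {for x, continuous f}.

Lemma integrable_cont a b (f : R -> R) : (forall x, a <= x <= b -> {for x, continuous f}) ->
  mu.-integrable `[a, b] (EFin \o f).
Proof.
move=> cf; apply: continuous_compact_integrable; first exact: segment_compact.
by apply: continuous_in_subspaceT => x /set_mem /=; rewrite in_itv /=; exact: cf.
Qed.

Lemma ccont_Re a b f : ccont a b f ->
  mu.-integrable `[a, b] (EFin \o (fun x => complex.Re (f x))).
Proof.
move=> cf; apply: integrable_cont => x /cf cx.
by apply: (@continuous_comp _ _ _ f (fun z => complex.Re z)); [|exact: continuous_Re].
Qed.

Lemma ccont_Im a b f : ccont a b f ->
  mu.-integrable `[a, b] (EFin \o (fun x => complex.Im (f x))).
Proof.
move=> cf; apply: integrable_cont => x /cf cx.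
by apply: (@continuous_comp _ _ _ f (fun z => complex.Im z)); [|exact: continuous_Im].
Qed.

Lemma eq_cint a b f g : (forall x, a <= x <= b -> f x = g x) -> cint a b f = cint a b g.
Proof.
move=> fg; rewrite /cint; congr (_ +i* _)%C; apply: eq_Rintegral => x /set_mem /=;
  by rewrite in_itv /= => /fg ->.
Qed.

Lemma cintD a b f g : ccont a b f -> ccont a b g ->
  cint a b (fun x => f x + g x) = cint a b f + cint a b g.
Proof.
move=> cf cg; have := ccont_Re cf; have := ccont_Im cf.
have := ccont_Re cg; have := ccont_Im cg => g1 g2 f1 f2.
apply: complex_eq; rewrite raddfD /= -RintegralD//; apply: eq_Rintegral => x _;
  by rewrite raddfD.
Qed.

Lemma cintZ a b (k : R[i]) f : ccont a b f ->
  cint a b (fun x => k * f x) = k * cint a b f.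
Proof.
move=> cf; have f1 := ccont_Re cf; have f2 := ccont_Im cf.
have iZ (r : R) (h : R -> R) : mu.-integrable `[a, b] (EFin \o h) ->
    mu.-integrable `[a, b] (EFin \o (fun t => r * h t)).
  by move=> hi; exact: (integrableZl _ r hi).
apply: complex_eq; case: k => p q /=; rewrite -!RintegralZl//.
- rewrite -RintegralB//; [|exact: iZ|exact: iZ].
  by apply: eq_Rintegral => x _; case: (f x).
- rewrite -RintegralD//; [|exact: iZ|exact: iZ].
  by apply: eq_Rintegral => x _; case: (f x).
Qed.

Lemma ccontZ a b k f : ccont a b f -> ccont a b (fun x => k * f x : R[i]^o).
Proof. by move=> cf x /cf; apply: cvgM; exact: cvg_cst. Qed.

Lemma ccontM a b f g : ccont a b f -> ccont a b g -> ccont a b (fun x => f x * g x).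
Proof. by move=> cf cg x xab; apply: cvgM; [exact: cf|exact: cg]. Qed.

Lemma cintB a b f g : ccont a b f -> ccont a b g ->
  cint a b (fun x => f x - g x) = cint a b f - cint a b g.
Proof.
move=> cf cg; transitivity (cint a b (fun x => f x + (-1) * g x)).
  by apply: eq_cint => x _; rewrite mulN1r.
by rewrite (cintD cf (ccontZ (k := -1) cg)) (cintZ _ cg) mulN1r.
Qed.

Lemma ccontB a b f g : ccont a b f -> ccont a b g -> ccont a b (fun x => f x - g x).
Proof. by move=> cf cg x xab; apply: cvgB; [exact: cf|exact: cg]. Qed.

Lemma cint_split a c b f : a <= c <= b -> ccont a b f ->
  cint a b f = cint a c f + cint c b f.
Proof.
move=> /andP[ac cb] cf; have key (h : R -> R) : mu.-integrable `[a, b] (EFin \o h) ->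
    \int[mu]_(x in `[a, b]) h x = \int[mu]_(x in `[a, c]) h x + \int[mu]_(x in `[c, b]) h x.
  move=> ih; rewrite -[X in _ + X]Rintegral_itv_obnd_cbnd; last first.
    apply: integrableS ih => //; apply: subset_itv; rewrite bnd_simp//.
  have := Rintegral_itvB ih (x := c); rewrite !bnd_simp => /(_ ac cb) <-; ring.
apply: complex_eq; rewrite raddfD /=; apply: key; [exact: ccont_Re|exact: ccont_Im].
Qed.

(** The factor 2 pays for bounding the real and the imaginary part separately. *)
Lemma cint_bound a b f (M : R) : a <= b -> ccont a b f ->
  (forall x, a <= x <= b -> cabs (f x) <= M) -> cabs (cint a b f) <= 2 * (M * (b - a)).
Proof.
move=> ab cf fM; have key (h : R -> R) : mu.-integrable `[a, b] (EFin \o h) ->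
    (forall x, a <= x <= b -> `|h x| <= M) -> `|\int[mu]_(x in `[a, b]) h x| <= M * (b - a).
  move=> ih hM; apply: le_trans (le_normr_Rintegral _ ih) _ => //.
  have -> : M * (b - a) = \int[mu]_(x in `[a, b]) M.
    rewrite Rintegral_cst//= lebesgue_measure_itv/= lte_fin.
    by move: ab; rewrite le_eqVlt => /predU1P[->|->]//; rewrite ltxx subrr.
  apply: le_Rintegral => //.
  - exact: (integrable_norm ih).
  - by apply: integrable_cont => x _; exact: cvg_cst.
apply: (le_trans (cabs_le_ReIm _)); rewrite mulr_natl mulr2n /=.
apply: lerD; apply: key; [exact: ccont_Re| |exact: ccont_Im|] => x /fM;
  apply: le_trans; [exact: normr_Re_le|exact: normr_Im_le].
Qed.

Lemma cint_cst a b (k : R[i]) : a <= b -> cint a b (fun=> k) = (b - a)%:C%C * k.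
Proof.
move=> ab; have E (r : R) : \int[mu]_(x in `[a, b]) r = (b - a) * r.
  rewrite mulrC Rintegral_cst//= lebesgue_measure_itv/= lte_fin.
  by move: ab; rewrite le_eqVlt => /predU1P[->|->]//; rewrite ltxx subrr.
by rewrite /cint !E; case: k => p q /=; apply: complex_eq => /=; ring.
Qed.

End ComplexIntegral.

Lemma nbhs_cabs (R : realType) (z : R[i]^o) (r : R) : 0 < r ->
  nbhs z [set w | cabs (w - z) < r].
Proof.
move=> r0; have : nbhs z (ball z r%:C%C) by apply: nbhsx_ballx; rewrite ltcR.
by apply: filterS => w; rewrite -ball_normE /= cabsE ltcR cabs_distC.
Qed.

Lemma nbhs_cabsP (R : realType) (z : R[i]^o) (P : set R[i]) : nbhs z P ->
  exists2 r : R, 0 < r & forall w, cabs (w - z) < r -> P w.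
Proof.
move=> /nbhs_ballP[e /= /gt0_complexE[-> e0] he]; exists (complex.Re e) => // w wz.
by apply: he; rewrite -ball_normE /= cabsE ltcR cabs_distC.
Qed.

(** * Goursat's bisection *)

Section Goursat.
Context (R : realType).

Section Bisection.
Context (L1 L2 a0 c0 : R) (N : R -> R -> R -> R).
Hypotheses (L1_ge0 : 0 <= L1) (L2_ge0 : 0 <= L2).

(** A box is given by its lower corner and a common scale [l], its sides being [l * L1] and
    [l * L2], so that halving keeps the proportions. *)
Definition in_box (a c l : R) :=
  [/\ a0 <= a, a + l * L1 <= a0 + L1, c0 <= c & c + l * L2 <= c0 + L2].

(** Goursat's argument for an arbitrary function of boxes that is subadditive under quartering and
    [o(l^2)] at each point. A positive value [e] on the full box leaves at least [e h^2] on some box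
    of each scale [h = 2^-n]; the nested boxes meet in a point where the local bound with [e / 2] is
    contradicted. *)
Lemma goursat_bisection :
  (forall a c l, 0 < l -> in_box a c (l + l) ->
    N a c (l + l) <= N a c l + N (a + l * L1) c l +
      (N a (c + l * L2) l + N (a + l * L1) (c + l * L2) l)) ->
  (forall x y e, a0 <= x <= a0 + L1 -> c0 <= y <= c0 + L2 -> 0 < e ->
    exists2 d, 0 < d & forall a c l, 0 < l -> l < d -> in_box a c l ->
      a <= x <= a + l * L1 -> c <= y <= c + l * L2 -> N a c l <= e * l ^+ 2) ->
  N a0 c0 1 <= 0.
Proof.
move=> sub loc; rewrite leNgt; apply/negP => N0; set e := N a0 c0 1 in N0.
pose h n : R := 2^-1 ^+ n.
have h0 n : 0 < h n by rewrite exprn_gt0.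
have hh n : h n = h n.+1 + h n.+1 by rewrite /h exprS; field.
have step (p : R * R) n : exists q : R * R,
    in_box p.1 p.2 (h n) -> e * h n ^+ 2 <= N p.1 p.2 (h n) ->
    [/\ in_box q.1 q.2 (h n.+1), e * h n.+1 ^+ 2 <= N q.1 q.2 (h n.+1),
      p.1 <= q.1 <= p.1 + h n.+1 * L1 & p.2 <= q.2 <= p.2 + h n.+1 * L2].
  case: p => a c /=.
  have [[ib Ne]|nb] := pselect (in_box a c (h n) /\ e * h n ^+ 2 <= N a c (h n)); last first.
    by exists (0, 0) => h1 h2; case: nb.
  have [i1 i2 i3 i4] := ib.
  have hL1 := mulr_ge0 (ltW (h0 n.+1)) L1_ge0.
  have hL2 := mulr_ge0 (ltW (h0 n.+1)) L2_ge0.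
  have := sub a c (h n.+1) (h0 n.+1); rewrite -hh => /(_ ib) sN.
  rewrite (hh n) mulrDl in i2; rewrite (hh n) mulrDl in i4.
  have Ne' : e * (h n.+1 + h n.+1) ^+ 2 <= N a c (h n) by rewrite -hh.
  pose good x y := [/\ in_box x y (h n.+1), e * h n.+1 ^+ 2 <= N x y (h n.+1),
    a <= x <= a + h n.+1 * L1 & c <= y <= c + h n.+1 * L2].
  suff [x [y g]] : exists x y, good x y by exists (x, y).
  have [g1|g1] := leP (e * h n.+1 ^+ 2) (N a c (h n.+1)).
    by exists a, c; split => //; [split; lra|lra|lra].
  have [g2|g2] := leP (e * h n.+1 ^+ 2) (N (a + h n.+1 * L1) c (h n.+1)).
    by exists (a + h n.+1 * L1), c; split => //; [split; lra|lra|lra].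
  have [g3|g3] := leP (e * h n.+1 ^+ 2) (N a (c + h n.+1 * L2) (h n.+1)).
    by exists a, (c + h n.+1 * L2); split => //; [split; lra|lra|lra].
  (* If three quarters carry less than their share, subadditivity leaves enough to the fourth. *)
  exists (a + h n.+1 * L1), (c + h n.+1 * L2); split; [split; lra| |lra|lra].
  by rewrite expr2 in Ne'; rewrite expr2 in g1 g2 g3 *; lra.
have /choice[F HF] := fun pn : (R * R) * nat => step pn.1 pn.2.
pose P := fix P n := if n is m.+1 then F (P m, m) else (a0, c0).
have PP n : in_box (P n).1 (P n).2 (h n) /\ e * h n ^+ 2 <= N (P n).1 (P n).2 (h n).
  elim: n => [|n [IH1 IH2]] /=.
    by rewrite /h expr0 expr1n mulr1; split => //; split; lra.
  by have [] := HF (P n, n) IH1 IH2.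
have Pst n : (P n).1 <= (P n.+1).1 <= (P n).1 + h n.+1 * L1 /\
    (P n).2 <= (P n.+1).2 <= (P n).2 + h n.+1 * L2.
  by have [IH1 IH2] := PP n; have [] := HF (P n, n) IH1 IH2.
have nested (u : nat -> R) (L : R) : (forall n, u n <= u n.+1 <= u n + h n.+1 * L) ->
    0 <= L -> exists x, forall n, u n <= x <= u n + h n * L.
  move=> hu L0.
  have mono n k : u n <= u (n + k)%N.
    elim: k => [|k IH]; rewrite ?addn0// addnS.
    by apply: le_trans IH _; have /andP[] := hu (n + k)%N.
  have upper n k : u (n + k)%N + h (n + k)%N * L <= u n + h n * L.
    elim: k => [|k IH]; rewrite ?addn0// addnS; apply: le_trans IH.
    by have /andP[_ h2] := hu (n + k)%N; rewrite (hh (n + k)%N) mulrDl; lra.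
  have ubu n : ubound (range u) (u n + h n * L).
    move=> _ [m _ <-]; have [mn|/ltnW nm] := leqP m n.
      have := mono m (n - m)%N; rewrite subnKC//.
      by have := mulr_ge0 (ltW (h0 n)) L0; lra.
    have := upper n (m - n)%N; rewrite subnKC//.
    by have := mulr_ge0 (ltW (h0 m)) L0; lra.
  exists (sup (range u)) => n; apply/andP; split.
    apply: ub_le_sup; last by exists n.
    by exists (u 0%N + h 0%N * L).
  by apply: ge_sup; [exists (u 0%N), 0%N|exact: ubu].
have [x hx] := nested (fun n => (P n).1) L1 (fun n => (Pst n).1) L1_ge0.
have [y hy] := nested (fun n => (P n).2) L2 (fun n => (Pst n).2) L2_ge0.
have hx0 := hx 0%N; have hy0 := hy 0%N.
move: hx0 hy0; rewrite /= /h expr0 !mul1r => hx0 hy0.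
have [|d d0 hd] := loc x y (e / 2) hx0 hy0; first by lra.
have /cvgrPdist_lt/(_ d d0)[n _ hn] :=
  @cvg_expr R (2^-1) ltac:(by rewrite ger0_norm; lra).
have hnd : h n < d.
  by have := hn n (leqnn n); rewrite /= sub0r normrN ger0_norm ?exprn_ge0.
have [ib Ne] := PP n.
have := hd _ _ _ (h0 n) hnd ib (hx n) (hy n).
by apply/negP; rewrite -ltNge; apply: lt_le_trans Ne; have := exprn_gt0 2 (h0 n); nra.
Qed.

End Bisection.

Definition cderivable (h : R[i] -> R[i]) (z d : R[i]) := forall e : R, 0 < e ->
  exists2 r : R, 0 < r & forall z', cabs (z' - z) < r ->
    cabs (h z' - h z - d * (z' - z)) <= e * cabs (z' - z).

Lemma cderivable_continuous h z d : cderivable h z d ->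
  {for z, continuous (h : R[i]^o -> R[i]^o)}.
Proof.
move=> hd; apply/(@cvgrPdist_lt _ _ _ (nbhs (z : R[i]^o)) (nbhs_filter (z : R[i]^o))).
move=> e /gt0_complexE[-> e0]; have [r r0 hr] := hd 1 ltr01.
set e' := complex.Re e in e0 *.
pose s := Num.min r (e' / (cabs d + 2)).
have c2 : 0 < cabs d + 2 by have := cabs_ge0 d; lra.
have s0 : 0 < s by rewrite lt_min r0 divr_gt0.
have := @nbhs_cabs _ z s s0.
apply: filterS => w /=; rewrite cabsE ltcR lt_min => /andP[w1].
rewrite ltr_pdivlMr// => w2; rewrite cabs_distC.
have -> : h w - h z = (h w - h z - d * (w - z)) + d * (w - z) by rewrite subrK.
apply: le_lt_trans (cabsD _ _) _; rewrite cabsM; have := hr w w1.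
have := cabs_ge0 (w - z); nra.
Qed.

Definition dcis (t : R) : R[i]^o := (2 * pi)%:C%C * 'i%C * cis t.

Lemma continuous_dcis : continuous dcis.
Proof. by move=> t; apply: cvgM; [exact: cvg_cst|exact: continuous_cis]. Qed.

Lemma cabs_dcis t : cabs (dcis t) = 2 * pi.
Proof.
rewrite /dcis !cabsM cabs_cis mulr1 cabsR ger0_norm ?mulr_ge0 ?pi_ge0//.
have -> : cabs ('i%C : R[i]) = 1 by rewrite /cabs normc_def /= expr0n add0r expr1n sqrtr1.
by rewrite mulr1.
Qed.

Lemma cint_dcis a b : a <= b -> cint a b dcis = cis b - cis a.
Proof.
rewrite le_eqVlt => /predU1P[->|ab].
  by rewrite subrr /cint !set_itv1 !Rintegral_set1.
have cR : continuous (fun t : R => complex.Re (dcis t)).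
  by move=> t; apply: (@continuous_comp _ _ _ dcis (fun z => complex.Re z));
    [exact: continuous_dcis|exact: continuous_Re].
have cI : continuous (fun t : R => complex.Im (dcis t)).
  by move=> t; apply: (@continuous_comp _ _ _ dcis (fun z => complex.Im z));
    [exact: continuous_dcis|exact: continuous_Im].
have d2 (t : R) : is_derive t (1 : R) (fun x : R => 2 * pi * x) (2 * pi).
  have -> : (fun x : R => 2 * pi * x) = (2 * pi) *: (id : R -> R) by [].
  rewrite -[X in is_derive _ _ _ X]mulr1.
  exact: (@is_deriveZ _ _ _ (id : R -> R) (2 * pi) t 1 1 _).
have dc (t : R) : is_derive t (1 : R) (fun x : R => cos (2 * pi * x)) (- sin (2 * pi * t) * (2 * pi)).
  exact: (is_derive1_comp (f := cos) (g := fun x : R => 2 * pi * x)).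
have ds (t : R) : is_derive t (1 : R) (fun x : R => sin (2 * pi * x)) (cos (2 * pi * t) * (2 * pi)).
  exact: (is_derive1_comp (f := sin) (g := fun x : R => 2 * pi * x)).
rewrite /cint; apply: complex_eq => /=.
- rewrite /Rintegral (@continuous_FTC2 R _ (fun t : R => cos (2 * pi * t)) a b)//.
  + by apply: continuous_subspaceT.
  + split; [by move=> t _; have := dc t => -[]| |].
      by apply: cvg_at_right_filter; exact: cos_cvg.
    by apply: cvg_at_left_filter; exact: cos_cvg.
  + by move=> t _; rewrite derive1E; have [_ ->] := dc t => /=; ring.
- rewrite /Rintegral (@continuous_FTC2 R _ (fun t : R => sin (2 * pi * t)) a b)//.
  + by apply: continuous_subspaceT.
  + split; [by move=> t _; have := ds t => -[]| |].
      by apply: cvg_at_right_filter; exact: sin_cvg.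
    by apply: cvg_at_left_filter; exact: sin_cvg.
  + by move=> t _; rewrite derive1E; have [_ ->] := ds t => /=; ring.
Qed.

Lemma cis_lipschitz (s t : R) : cabs (cis s - cis t) <= 4 * pi * `|s - t|.
Proof.
wlog st : s t / t <= s.
  move=> H; have [|/ltW] := leP t s; first exact: H.
  by move=> /H; rewrite cabs_distC distrC.
rewrite -cint_dcis// ger0_norm ?subr_ge0//.
have -> : 4 * pi * (s - t) = 2 * ((2 * pi) * (s - t)) :> R by ring.
by apply: cint_bound => // x _; [exact: continuous_dcis|rewrite cabs_dcis].
Qed.

End Goursat.

Lemma continuous_sub_affine (R : realType) (T : topologicalType) (u : T)
    (h g : T -> R[i]^o) (al be : R[i]^o) :
  {for u, continuous h} -> {for u, continuous g} ->
  {for u, continuous (fun v => h v - (al + be * g v))}.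
Proof.
move=> ch cg; apply: cvgB; first exact: ch.
by apply: cvgD; [exact: cvg_cst|apply: cvgM; [exact: cvg_cst|exact: cg]].
Qed.

(** * The Cauchy integral in polar coordinates around [w] *)

Section CauchyFormula.
Context (R : realType) (w : R[i]).
Context (w1 : cabs w < 1).
Implicit Types (h : R[i] -> R[i]).

Definition star_pt (s t : R) : R[i]^o := w + s%:C%C * (cis t - w).

Local Notation z := star_pt.

(** This is [dz / (z - w)] in the direction of [t]: the factor [s] of [dz] cancels that of [z - w],
    so the kernel is independent of [s]. In the direction of [s] the same form is [ds / s]. *)
Definition star_kernel (t : R) : R[i]^o := dcis t * (cis t - w)^-1.

Local Notation k := star_kernel.

Lemma star_cisw t : 1 - cabs w <= cabs (cis t - w).
Proof. by have := cabsD (cis t - w) w; rewrite subrK cabs_cis; lra. Qed.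

Lemma star_cisw0 t : cis t - w != 0.
Proof. by rewrite -cabs_gt0; apply: lt_le_trans (star_cisw t); rewrite subr_gt0. Qed.

Lemma star_z_le1 s t : 0 <= s <= 1 -> cabs (z s t) <= 1.
Proof.
move=> /andP[s0 s1]; have -> : z s t = (1 - s)%:C%C * w + s%:C%C * cis t.
  by rewrite /z rmorphB /= rmorph1; ring.
apply: le_trans (cabsD _ _) _; rewrite !cabsM cabs_cis !cabsR.
rewrite !ger0_norm ?subr_ge0//.
have h1 : 0 <= (1 - s) * (1 - cabs w) by rewrite mulr_ge0 ?subr_ge0// ltW.
by nra.
Qed.

Lemma star_zt_cont s : continuous (z s).
Proof.
move=> t; apply: cvgD; first exact: cvg_cst.
apply: cvgM; first exact: cvg_cst.
by apply: cvgB; [exact: continuous_cis|exact: cvg_cst].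
Qed.

Lemma star_zs_cont t : continuous (z ^~ t).
Proof.
move=> s; apply: cvgD; first exact: cvg_cst.
by apply: cvgM; [exact: continuous_real_complex|exact: cvg_cst].
Qed.

Lemma star_k_cont : continuous k.
Proof.
move=> t; apply: cvgM; first exact: continuous_dcis.
apply: cvgV; first exact: star_cisw0.
by apply: cvgB; [exact: continuous_cis|exact: cvg_cst].
Qed.

Lemma star_k_bound t : cabs (k t) <= 2 * pi / (1 - cabs w).
Proof.
have m0 : 0 < 1 - cabs w by rewrite subr_gt0.
rewrite cabsM cabs_dcis cabsV ler_wpM2l ?mulr_ge0 ?pi_ge0//.
by rewrite lef_pV2 ?posrE ?star_cisw//; exact: lt_le_trans m0 (star_cisw t).
Qed.

(* The integral of [h z / (z - w)] along the boundary of a box in the coordinates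
   [(s, t) |-> w + s (cis t - w)]. *)
Definition star_box h (a b c d : R) : R[i] :=
  cint c d (fun t => (h (z b t) - h (z a t)) * k t) -
  cint a b (fun s => (s^-1)%:C%C * (h (z s d) - h (z s c))).

Definition cont_disc h := forall u, cabs u <= 1 -> {for u, continuous (h : R[i]^o -> R[i]^o)}.

Lemma star_ht_cont h s : cont_disc h -> 0 <= s <= 1 -> continuous (fun t => h (z s t) : R[i]^o).
Proof.
move=> hc s01 t; apply: (@continuous_comp _ _ _ (z s) (h : R[i]^o -> R[i]^o)).
  exact: star_zt_cont.
by apply: hc; exact: star_z_le1.
Qed.

Lemma star_hs_cont h t s : cont_disc h -> 0 <= s <= 1 -> {for s, continuous (fun s => h (z s t) : R[i]^o)}.
Proof.
move=> hc s01; apply: (@continuous_comp _ _ _ (z ^~ t) (h : R[i]^o -> R[i]^o)).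
  exact: star_zs_cont.
by apply: hc; exact: star_z_le1.
Qed.

Lemma star_c1 h a b c d : cont_disc h -> 0 <= a <= 1 -> 0 <= b <= 1 ->
  ccont c d (fun t => (h (z b t) - h (z a t)) * k t).
Proof.
move=> hc a01 b01 t _; apply: cvgM; last exact: star_k_cont.
by apply: cvgB; exact: star_ht_cont.
Qed.

Lemma star_c2 h a b c d : cont_disc h -> 0 < a -> b <= 1 ->
  ccont a b (fun s => (s^-1)%:C%C * (h (z s d) - h (z s c))).
Proof.
move=> hc a0 b1 s /andP[sa sb]; apply: cvgM.
  apply: (@continuous_comp _ _ _ (fun s : R => s^-1) (fun a : R => a%:C%C : R[i]^o)).
    by apply: cvgV; [lra|exact: cvg_id].
  exact: continuous_real_complex.
by apply: cvgB; apply: star_hs_cont => //; lra.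
Qed.

Lemma star_split_s h a m b c d : cont_disc h -> 0 < a -> a <= m <= b -> b <= 1 ->
  star_box h a b c d = star_box h a m c d + star_box h m b c d.
Proof.
move=> hc a0 amb b1; rewrite /star_box (cint_split amb (star_c2 hc a0 b1)).
have -> : cint c d (fun t => (h (z b t) - h (z a t)) * k t) =
    cint c d (fun t => (h (z m t) - h (z a t)) * k t) +
    cint c d (fun t => (h (z b t) - h (z m t)) * k t).
  rewrite -cintD; [|apply: star_c1 => //; lra|apply: star_c1 => //; lra].
  by apply: eq_cint => t _; ring.
by ring.
Qed.

Lemma star_split_t h a b c m d : cont_disc h -> 0 < a -> a <= b -> b <= 1 -> c <= m <= d ->
  star_box h a b c d = star_box h a b c m + star_box h a b m d.
Proof.
move=> hc a0 ab b1 cmd; rewrite /star_box (cint_split cmd); last by apply: star_c1 => //; lra.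
have -> : cint a b (fun s => (s^-1)%:C%C * (h (z s d) - h (z s c))) =
    cint a b (fun s => (s^-1)%:C%C * (h (z s m) - h (z s c))) +
    cint a b (fun s => (s^-1)%:C%C * (h (z s d) - h (z s m))).
  rewrite -cintD; [|exact: star_c2|exact: star_c2].
  by apply: eq_cint => t _; ring.
by ring.
Qed.

(* The two integrals of an affine function over a box cancel exactly. *)
Lemma star_box_sub_affine h (al be : R[i]) a b c d : cont_disc h -> 0 < a -> a <= b -> b <= 1 -> c <= d ->
  star_box h a b c d = star_box (fun u => h u - (al + be * u)) a b c d.
Proof.
move=> hc a0 ab b1 cd; set r := fun u => _.
have rc : cont_disc r.
  move=> u u1; apply: (@continuous_sub_affine _ R[i]^o u (h : R[i]^o -> R[i]^o) id).
    exact: (hc u u1).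
  exact: cvg_id.
have a01 : 0 <= a <= 1 by lra.
have b01 : 0 <= b <= 1 by lra.
have aux (A B A' B' : R[i]) : A - A' + (B' - B) = 0 -> A - B = A' - B'.
  by move=> E; apply/eqP; rewrite -subr_eq0 -[X in _ == X]E; apply/eqP; ring.
apply: aux; rewrite -(cintB (star_c1 hc a01 b01) (star_c1 rc a01 b01)).
rewrite -(cintB (star_c2 rc a0 b1) (star_c2 hc a0 b1)).
have -> : cint c d (fun x => (h (z b x) - h (z a x)) * k x - (r (z b x) - r (z a x)) * k x) =
    cint c d (fun t => be * (b - a)%:C%C * dcis t).
  apply: eq_cint => t _; rewrite /r /z /k rmorphB /=; field; exact: star_cisw0.
have -> : cint a b (fun x => (x^-1)%:C%C * (r (z x d) - r (z x c)) -
      (x^-1)%:C%C * (h (z x d) - h (z x c))) =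
    cint a b (fun=> - (be * (cis d - cis c))).
  apply: eq_cint => s sab; rewrite /r /z fmorphV /=; field.
  by rewrite -cabs_eq0 cabsR normr_eq0; lra.
rewrite cintZ; last by move=> t _; exact: continuous_dcis.
by rewrite cint_cst// cint_dcis//; ring.
Qed.

Lemma star_z_lip s t x y : 0 <= x <= 1 -> cabs (z s t - z x y) <= 2 * `|s - x| + 4 * pi * `|t - y|.
Proof.
move=> x01; have -> : z s t - z x y =
    (s - x)%:C%C * (cis t - w) + x%:C%C * (cis t - cis y).
  by rewrite /z rmorphB /=; ring.
apply: le_trans (cabsD _ _) _; rewrite !cabsM !cabsR.
have h1 : cabs (cis t - w) <= 1 + cabs w by rewrite -(cabs_cis t) cabsB.
have w1' := w1.
have h2 := cis_lipschitz t y.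
rewrite (ger0_norm (_ : 0 <= x)); last by lra.
have h3 : 0 <= `|s - x| * (2 - cabs (cis t - w)) by apply: mulr_ge0 => //; lra.
have h4 : 0 <= (1 - x) * cabs (cis t - cis y) by rewrite mulr_ge0 ?cabs_ge0//; lra.
lra.
Qed.

(** On a small box the affine part of [h] contributes nothing, the remainder is [o(l)] and the sides
    have length [O(l)], so the boundary integral is [o(l^2)]. The condition [s0 > 0] keeps the boxes
    away from the pole at [w]. *)
Lemma star_box_eq0 h (s0 : R) : 0 < s0 < 1 ->
  (forall u, cabs u <= 1 -> exists d, cderivable h u d) -> star_box h s0 1 0 1 = 0.
Proof.
move=> s01 hd; have hc : cont_disc h.
  by move=> u /hd[d]; exact: cderivable_continuous.
pose N a c l := cabs (star_box h a (a + l * (1 - s0)) c (c + l * 1)).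
suff : N s0 0 1 <= 0.
  rewrite /N !mul1r add0r addrC subrK => h0; apply/eqP.
  by rewrite -cabs_eq0 eq_le h0 cabs_ge0.
apply: (@goursat_bisection R (1 - s0) 1 s0 0) => //; first by lra.
  move=> a c l l0 [i1 i2 i3 i4]; rewrite /N !mulr1.
  have lL : 0 < l * (1 - s0) by rewrite mulr_gt0//; lra.
  rewrite mulrDl in i2.
  rewrite (@star_split_s h a (a + l * (1 - s0))) ?mulrDl//; [|lra|lra|lra].
  rewrite (@star_split_t h a (a + l * (1 - s0)) c (c + l))//; [|lra|lra|lra|lra].
  rewrite (@star_split_t h (a + l * (1 - s0)) _ c (c + l))//; [|lra|lra|lra|lra].
  have q4 (A1 A2 B1 B2 : R[i]) :
      cabs (A1 + A2 + (B1 + B2)) <= cabs A1 + cabs B1 + (cabs A2 + cabs B2).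
    have := cabsD (A1 + A2) (B1 + B2); have := cabsD A1 A2; have := cabsD B1 B2; lra.
  by apply: le_trans (q4 _ _ _ _) _; rewrite !addrA.
move=> x y e hx hy e0.
have x01 : 0 <= x <= 1 by lra.
have [d hdz] := hd (z x y) (star_z_le1 y x01).
pose m := 1 - cabs w; have m0 : 0 < m by rewrite subr_gt0.
pose K := 2 + 4 * pi : R; have K0 : 0 < K by have := pi_gt0 R; rewrite /K; lra.
pose M2 := 2 * pi / m; have M20 : 0 <= M2 by rewrite divr_ge0 ?mulr_ge0 ?pi_ge0// ltW.
(* [K] is the Lipschitz constant of the parametrisation and [M2] bounds the kernel. The two terms of
   [A] come from the two integrals, so a relative remainder [e / A] gives the total [e * l ^+ 2]. *)
pose A := 4 * K * M2 + 4 * K * s0^-1.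
have is0 : 0 < s0^-1 by rewrite invr_gt0; lra.
have A0 : 0 < A.
  have h1 : 0 <= 4 * K * M2 by apply: mulr_ge0 => //; apply: mulr_ge0 => //; exact: ltW.
  have h2 : 0 < 4 * K * s0^-1 by apply: mulr_gt0 => //; apply: mulr_gt0.
  by rewrite /A; lra.
have eA0 : 0 < e / A by rewrite divr_gt0.
have [r r0 hr] := hdz _ eA0.
exists (r / K); first by rewrite divr_gt0.
move=> a c l l0 lr [i1 i2 i3 i4] xa yc.
rewrite ltr_pdivlMr// in lr; rewrite /N mulr1.
have lL : 0 <= l * (1 - s0) <= l by nra.
rewrite (@star_box_sub_affine h (h (z x y) - d * z x y) d)//; [|lra|lra|lra|lra].
set rho := fun u => _.
have rc : cont_disc rho.
  move=> u u1; apply: (@continuous_sub_affine _ R[i]^o u (h : R[i]^o -> R[i]^o) id).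
    exact: (hc u u1).
  exact: cvg_id.
have rb s t : `|s - x| <= l -> `|t - y| <= l -> cabs (rho (z s t)) <= e / A * (K * l).
  move=> sx ty; have zz : cabs (z s t - z x y) <= K * l.
    by apply: le_trans (star_z_lip s t y x01) _; rewrite /K; have := pi_gt0 R; nra.
  have -> : rho (z s t) = h (z s t) - h (z x y) - d * (z s t - z x y).
    by rewrite /rho; ring.
  have zr : cabs (z s t - z x y) < r by nra.
  by apply: le_trans (hr _ zr) _; rewrite ler_pM2l.
have rbb s t s' t' : `|s - x| <= l -> `|t - y| <= l -> `|s' - x| <= l -> `|t' - y| <= l ->
    cabs (rho (z s t) - rho (z s' t')) <= 2 * (e / A * (K * l)).
  move=> h1 h2 h3 h4; apply: le_trans (cabsB _ _) _.
  by have := rb _ _ h1 h2; have := rb _ _ h3 h4; lra.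
have nb (p q : R) : q - l <= p -> p <= q + l -> `|p - q| <= l by rewrite ler_norml; lra.
have B1 : cabs (cint c (c + l) (fun t => (rho (z (a + l * (1 - s0)) t) - rho (z a t)) * k t)) <=
    2 * (2 * (e / A * (K * l)) * M2 * (c + l - c)).
  apply: cint_bound; first lra.
    by apply: star_c1 => //; lra.
  move=> t tc; rewrite cabsM; apply: ler_pM; [exact: cabs_ge0|exact: cabs_ge0| |exact: star_k_bound].
  by apply: rbb; apply: nb; lra.
have B2 : cabs (cint a (a + l * (1 - s0))
      (fun s => (s^-1)%:C%C * (rho (z s (c + l)) - rho (z s c)))) <=
    2 * (s0^-1 * (2 * (e / A * (K * l))) * (a + l * (1 - s0) - a)).
  apply: cint_bound; first lra.
    by apply: star_c2 => //; lra.
  move=> s sa; rewrite cabsM; apply: ler_pM; [exact: cabs_ge0|exact: cabs_ge0| |].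
    by rewrite cabsR ger0_norm ?invr_ge0; [rewrite lef_pV2 ?posrE; lra|lra].
  by apply: rbb; apply: nb; lra.
rewrite /star_box; apply: le_trans (cabsB _ _) _; apply: le_trans (lerD B1 B2) _.
have -> : e * l ^+ 2 = 2 * (2 * (e / A * (K * l)) * M2 * l) +
    2 * (s0^-1 * (2 * (e / A * (K * l))) * l).
  rewrite [X in _ = X](_ : _ = e / A * A * l ^+ 2); last by rewrite /A; ring.
  by rewrite divfK// gt_eqF.
have -> : c + l - c = l by ring.
have -> : a + l * (1 - s0) - a = l * (1 - s0) by ring.
rewrite lerD2l ler_pM2l// ler_wpM2l//; last by lra.
have P0 : 0 <= e / A * (K * l) by apply: mulr_ge0; [exact: ltW|apply: mulr_ge0; exact: ltW].
by apply: mulr_ge0; [exact: ltW|exact: mulr_ge0].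
Qed.

End CauchyFormula.

Section CauchyIntegral.
Context (R : realType) (w : R[i]).
Context (w1 : cabs w < 1).
Implicit Types (h : R[i] -> R[i]).

Local Notation z := (star_pt w).
Local Notation k := (star_kernel w).

Lemma star_small h (e : R) : {for w, continuous (h : R[i]^o -> R[i]^o)} -> 0 < e ->
  exists2 s : R, 0 < s < 1 & forall t, cabs (h (z s t) - h w) <= e.
Proof.
move=> hc e0; have /cvgrPdist_lt/(_ e%:C%C) := hc.
rewrite ltcR e0 => /(_ isT)/nbhs_cabsP[r r0 hr].
pose s := Num.min (2^-1) (r / 4).
have r4 : 0 < r / 4 by rewrite divr_gt0.
have s0 : 0 < s by rewrite lt_min invr_gt0 r4 andbT.
have s2 : s <= 2^-1 by rewrite ge_min lexx.
have s4 : s <= r / 4 by rewrite ge_min lexx orbT.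
exists s; first by rewrite s0 (le_lt_trans s2)// invf_lt1// ltr1n.
move=> t; have /hr : cabs (z s t - w) < r.
  rewrite /star_pt addrC addKr cabsM cabsR ger0_norm ?(ltW s0)//.
  have c2 : cabs (cis t - w) <= 2.
    by apply: le_trans (cabsB _ _) _; rewrite cabs_cis lerD2l ltW.
  apply: (@le_lt_trans _ _ (s * 2)); first by rewrite ler_pM2l.
  apply: (@le_lt_trans _ _ (r / 4 * 2)); first by rewrite ler_pM2r.
  by have -> : r / 4 * 2 = r / 2 by [field]; rewrite ltr_pdivrMr// ltr_pMr// ltr1n.
by rewrite /= cabsE ltcR cabs_distC => /ltW.
Qed.

(** On the box from [s] to 1 and from 0 to 1, the sides [t = 0] and [t = 1] cancel by periodicity.
    Hence the integral over the circle equals the one at level [s] for every [s > 0], where [h] is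
    as close to [h w] as desired. *)
Lemma star_integral h : (forall u, cabs u <= 1 -> exists d, cderivable h u d) ->
  cint 0 1 (fun t => h (cis t) * k t) = h w * cint 0 1 k.
Proof.
move=> hd; have hc : cont_disc h.
  by move=> u /hd[d]; exact: cderivable_continuous.
have kc : ccont 0 1 k by move=> t _; exact: star_k_cont.
have cs s : 0 <= s <= 1 -> ccont 0 1 (fun t => h (z s t) * k t).
  by move=> s01 t _; apply: cvgM; [exact: star_ht_cont|exact: star_k_cont].
have z1 t : z 1 t = cis t by rewrite /z rmorph1 mul1r addrC subrK.
have J s : 0 < s < 1 -> cint 0 1 (fun t => h (cis t) * k t) = cint 0 1 (fun t => h (z s t) * k t).
  move=> s01; have := star_box_eq0 w1 s01 hd; rewrite /star_box.
  have -> : cint s 1 (fun s => (s^-1)%:C%C * (h (z s 1) - h (z s 0))) = 0.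
    transitivity (cint s 1 (fun=> 0 : R[i]^o)).
      by apply: eq_cint => x _; rewrite /z cis0 cis1 subrr mulr0.
    by rewrite cint_cst ?mulr0//; lra.
  rewrite subr0 => E.
  have := cintB (cs 1 ltac:(lra)) (cs s ltac:(lra)).
  under eq_cint do rewrite -mulrBl.
  rewrite E => /esym/eqP; rewrite subr_eq0 => /eqP <-.
  by apply: eq_cint => t _; rewrite z1.
have hk : ccont 0 1 (fun t => h w * k t) by exact: ccontZ.
rewrite -cintZ//; apply/eqP; rewrite -subr_eq0 -cabs_eq0 eq_le cabs_ge0 andbT.
rewrite leNgt; apply/negP; set e := cabs _ => e0.
pose M := 2 * pi / (1 - cabs w); have M0 : 0 < M.
  by apply: divr_gt0; [apply: mulr_gt0 => //; exact: pi_gt0|rewrite subr_gt0].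
have eM : 0 < e / (4 * M) by apply: divr_gt0 => //; apply: mulr_gt0.
have [s s0 hs] := star_small (hc _ (ltW w1)) eM.
have s01 : 0 <= s <= 1 by case/andP: s0 => /ltW -> /ltW ->.
suff : e <= 2 * (e / (4 * M) * M * (1 - 0)).
  have -> : 2 * (e / (4 * M) * M * (1 - 0)) = e / 2 by field; rewrite gt_eqF.
  by rewrite leNgt => /negP; apply; rewrite ltr_pdivrMr// ltr_pMr// ltr1n.
rewrite {1}/e (J s s0) -(cintB (cs s s01) hk).
apply: cint_bound; [exact: ler01|exact: (ccontB (cs s s01) hk)|move=> t _].
rewrite -mulrBl cabsM; apply: ler_pM; [exact: cabs_ge0|exact: cabs_ge0|exact: hs|exact: star_k_bound].
Qed.

End CauchyIntegral.

Section CauchyKernel.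
Context (R : realType).

Lemma cauchy_kernel_neq0 (w : R[i]) t : cabs w < 1 -> 1 - w * (cis t)^* != 0.
Proof.
move=> w1; rewrite -cabs_gt0; have := cabsD (1 - w * (cis t)^*) (w * (cis t)^*).
by rewrite subrK cabs1 cabsM cabsJ cabs_cis; lra.
Qed.

Lemma continuous_cauchy_kernel (w : R[i]) : cabs w < 1 ->
  continuous (fun t => (1 - w * (cis t)^*)^-1 : R[i]^o).
Proof.
move=> w1 t; apply: cvgV; first exact: cauchy_kernel_neq0.
apply: cvgB; first exact: cvg_cst.
apply: cvgM; first exact: cvg_cst.
apply: (@continuous_comp _ _ _ (@cis R : R -> R[i]^o) (fun z : R[i]^o => z^* : R[i]^o)).
  exact: continuous_cis.
exact: continuous_conj.
Qed.

Lemma star_kernelE (w : R[i]) t : cabs w < 1 ->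
  star_kernel w t = (2 * pi)%:C%C * 'i%C * (1 - w * (cis t)^*)^-1.
Proof.
move=> w1; have n0 := cauchy_kernel_neq0 t w1.
have E : cis t - w = cis t * (1 - w * (cis t)^*).
  by rewrite mulrBr mulr1 mulrCA cisJ mulr1.
rewrite /star_kernel /dcis E invfM -!mulrA; congr (_ * (_ * _)).
by rewrite mulrA divff ?mul1r// -cabs_eq0 cabs_cis oner_eq0.
Qed.

Lemma two_pi_i_neq0 : (2 * pi)%:C%C * 'i%C != 0 :> R[i].
Proof.
rewrite mulf_neq0// eq_complex /= ?oner_eq0 ?andbF//.
by rewrite negb_and mulf_neq0// gt_eqF// pi_gt0.
Qed.

Let cderivable_inv (a u : R[i]) : 1 - a * u != 0 ->
  cderivable (fun u => (1 - a * u)^-1) u (a / (1 - a * u) ^+ 2).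
Proof.
move=> n0 e e0; have q0 : 0 < cabs (1 - a * u) by rewrite cabs_gt0.
set q := cabs (1 - a * u) in q0.
have a0 := cabs_ge0 a.
pose r := Num.min (q / (2 * (cabs a + 1))) (e * q ^+ 3 / (2 * (cabs a ^+ 2 + 1))).
have d1 : 0 < 2 * (cabs a + 1) by lra.
have d2 : 0 < 2 * (cabs a ^+ 2 + 1) by have := sqr_ge0 (cabs a); lra.
exists r; first by rewrite lt_min !divr_gt0// mulr_gt0// exprn_gt0.
move=> v; rewrite lt_min !ltr_pdivlMr// => /andP[v1 v2].
have v0 := cabs_ge0 (v - u).
have qv : q / 2 <= cabs (1 - a * v).
  have := cabsD (1 - a * v) (a * (v - u)).
  have -> : 1 - a * v + a * (v - u) = 1 - a * u by ring.
  by rewrite -/q cabsM; nra.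
have nv : 1 - a * v != 0 by rewrite -cabs_gt0; lra.
have -> : (1 - a * v)^-1 - (1 - a * u)^-1 - a / (1 - a * u) ^+ 2 * (v - u) =
    a ^+ 2 * (v - u) ^+ 2 / ((1 - a * v) * (1 - a * u) ^+ 2).
  by field; rewrite nv n0.
rewrite !(cabsX, cabsV, cabsM) -/q ler_pdivrMr; last first.
  by rewrite mulr_gt0 ?cabs_gt0 ?exprn_gt0.
have q3 : 0 < q ^+ 2 by rewrite exprn_gt0.
have -> : cabs a ^+ 2 * cabs (v - u) ^+ 2 = cabs (v - u) * (cabs (v - u) * cabs a ^+ 2) by ring.
have -> : e * cabs (v - u) * (cabs (1 - a * v) * q ^+ 2) =
  cabs (v - u) * (e * q ^+ 2 * cabs (1 - a * v)) by ring.
rewrite ler_wpM2l//; have eq2 : 0 < e * q ^+ 2 by rewrite mulr_gt0.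
have : e * q ^+ 2 * (q / 2) <= e * q ^+ 2 * cabs (1 - a * v) by rewrite ler_pM2l.
apply: le_trans.
have : cabs (v - u) * (2 * (cabs a ^+ 2 + 1)) < e * q ^+ 3 by [].
have := sqr_ge0 (cabs a); rewrite exprS; nra.
Qed.

(* Conjugation turns this into the mean value property of [1 / (1 - conj w z)] at [0]. *)
Lemma cint_cauchy_kernel (w : R[i]) : cabs w < 1 ->
  cint 0 1 (fun t => (1 - w * (cis t)^*)^-1 : R[i]^o) = 1.
Proof.
move=> w1; have z1 : cabs (0 : R[i]) < 1 by rewrite cabs0.
have pi0 := @two_pi_i_neq0.
pose h (u : R[i]) := (1 - w^* * u)^-1.
have hd u : cabs u <= 1 -> exists d, cderivable h u d.
  move=> u1; eexists; apply: cderivable_inv; rewrite -cabs_gt0.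
  have := cabsD (1 - w^* * u) (w^* * u); rewrite subrK cabs1 cabsM cabsJ.
  by have := cabs_ge0 w; have := cabs_ge0 u; nra.
have := star_integral z1 hd.
have -> : cint 0 1 (star_kernel 0) = (2 * pi)%:C%C * 'i%C :> R[i].
  transitivity (cint 0 1 (fun=> (2 * pi)%:C%C * 'i%C : R[i]^o)).
    by apply: eq_cint => t _; rewrite star_kernelE// mul0r subr0 invr1 mulr1.
  by rewrite cint_cst ?subr0 ?mul1r.
have hc : ccont 0 1 (fun t => h (cis t) : R[i]^o).
  move=> t _; apply: (@continuous_comp _ _ _ (@cis R : R -> R[i]^o) (h : R[i]^o -> R[i]^o)).
    exact: continuous_cis.
  have [d hdd] := hd (cis t) ltac:(by rewrite cabs_cis).
  exact: cderivable_continuous hdd.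
have -> : cint 0 1 (fun t => h (cis t) * star_kernel 0 t) =
    (2 * pi)%:C%C * 'i%C * cint 0 1 (fun t => h (cis t)).
  rewrite -cintZ//; apply: eq_cint => t _.
  by rewrite star_kernelE// mul0r subr0 invr1 mulr1 mulrC.
rewrite {2}/h mulr0 subr0 invr1 mul1r => /(congr1 ( *%R ((2 * pi)%:C%C * 'i%C)^-1)).
rewrite mulKf// mulVf// => E.
have J f : ccont 0 1 f -> cint 0 1 (fun t => (f t : R[i])^* : R[i]^o) = (cint 0 1 f : R[i])^*.
  move=> fc; rewrite /cint; apply: complex_eq => /=.
    by apply: eq_Rintegral => t _; case: (f t).
  rewrite -mulN1r -RintegralZl//; last exact: ccont_Im.
  by apply: eq_Rintegral => t _; rewrite mulN1r; case: (f t).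
transitivity ((cint 0 1 (fun t => h (cis t)) : R[i])^*); last by rewrite E rmorph1.
rewrite -J//; apply: eq_cint => t _.
by rewrite /h fmorphV rmorphB rmorph1 rmorphM /= conjCK.
Qed.

(** [star_integral] determines the left side up to the integral of the kernel itself;
    [cint_cauchy_kernel] supplies that value, so no winding number is computed. *)
Lemma cauchy_formula (h : R[i] -> R[i]) (w : R[i]) : cabs w < 1 ->
  (forall u, cabs u <= 1 -> exists d, cderivable h u d) ->
  cint 0 1 (fun t => h (cis t) * (1 - w * (cis t)^*)^-1) = h w.
Proof.
move=> w1 hd.
have hc : ccont 0 1 (fun t => h (cis t) : R[i]^o).
  move=> t _; apply: (@continuous_comp _ _ _ (@cis R : R -> R[i]^o) (h : R[i]^o -> R[i]^o)).
    exact: continuous_cis.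
  have [d hdd] := hd (cis t) ltac:(by rewrite cabs_cis).
  exact: cderivable_continuous hdd.
have kc : ccont 0 1 (fun t => (1 - w * (cis t)^*)^-1 : R[i]^o).
  by move=> t _; exact: continuous_cauchy_kernel.
have := star_integral w1 hd.
have -> : cint 0 1 (fun t => h (cis t) * star_kernel w t) =
    (2 * pi)%:C%C * 'i%C * cint 0 1 (fun t => h (cis t) * (1 - w * (cis t)^*)^-1).
  rewrite -cintZ; last exact: ccontM.
  by apply: eq_cint => t _; rewrite star_kernelE// mulrCA.
have -> : cint 0 1 (star_kernel w) = (2 * pi)%:C%C * 'i%C *
    cint 0 1 (fun t => (1 - w * (cis t)^*)^-1 : R[i]^o).
  rewrite -cintZ//.
  by apply: eq_cint => t _; rewrite star_kernelE.
rewrite cint_cauchy_kernel// mulr1 mulrC => /mulIf; apply; exact: two_pi_i_neq0.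
Qed.

End CauchyKernel.

(** * The maximal inequality *)

Section RootsOfUnity.
Context (R : realType) (N : nat).
Context (N_gt0 : (0 < N)%N).

Definition uroot (j : nat) : R[i] := cis (j%:R / N%:R).

Lemma cis_nat (x : R) n : cis (n%:R * x) = cis x ^+ n.
Proof.
elim: n => [|n IH]; first by rewrite mul0r cis0 expr0.
by rewrite -natr1 mulrDl mul1r cisD IH exprSr.
Qed.

Lemma urootX j n : uroot j ^+ n = uroot n ^+ j.
Proof.
rewrite /uroot -!cis_nat; congr cis.
by rewrite !mulrA [X in X / _ = _]mulrC.
Qed.

Lemma uroot_expN j : uroot j ^+ N = 1.
Proof.
rewrite urootX /uroot divff ?pnatr_eq0 -?lt0n// cis1 expr1n //.
Qed.

Lemma cabs_uroot j : cabs (uroot j) = 1.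
Proof. exact: cabs_cis. Qed.

Lemma urootJ j : uroot j * (uroot j)^* = 1.
Proof. exact: cisJ. Qed.

Lemma cis_neq1 (x : R) : 0 < x < 1 -> cis x != 1.
Proof.
move=> /andP[x0 x1]; apply/eqP => /(congr1 (fun z : R[i] => complex.Re z)) /=.
have -> : 2 * pi * x = (pi * x) *+ 2 by rewrite mulr2n; ring.
rewrite mulr2n cosD -!expr2 => h; have h2 := cos2Dsin2 (pi * x).
have : 0 < sin (pi * x).
  by apply: sin_gt0_pi; rewrite mulr_gt0 ?pi_gt0//= gtr_pMr// pi_gt0.
have : sin (pi * x) ^+ 2 = 0 by lra.
by move=> /eqP; rewrite sqrf_eq0 => /eqP ->; rewrite ltxx.
Qed.

Lemma uroot_neq1 n : (0 < n < N)%N -> uroot n != 1.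
Proof.
move=> /andP[n0 nN]; apply: cis_neq1.
have N0 : 0 < N%:R :> R by rewrite ltr0n.
by rewrite divr_gt0 ?ltr0n//= ltr_pdivrMr// mul1r ltr_nat.
Qed.

Lemma sum_uroot (m n : nat) : (m < N)%N -> (n < N)%N ->
  \sum_(j < N) uroot j ^+ n * (uroot j)^* ^+ m = if m == n then N%:R else 0.
Proof.
move=> mN nN; case: eqVneq => [->|mn].
  under eq_bigr do rewrite -exprMn urootJ expr1n.
  by rewrite sumr_const card_ord.
have conjV j : (uroot j)^* = (uroot j)^-1.
  have u0 : uroot j != 0 by rewrite -cabs_gt0 cabs_uroot.
  by rewrite -[LHS]mul1r -(mulVf u0) -mulrA urootJ mulr1.
have key a b : (a < b < N)%N -> \sum_(j < N) uroot j ^+ b * (uroot j)^* ^+ a = 0.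
  move=> /andP[ab bN]; have := subrX1 (uroot (b - a)) N.
  rewrite uroot_expN subrr => /esym/eqP; rewrite mulf_eq0 subr_eq0.
  rewrite (negbTE (uroot_neq1 _)) ?subn_gt0 ?ab ?(leq_ltn_trans (leq_subr _ _))//=.
  move=> /eqP E; rewrite -[RHS]E; apply: eq_bigr => j _; rewrite [RHS]urootX conjV exprVn.
  rewrite -{1}(subnK (ltnW ab)) exprD mulfK// expf_neq0//.
  by rewrite -cabs_gt0 cabs_uroot.
have [mltn|nltm|/eqP] := ltngtP m n; last by rewrite (negbTE mn).
  by apply: key; rewrite mltn.
have := key n m; rewrite nltm mN => /(_ isT) h.
apply: (can_inj (@conjCK _)); rewrite rmorph0 -[RHS]h rmorph_sum /=.
by apply: eq_bigr => j _; rewrite rmorphM !rmorphXn /= conjCK mulrC.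
Qed.

Lemma sum_geometric_uroot (mu : R[i]) j :
  (1 - mu * (uroot j)^*) * \sum_(m < N) (mu * (uroot j)^*) ^+ m = 1 - mu ^+ N.
Proof.
have := subrX1 (mu * (uroot j)^*) N.
rewrite exprMn -rmorphXn /= uroot_expN rmorph1 mulr1 => h.
by rewrite -(opprB (mu ^+ N)) h; ring.
Qed.

(** By orthogonality only [m = n] survives: the truncated geometric sum is an exact Cauchy kernel on
    the grid for monomials of degree below [N]. *)
Lemma discrete_cauchy (mu : R[i]) n : (n < N)%N ->
  \sum_(j < N) uroot j ^+ n * \sum_(m < N) (mu * (uroot j)^*) ^+ m = N%:R * mu ^+ n.
Proof.
move=> nN; under eq_bigr do rewrite mulr_sumr.
rewrite exchange_big /= (bigD1 (Ordinal nN)) //= [X in _ + X]big1 ?addr0.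
  under eq_bigr do rewrite exprMn mulrCA.
  by rewrite -mulr_sumr sum_uroot// eqxx mulrC.
move=> m mn; under eq_bigr do rewrite exprMn mulrCA.
rewrite -mulr_sumr sum_uroot//.
case: eqP => [e|]; last by rewrite mulr0.
by move: mn; rewrite -(inj_eq val_inj) /= e eqxx.
Qed.

End RootsOfUnity.

(** * Poisson kernels *)

Section PoissonKernel.
Context (R : realType).
Implicit Types (r s : R) (x y : R[i]).

Definition poisson r x : R := (1 - r ^+ 2) / cabs (1 - r%:C%C * x) ^+ 2.

Lemma poisson_denominator r x : 0 <= r < 1 -> cabs x = 1 -> 1 - r <= cabs (1 - r%:C%C * x).
Proof.
move=> /andP[r0 r1] x1; have := cabsD (1 - r%:C%C * x) (r%:C%C * x).
by rewrite subrK cabs1 cabsM cabsR x1 ger0_norm//; lra.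
Qed.

Lemma poisson_denominator_gt0 r x : 0 <= r < 1 -> cabs x = 1 -> 0 < cabs (1 - r%:C%C * x).
Proof.
move=> r01 x1; apply: lt_le_trans (poisson_denominator r01 x1).
by case/andP: r01 => _; rewrite subr_gt0.
Qed.

Lemma poisson_ge0 r x : 0 <= r < 1 -> 0 <= poisson r x.
Proof.
move=> /andP[r0 r1]; rewrite divr_ge0 ?exprn_ge0 ?cabs_ge0// subr_ge0.
by rewrite exprn_ile1// ltW.
Qed.

Lemma poissonJ r x : poisson r x^* = poisson r x.
Proof.
rewrite /poisson -(cabsJ (1 - r%:C%C * x)) rmorphB rmorph1 rmorphM /=.
by rewrite (_ : (r%:C%C)^* = r%:C%C)//; exact: conjc_real.
Qed.

Let dist1 r x : 0 <= r < 1 -> cabs x = 1 -> cabs (1 - x) <= 2 * cabs (1 - r%:C%C * x).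
Proof.
move=> r01 x1; have h := poisson_denominator r01 x1.
have -> : 1 - x = (1 - r%:C%C * x) - (1 - r)%:C%C * x by rewrite rmorphB rmorph1; ring.
apply: le_trans (cabsB _ _) _; rewrite (cabsM (1 - r)%:C%C) cabsR x1 mulr1.
by case/andP: r01 => r0 r1; rewrite ger0_norm; lra.
Qed.

(** The constant is [5^2]: [|1 - r z| <= (1 - r) + |1 - z| <= |1 - r x| + 2 |1 - x| <= 5 |1 - r x|],
    the last step by [dist1]. *)
Let compare r x z : 0 <= r < 1 -> cabs x = 1 -> cabs z = 1 -> cabs (1 - z) <= 2 * cabs (1 - x) ->
  poisson r x <= 25 * poisson r z.
Proof.
move=> r01 x1 z1 xz; have dx := dist1 r01 x1.
have hx := poisson_denominator r01 x1.
have px := poisson_denominator_gt0 r01 x1; have pz := poisson_denominator_gt0 r01 z1.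
have h : cabs (1 - r%:C%C * z) <= 5 * cabs (1 - r%:C%C * x).
  have -> : 1 - r%:C%C * z = (1 - r)%:C%C + r%:C%C * (1 - z) by rewrite rmorphB rmorph1; ring.
  apply: le_trans (cabsD _ _) _; rewrite (cabsM r%:C%C) !cabsR.
  case/andP: r01 => r0 r1; rewrite !ger0_norm ?subr_ge0 ?(ltW r1)//.
  have : r * cabs (1 - z) <= 1 * cabs (1 - z) by rewrite ler_wpM2r ?cabs_ge0// ltW.
  lra.
rewrite /poisson mulrCA ler_wpM2l//.
  by rewrite subr_ge0 exprn_ile1//; case/andP: r01 => // r0 /ltW.
rewrite ler_pdivlMr ?exprn_gt0// ler_pdivrMl ?exprn_gt0//.
have -> : cabs (1 - r%:C%C * x) ^+ 2 * 25 = (5 * cabs (1 - r%:C%C * x)) ^+ 2 by ring.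
by rewrite ler_pXn2r// nnegrE ?mulr_ge0 ?cabs_ge0.
Qed.

(* [|1 - x y| <= |1 - x| + |1 - y|], so one of the two factors can be moved to [x y]. *)
Lemma poisson_quasi_triangle r s x y : 0 <= r < 1 -> 0 <= s < 1 ->
  cabs x = 1 -> cabs y = 1 ->
  poisson r x * poisson s y <=
  25 * (poisson r (x * y) * poisson s y + poisson r x * poisson s (x * y)).
Proof.
move=> r01 s01 x1 y1; have xy1 : cabs (x * y) = 1 by rewrite cabsM x1 y1 mulr1.
have P0 := poisson_ge0 x r01; have Q0 := poisson_ge0 y s01.
have P1 := poisson_ge0 (x * y) r01; have Q1 := poisson_ge0 (x * y) s01.
have tri : cabs (1 - x * y) <= cabs (1 - x) + cabs (1 - y).
  have -> : 1 - x * y = (1 - x) + x * (1 - y) by ring.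
  by apply: le_trans (cabsD _ _) _; rewrite (cabsM x) x1 mul1r.
rewrite mulrDr; have [yx|/ltW xy] := leP (cabs (1 - y)) (cabs (1 - x)).
  have := compare r01 x1 xy1 ltac:(lra) => h.
  apply: ler_wpDr; first by apply: mulr_ge0 => //; apply: mulr_ge0.
  by rewrite mulrA ler_wpM2r.
have := compare s01 y1 xy1 ltac:(lra) => h.
apply: ler_wpDl; first by apply: mulr_ge0 => //; apply: mulr_ge0.
by rewrite [leRHS]mulrCA ler_wpM2l.
Qed.

End PoissonKernel.

Section DiscreteMaximal.
Context (R : realType) (E : innerType R).

Lemma hnormZ (a : R[i]) (x : E) : hnorm (a *: x) = cabs a * hnorm x.
Proof.
rewrite /hnorm sqnormZ -cabs_sqrJ /= sqrtrM ?sqr_ge0// sqrtr_sqr.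
by rewrite ger0_norm ?cabs_ge0.
Qed.

Lemma hnorm_sum (I : Type) (s : seq I) (P : pred I) (f : I -> E) :
  hnorm (\sum_(i <- s | P i) f i) <= \sum_(i <- s | P i) hnorm (f i).
Proof.
elim/big_ind2 : _ => //; first by rewrite hnorm0.
by move=> x a y b xa yb; apply: le_trans (ler_hnormD _ _) _; exact: lerD.
Qed.

Definition poly1 (s : seq (nat * E)) (z : R[i]) : E :=
  \sum_(x <- s) z ^+ x.1 *: x.2.

Section Grid.
Context (N : nat) (N_gt0 : (0 < N)%N).

Local Notation u := (@uroot R N).

Definition grid_kernel r (l j : nat) : R := N%:R^-1 * poisson r (u l * (u j)^*).

Let N0 : 0 < N%:R :> R. Proof. by rewrite ltr0n. Qed.

Lemma grid_kernel_ge0 r l j : 0 <= r < 1 -> 0 <= grid_kernel r l j.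
Proof. by move=> r01; rewrite mulr_ge0 ?invr_ge0 ?poisson_ge0// ltW. Qed.

Lemma grid_kernelC r l j : grid_kernel r l j = grid_kernel r j l.
Proof. by rewrite /grid_kernel -[in LHS]poissonJ rmorphM /= conjCK (mulrC (u l)^*). Qed.

Let uu1 l j : cabs (u l * (u j)^*) = 1.
Proof. by rewrite cabsM cabsJ !cabs_uroot mulr1. Qed.

Lemma grid_kernel_quasi_triangle r s (l j m : nat) : 0 <= r < 1 -> 0 <= s < 1 ->
  grid_kernel r l j * grid_kernel s j m <=
  25 * (grid_kernel r l m * grid_kernel s j m + grid_kernel r l j * grid_kernel s l m).
Proof.
move=> r01 s01; have := poisson_quasi_triangle r01 s01 (uu1 l j) (uu1 j m).
have -> : u l * (u j)^* * (u j * (u m)^*) = u l * (u m)^*.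
  by rewrite -mulrA [X in u l * X]mulrA (mulrC (u j)^*) urootJ mul1r.
rewrite /grid_kernel => h.
have n2 : 0 <= N%:R^-1 * N%:R^-1 :> R by rewrite mulr_ge0// invr_ge0 ltW.
have := ler_wpM2l n2 h; lra.
Qed.

(* Parseval for [1 / (1 - r z) = sum_m (r z)^m / (1 - r^N)] on the grid. *)
Lemma grid_kernel_row r (l : nat) : 0 <= r < 1 -> r ^+ N <= 2^-1 ->
  \sum_(j < N) grid_kernel r l j <= 4.
Proof.
move=> r01 rN; have [r0 r1] := andP r01.
pose mu := r%:C%C * u l; pose S j := \sum_(m < N) (mu * (u j)^*) ^+ m.
have muN : mu ^+ N = (r ^+ N)%:C%C by rewrite exprMn uroot_expN// mulr1 rmorphXn.
have SE j : cabs (1 - mu * (u j)^*) * cabs (S j) = 1 - r ^+ N.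
  rewrite -cabsM sum_geometric_uroot// muN -[X in X - _](rmorph1 (real_complex R)).
  by rewrite -rmorphB /= cabsR ger0_norm// subr_ge0 exprn_ile1// ltW.
have q0 j : 0 < cabs (1 - mu * (u j)^*).
  by rewrite /mu -mulrA; exact: poisson_denominator_gt0.
(* The product of [|S j|] and the denominator is [1 - r^N >= 1/2], so the inverse of the denominator
   is at most [2 |S j|]; squaring gives the 4. *)
have KS j : grid_kernel r l j <= 4 * (N%:R^-1 * (1 - r ^+ 2) * cabs (S j) ^+ 2).
  have r2 : 0 <= 1 - r ^+ 2 by rewrite subr_ge0 exprn_ile1// ltW.
  have -> : 4 * (N%:R^-1 * (1 - r ^+ 2) * cabs (S j) ^+ 2) =
     N%:R^-1 * ((1 - r ^+ 2) * (2 * cabs (S j)) ^+ 2) by ring.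
  rewrite /grid_kernel /poisson ler_pM2l ?invr_gt0// ler_wpM2l// -exprVn mulrA -/mu.
  rewrite ler_pXn2r ?nnegrE ?invr_ge0 ?mulr_ge0 ?cabs_ge0//.
  by rewrite -(ler_pM2l (q0 j)) divff ?gt_eqF// mulrCA SE; lra.
apply: (@le_trans _ _ (\sum_(j < N) 4 * (N%:R^-1 * (1 - r ^+ 2) * cabs (S j) ^+ 2))).
  by apply: ler_sum => j _; exact: KS.
rewrite -mulr_sumr -mulr_sumr.
have -> : \sum_(j < N) cabs (S j) ^+ 2 = N%:R * \sum_(m < N) r ^+ 2 ^+ m.
  apply: complexI; rewrite rmorph_sum rmorphM rmorph_sum /=.
  under eq_bigr do rewrite cabs_sqrJ /S.
  transitivity (\sum_(j < N) \sum_(m < N) mu^* ^+ m * (u j ^+ m * S j)).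
    apply: eq_bigr => j _; rewrite -/(S j) {2}/S rmorph_sum /= mulr_sumr.
    by apply: eq_bigr => m _; rewrite rmorphXn rmorphM /= conjCK exprMn mulrC mulrA.
  rewrite exchange_big /= rmorph_nat mulr_sumr; apply: eq_bigr => m _.
  rewrite -mulr_sumr discrete_cauchy// mulrCA -exprMn; congr (_ * _).
  rewrite mulrC -cabs_sqrJ /mu cabsM cabs_uroot mulr1 cabsR ger0_norm//.
  by rewrite !rmorphXn.
have g : (1 - r ^+ 2) * \sum_(m < N) r ^+ 2 ^+ m = 1 - r ^+ 2 ^+ N.
  by rewrite -(opprB (r ^+ 2 ^+ N)) subrX1; ring.
have -> : 4 * (N%:R^-1 * (1 - r ^+ 2) * (N%:R * \sum_(m < N) r ^+ 2 ^+ m)) =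
    4 * ((1 - r ^+ 2) * \sum_(m < N) r ^+ 2 ^+ m).
  by field; rewrite gt_eqF.
rewrite g ler_piMr// gerBl exprn_ge0// exprn_ge0//.
Qed.

End Grid.

End DiscreteMaximal.

(** * The maximal operator on a grid of roots of unity *)

Section GridMaximal.
Context (R : realType) (E : innerType R) (N : nat) (N_gt0 : (0 < N)%N).

Local Notation u := (@uroot R N).

(** Multiplying the polynomial by a geometric sum of [L] terms in [c u_j] raises its degree but
    keeps it below [N], so the discrete Cauchy formula remains exact. Two Cauchy factors are needed
    to form a kernel of Poisson type. *)
Lemma grid_cauchy_product (s : seq (nat * E)) (d L : nat) (c mu : R[i]) :
  (forall x, x \in s -> (x.1 < d)%N) -> (d + L <= N)%N ->
  \sum_(j < N) ((\sum_(i < L) (c * u j) ^+ i) * \sum_(m < N) (mu * (u j)^*) ^+ m)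
     *: poly1 s (u j) = (N%:R * \sum_(i < L) (c * mu) ^+ i) *: poly1 s mu.
Proof.
move=> sd dL; rewrite /poly1 scaler_sumr.
under eq_bigr do rewrite scaler_sumr.
rewrite exchange_big /=; apply: eq_big_seq => x /sd xd.
under eq_bigr do rewrite scalerA.
rewrite -scaler_suml scalerA; congr (_ *: _).
transitivity (\sum_(i < L) c ^+ i * \sum_(j < N) u j ^+ (i + x.1) *
    \sum_(m < N) (mu * (u j)^*) ^+ m).
  under [RHS]eq_bigr do rewrite mulr_sumr.
  rewrite exchange_big /=; apply: eq_bigr => j _.
  rewrite mulrAC !mulr_suml; apply: eq_bigr => i _.
  by rewrite exprMn exprD; ring.
rewrite mulr_sumr mulr_suml; apply: eq_bigr => i _.
rewrite discrete_cauchy//; last by rewrite (leq_trans _ dL)// addnC -addSn leq_add// ltnW.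
by rewrite exprMn exprD; ring.
Qed.

(** Take [c] to be the conjugate of [mu], so that [c mu = r^2]. The two geometric factors have
    product of modulus at most [2 / q^2], while the factor in front of the value at [mu] is at least
    [N / (2 (1 - r^2))] because [r^L <= 1/2]. Hence four times the Poisson average of the norms. *)
Lemma grid_pointwise (s : seq (nat * E)) (d L : nat) (r : R) (l : nat) :
  (forall x, x \in s -> (x.1 < d)%N) -> (d + L <= N)%N -> 0 <= r < 1 -> r ^+ L <= 2^-1 ->
  hnorm (poly1 s (r%:C%C * u l)) <= 4 * \sum_(j < N) grid_kernel N r l j * hnorm (poly1 s (u j)).
Proof.
move=> sd dL r01 rL; have [r0 r1] := andP r01.
have N0 : 0 < N%:R :> R by rewrite ltr0n.
pose mu := r%:C%C * u l; pose c := r%:C%C * (u l)^*.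
pose k j := \sum_(i < L) (c * u j) ^+ i.
pose D j := \sum_(m < N) (mu * (u j)^*) ^+ m.
pose q j := cabs (1 - mu * (u j)^*).
have q0 j : 0 < q j.
  rewrite /q /mu -mulrA; apply: poisson_denominator_gt0 => //.
  by rewrite cabsM cabsJ !cabs_uroot mulr1.
have rn n : 0 <= r ^+ n <= 1 by rewrite exprn_ge0// exprn_ile1// ltW.
have qc j : cabs (1 - c * u j) = q j.
  have rJ : (r%:C%C)^* = r%:C%C by exact: conjc_real.
  by rewrite /q /c /mu -[LHS]cabsJ rmorphB rmorph1 !rmorphM /= conjCK rJ.
have kq j : cabs (k j) * q j <= 2.
  rewrite -qc -cabsM mulrC.
  have -> : (1 - c * u j) * k j = 1 - (c * u j) ^+ L.
    by rewrite -(opprB ((c * u j) ^+ L)) subrX1 /k; ring.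
  apply: le_trans (cabsB _ _) _.
  rewrite cabs1 cabsX !cabsM cabsJ !cabs_uroot !mulr1 cabsR ger0_norm//.
  by have /andP[_] := rn L; lra.
have Dq j : cabs (D j) * q j <= 1.
  rewrite mulrC -cabsM sum_geometric_uroot//.
  have -> : 1 - mu ^+ N = (1 - r ^+ N)%:C%C.
    by rewrite /mu exprMn uroot_expN// mulr1 rmorphB rmorph1 rmorphXn.
  by rewrite cabsR; have := rn N; rewrite ler_norml; lra.
have kmu : (\sum_(i < L) (c * mu) ^+ i) = (\sum_(i < L) r ^+ 2 ^+ i)%:C%C.
  rewrite rmorph_sum /=; apply: eq_bigr => i _; rewrite !rmorphXn /=; congr (_ ^+ _).
  rewrite /c /mu mulrACA [X in _ * X]mulrC urootJ mulr1 expr2; by [].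
have ksum : 2^-1 <= (1 - r ^+ 2) * \sum_(i < L) r ^+ 2 ^+ i.
  have -> : (1 - r ^+ 2) * \sum_(i < L) r ^+ 2 ^+ i = 1 - r ^+ 2 ^+ L.
    by rewrite -(opprB (r ^+ 2 ^+ L)) subrX1; ring.
  rewrite -exprM mulnC exprM; have /andP[a0 a1] := rn L.
  have : (r ^+ L) ^+ 2 <= r ^+ L by rewrite expr2 ler_piMl.
  by move: rL; lra.
have r2 : 0 <= 1 - r ^+ 2 by have := rn 2%N; lra.
have := grid_cauchy_product c mu sd dL.
move=> /(congr1 (@hnorm _ _)); rewrite kmu hnormZ => E1.
have E2 : N%:R * (\sum_(i < L) r ^+ 2 ^+ i) * hnorm (poly1 s mu) <=
   \sum_(j < N) 2 / q j ^+ 2 * hnorm (poly1 s (u j)).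
  move: E1; rewrite cabsM cabsR ger0_norm; last by apply: sumr_ge0 => i _; rewrite !exprn_ge0.
  have -> : cabs (N%:R : R[i]) = N%:R.
    by rewrite -(rmorph_nat (real_complex R)) cabsR ger0_norm.
  move=> <-; apply: le_trans (hnorm_sum _ _ _) _; apply: ler_sum => j _.
  rewrite hnormZ ler_wpM2r ?hnorm_ge0// cabsM -/(k j) -/(D j).
  rewrite ler_pdivlMr ?exprn_gt0// expr2 mulrACA -[leRHS]mulr1.
  by apply: ler_pM => //; rewrite mulr_ge0 ?cabs_ge0// ltW.
have E3 : hnorm (poly1 s mu) <= (1 - r ^+ 2) * 2 * N%:R^-1 *
    (N%:R * (\sum_(i < L) r ^+ 2 ^+ i) * hnorm (poly1 s mu)).
  have -> : (1 - r ^+ 2) * 2 * N%:R^-1 * (N%:R * (\sum_(i < L) r ^+ 2 ^+ i) * hnorm (poly1 s mu)) =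
    2 * ((1 - r ^+ 2) * \sum_(i < L) r ^+ 2 ^+ i) * hnorm (poly1 s mu).
    by field; rewrite gt_eqF.
  by rewrite ler_peMl ?hnorm_ge0//; lra.
apply: le_trans E3 _; apply: le_trans (ler_wpM2l _ E2) _.
  by rewrite mulr_ge0 ?invr_ge0 ?(ltW N0)// mulr_ge0.
rewrite !mulr_sumr le_eqVlt; apply/orP; left; apply/eqP; apply: eq_bigr => j _.
rewrite /grid_kernel /poisson !mulrA -/mu -/(q j).
have := lt0r_neq0 (q0 j); move: (q j) => Q Q0.
by field; rewrite Q0 gt_eqF.
Qed.

(** From [K g h <= (K^2 g^2 + h^2) / 2]; the half containing [h] is absorbed by the left side. *)
Lemma sum_le_of_half (I : finType) (f g h : I -> R) (K : R) : 0 < K ->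
  \sum_i f i ^+ 2 <= \sum_i K * g i * h i -> (forall i, 0 <= g i) ->
  \sum_i h i ^+ 2 <= \sum_i f i ^+ 2 ->
  \sum_i f i ^+ 2 <= K ^+ 2 * \sum_i g i ^+ 2.
Proof.
move=> K0 h1 g0 h2.
have h3 : \sum_i K * g i * h i <= \sum_i (K ^+ 2 * g i ^+ 2 + h i ^+ 2) / 2.
  by apply: ler_sum => i _; have := sqr_ge0 (K * g i - h i); lra.
have h4 : \sum_i (K ^+ 2 * g i ^+ 2 + h i ^+ 2) / 2 =
    (K ^+ 2 * \sum_i g i ^+ 2 + \sum_i h i ^+ 2) / 2.
  by rewrite -mulr_suml big_split /= mulr_sumr.
lra.
Qed.

Section Linearized.
Context (rho : 'I_N -> R) (rho01 : forall l, 0 <= rho l < 1)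
  (rhoN : forall l, rho l ^+ N <= 2^-1).

Let A (l j : 'I_N) := grid_kernel N (rho l) l j.

Let A0 l j : 0 <= A l j. Proof. exact: grid_kernel_ge0. Qed.

(** The constant is 25 from the quasi-triangle inequality times the row sum bound 4; the symmetry of
    the kernel lets [A m j] be read as an entry in column [m]. *)
Let AAt l m : \sum_j A l j * A m j <= 100 * (A l m + A m l).
Proof.
apply: (@le_trans _ _ (\sum_j 25 * (A l m * A m j + A l j * A m l))).
  apply: ler_sum => j _.
  have := grid_kernel_quasi_triangle N l j m (rho01 l) (rho01 m).
  by rewrite (grid_kernelC N (rho m) j) (grid_kernelC N (rho m) l).
rewrite -mulr_sumr big_split /= -mulr_sumr -mulr_suml.
have rl : \sum_j A l j <= 4 by exact: grid_kernel_row.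
have rm : \sum_j A m j <= 4 by exact: grid_kernel_row.
have := ler_wpM2l (A0 l m) rm; have := ler_wpM2r (A0 m l) rl; lra.
Qed.

(* [T T^* <= 100 (T + T^* )] entrywise, hence [|T^* g|^2 <= 200 <T^* g, g>]. *)
Let Tstar_bound (g : 'I_N -> R) : (forall l, 0 <= g l) ->
  \sum_j (\sum_l A l j * g l) ^+ 2 <= 200 ^+ 2 * \sum_l g l ^+ 2.
Proof.
move=> g0; apply: (@sum_le_of_half _ _ g (fun j => \sum_l A l j * g l)) => //.
have -> : \sum_j (\sum_l A l j * g l) ^+ 2 =
    \sum_l \sum_m g l * g m * \sum_j A l j * A m j.
  under eq_bigr do rewrite expr2 mulr_suml.
  rewrite exchange_big /=; apply: eq_bigr => l _.
  under eq_bigr do rewrite mulr_sumr.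
  rewrite exchange_big /=; apply: eq_bigr => m _.
  by rewrite mulr_sumr; apply: eq_bigr => j _; ring.
apply: (@le_trans _ _ (\sum_l \sum_m g l * g m * (100 * (A l m + A m l)))).
  by apply: ler_sum => l _; apply: ler_sum => m _; rewrite ler_wpM2l ?mulr_ge0.
have -> : \sum_l \sum_m g l * g m * (100 * (A l m + A m l)) =
    \sum_l \sum_m 100 * g m * (A l m * g l) + \sum_l \sum_m 100 * g l * (A m l * g m).
  rewrite -big_split; apply: eq_bigr => l _; rewrite -big_split; apply: eq_bigr => m _ /=.
  ring.
rewrite exchange_big /= -big_split /= le_eqVlt; apply/orP; left; apply/eqP.
by apply: eq_bigr => j _; rewrite -!mulr_sumr; ring.
Qed.

(** Duality: for [f = A g] one has [|f|^2 = <g, A^T f>], and [Tstar_bound] gives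
    [|A^T f| <= 200 |f|]. *)
Lemma grid_linear_maximal (g : 'I_N -> R) : (forall l, 0 <= g l) ->
  \sum_l (\sum_j A l j * g j) ^+ 2 <= 200 ^+ 2 * \sum_l g l ^+ 2.
Proof.
move=> g0; pose f l := \sum_j A l j * g j.
have f0 l : 0 <= f l by apply: sumr_ge0 => j _; exact: mulr_ge0.
apply: (@sum_le_of_half _ f g (fun j => 200^-1 * \sum_l A l j * f l)) => //.
  rewrite le_eqVlt; apply/orP; left; apply/eqP.
  have -> : \sum_j 200 * g j * (200^-1 * \sum_l A l j * f l) = \sum_j \sum_l f l * (A l j * g j).
    by apply: eq_bigr => j _; rewrite !mulr_sumr; apply: eq_bigr => l _; field.
  by rewrite exchange_big /=; apply: eq_bigr => l _; rewrite -mulr_sumr expr2.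
have := Tstar_bound f0.
have -> : \sum_j (200^-1 * \sum_l A l j * f l) ^+ 2 =
    (200 ^+ 2)^-1 * \sum_j (\sum_l A l j * f l) ^+ 2.
  by rewrite mulr_sumr; apply: eq_bigr => j _; rewrite exprMn exprVn.
by rewrite ler_pdivrMl ?exprn_gt0.
Qed.

End Linearized.

(** The value at radius [rho l] is dominated by four times the matrix applied to the norms on the
    circle; squaring produces 16. *)
Lemma grid_maximal (s : seq (nat * E)) (d L : nat) (rho : 'I_N -> R) :
  (forall x, x \in s -> (x.1 < d)%N) -> (d + L <= N)%N ->
  (forall l, 0 <= rho l < 1) -> (forall l, rho l ^+ L <= 2^-1) ->
  \sum_(l < N) sqnorm (poly1 s ((rho l)%:C%C * u l)) <=
  16 * (200 ^+ 2 * \sum_(l < N) sqnorm (poly1 s (u l))).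
Proof.
move=> sd dL r01 rL.
have rN l : rho l ^+ N <= 2^-1.
  apply: le_trans (rL l); have /andP[r0 r1] := r01 l.
  by rewrite ler_wiXn2l ?(ltW r1)// (leq_trans _ dL)// leq_addl.
have := grid_linear_maximal r01 rN (fun l => hnorm_ge0 (poly1 s (u l))).
under [X in _ * X]eq_bigr do rewrite hnorm_sqr.
move=> h; have := ler_wpM2l (ler0n R 16) h.
apply: le_trans; rewrite mulr_sumr; apply: ler_sum => l _.
have := grid_pointwise l sd dL (r01 l) (rL l).
set S := \sum_j _; have S0 : 0 <= S.
  by apply: sumr_ge0 => j _; rewrite mulr_ge0 ?hnorm_ge0 ?grid_kernel_ge0.
have -> : 16 * S ^+ 2 = (4 * S) ^+ 2 by ring.
by rewrite -hnorm_sqr ler_pXn2r ?nnegrE ?hnorm_ge0 ?mulr_ge0.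
Qed.

End GridMaximal.

Lemma continuous_mkpair (T U V : topologicalType) (t : T) (f : T -> U) (g : T -> V) :
  {for t, continuous f} -> {for t, continuous g} ->
  {for t, continuous (fun x => (f x, g x) : U * V)}.
Proof. by move=> cf cg; exact: (cvg_pair cf cg). Qed.

Lemma continuous_fst2 (U V : topologicalType) : continuous (fun x : U * V => x.1).
Proof. by move=> x; exact: cvg_fst. Qed.

Lemma continuous_snd2 (U V : topologicalType) : continuous (fun x : U * V => x.2).
Proof. by move=> x; exact: cvg_snd. Qed.

(** * Fubini and rotation invariance on the torus *)

Section ContinuousOnSquare.
Context (R : realType).
Local Notation mu := (@lebesgue_measure R).
Implicit Types f : R * R -> R.

(** An open set is the countable union of the squares inside it that have rational centre and radius
    [1 / (n + 1)], and these are measurable rectangles. *)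
Lemma open_measurable2 (U : set (R * R)) : open U -> measurable (U : set (angles R)).
Proof.
move=> oU; pose B (i : rat * rat * nat) : set (angles R) :=
  ball (ratr i.1.1 : R) i.2.+1%:R^-1 `*` ball (ratr i.1.2 : R) i.2.+1%:R^-1.
pose F i := if `[< B i `<=` U >] then B i else set0.
have -> : U = \bigcup_i F i.
  apply/seteqP; split => [[x y] Uxy|z [i _]]; last first.
    by rewrite /F; case: asboolP => // h; exact: h.
  have /nbhs_ballP[d /= d0 hd] : nbhs (x, y) U by exact: open_nbhs_nbhs.
  pose n := Num.trunc (2 / d); pose e : R := n.+1%:R^-1.
  have e0 : 0 < e by rewrite invr_gt0.
  have ed : 2 * e < d.
    rewrite /e ltr_pdivrMr// mulrC -ltr_pdivrMr//; exact: truncnS_gt.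
  have [p /= hp] := rat_in_itvoo (ltr_pwDr e0 (lexx x) : x < x + e).
  have [q /= hq] := rat_in_itvoo (ltr_pwDr e0 (lexx y) : y < y + e).
  move: hp hq; rewrite !in_itv /= => hp hq.
  exists (p, q, n) => //; rewrite /F; case: asboolP; last first.
    move=> nB; exfalso; apply: nB => -[a b] [/= ha hb]; apply: hd; split => /=;
      move: ha hb; rewrite -!ball_normE /= !ltr_norml -/e; lra.
  by move=> _; split; rewrite -ball_normE /= ltr_norml -/e; lra.
apply: countable_bigcupT_measurable => // i; rewrite /F; case: asboolP => // _.
by apply: measurableX; apply: open_measurable; exact: ball_open.
Qed.

Lemma continuous_measurable2 f : continuous f -> measurable_fun setT (f : angles R -> R).
Proof.
move=> /continuousP cf; apply: (measurability _ (RGenOpens.measurableE R)).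
move=> _ [_ [a [b ->] <-]]; rewrite setTI.
by apply: open_measurable2; apply: cf; exact: interval_open.
Qed.

Lemma compact_unit_square : compact (`[0, 1]%classic `*` `[0, 1]%classic : set (R * R)).
Proof. by apply: compact_setX; exact: segment_compact. Qed.

Lemma continuous_bounded2 f : continuous f ->
  exists M, forall t : R * R, square (t : angles R) -> `|f t| <= M.
Proof.
move=> cf.
have : compact (f @` (`[0, 1]%classic `*` `[0, 1]%classic)).
  by apply: continuous_compact; [exact: continuous_subspaceT|exact: compact_unit_square].
move=> /compact_bounded[M [_ hM]]; exists (M + 1) => t tS.
by apply: (hM (M + 1)); [rewrite ltrDl|exists t].
Qed.

Lemma mu2_square : mu2 (square : set (angles R)) = 1%E.
Proof.
rewrite /mu2 /square product_measure1E; [|exact: measurable_itv|exact: measurable_itv].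
by rewrite /= lebesgue_measure_itv /= lte_fin ltr01 oppr0 adde0 mule1.
Qed.

Lemma bounded_integrable_square (f : angles R -> R) M :
  measurable_fun square f -> (forall t, square t -> `|f t| <= M) ->
  mu2.-integrable square (EFin \o f).
Proof.
move=> mf fM; apply: (@le_integrable _ _ _ mu2 _ _ _ (fun=> M%:E)) => //.
- exact/measurable_EFinP.
- move=> t tS /=; rewrite lee_fin [leRHS]ger0_norm ?fM//.
  exact: le_trans (normr_ge0 _) (fM t tS).
- apply/integrableP; split; first exact: measurable_cst.
  have -> : (\int[mu2]_(t in square) `|M%:E| = `|M|%:E * mu2 (square : set (angles R)))%E.
    exact: integral_cst.
  by rewrite mu2_square mule1 ltry.
Qed.

Lemma continuous_integrable2 f : continuous f ->
  mu2.-integrable square (EFin \o (f : angles R -> R)).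
Proof.
move=> cf; have [M fM] := continuous_bounded2 cf.
by apply: bounded_integrable_square fM; apply: measurable_funTS; exact: continuous_measurable2.
Qed.

Lemma continuous_section f (x : R) : continuous f -> continuous (fun y => f (x, y)).
Proof.
move=> cf y; apply: (@continuous_comp _ _ _ (fun y => (x, y)) f); last exact: cf.
by apply: continuous_mkpair; [exact: cvg_cst|exact: cvg_id].
Qed.

Lemma fubini_square f : continuous f ->
  \int[mu2]_(t in square) f t =
  \int[mu]_(x in `[0, 1]) \int[mu]_(y in `[0, 1]) f (x, y).
Proof.
move=> cf; have If := continuous_integrable2 cf.
pose g : angles R -> \bar R := (EFin \o f) \_ square.
have Ig : mu2.-integrable setT g.
  by apply/integrable_restrict => //; rewrite setTI.
have E : (\int[mu2]_(t in square) (f t)%:E =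
    \int[mu]_(x in `[0%R, 1%R]) \int[mu]_(y in `[0%R, 1%R]) (f (x, y))%:E)%E.
  rewrite integral_mkcond.
  transitivity (\int[mu]_x \int[mu]_y g (x, y))%E.
    by symmetry; exact: (integral12_prod_meas1 Ig).
  rewrite [RHS]integral_mkcond; apply: eq_integral => x _.
  rewrite patchE; case: ifPn => xI.
    rewrite [RHS]integral_mkcond; apply: eq_integral => y _.
    rewrite /g !patchE /=; have -> : ((x, y) \in (square : set (angles R))) = (y \in `[0%R, 1%R]%classic).
      by apply/idP/idP; rewrite !inE /square /=; [case|move/set_mem: xI].
    by [].
  transitivity (\int[mu]_y (cst 0%E y))%E; last by rewrite integral0.
  apply: eq_integral => y _; rewrite /g patchE memNset// => -[/= h _].
  by move: xI; rewrite notin_setE.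
rewrite /Rintegral E; congr fine; apply: eq_integral => x _.
rewrite fineK//; apply: integrable_fin_num => //.
by apply: integrable_cont => y _; exact: continuous_section.
Qed.

Lemma fubini_square' f : continuous f ->
  \int[mu2]_(t in square) f t =
  \int[mu]_(y in `[0, 1]) \int[mu]_(x in `[0, 1]) f (x, y).
Proof.
move=> cf; have If := continuous_integrable2 cf.
pose g : angles R -> \bar R := (EFin \o f) \_ square.
have Ig : mu2.-integrable setT g.
  by apply/integrable_restrict => //; rewrite setTI.
have E : (\int[mu2]_(t in square) (f t)%:E =
    \int[mu]_(y in `[0%R, 1%R]) \int[mu]_(x in `[0%R, 1%R]) (f (x, y))%:E)%E.
  rewrite integral_mkcond.
  transitivity (\int[mu]_y \int[mu]_x g (x, y))%E.
    by symmetry; exact: (integral21_prod_meas1 Ig).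
  rewrite [RHS]integral_mkcond; apply: eq_integral => y _.
  rewrite patchE; case: ifPn => yI.
    rewrite [RHS]integral_mkcond; apply: eq_integral => x _.
    rewrite /g !patchE /=; have -> : ((x, y) \in (square : set (angles R))) = (x \in `[0%R, 1%R]%classic).
      by apply/idP/idP; rewrite !inE /square /=; [case|move/set_mem: yI].
    by [].
  transitivity (\int[mu]_x (cst 0%E x))%E; last by rewrite integral0.
  apply: eq_integral => x _; rewrite /g patchE memNset// => -[/= _ h].
  by move: yI; rewrite notin_setE.
rewrite /Rintegral E; congr fine; apply: eq_integral => y _.
rewrite fineK//; apply: integrable_fin_num => //.
apply: integrable_cont => x _.
apply: (@continuous_comp _ _ _ (fun x => (x, y)) f); last exact: cf.
by apply: continuous_mkpair; [exact: cvg_id|exact: cvg_cst].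
Qed.

(** The shifted integral runs over the interval from [a] to [1 + a]; its part beyond 1 is moved back
    by one period. *)
Lemma shift_integral (f : R -> R) (a : R) : continuous f -> (forall x, f (x + 1) = f x) ->
  0 <= a <= 1 -> \int[mu]_(x in `[0, 1]) f (x + a) = \int[mu]_(x in `[0, 1]) f x.
Proof.
move=> cf pf /andP[a0 a1].
have sub (b c d : R) : c <= d -> \int[mu]_(x in `[c, d]) f (x + b) = \int[mu]_(x in `[c + b, d + b]) f x.
  move=> cd; rewrite /Rintegral.
  have dF (x : R) : is_derive x (1 : R) (fun x : R => x + b) 1.
    rewrite -[X in is_derive _ _ _ X]addr0.
    exact: (@is_deriveD _ _ _ (id : R -> R) (cst b) x 1 1 0 _ _).
  have F'E : derive1 (fun x : R => x + b) = cst 1.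
    by apply/funext => x; rewrite derive1E; have [_ ->] := dF x.
  rewrite (@integration_by_substitution_increasing R (fun x => x + b) f c d cd).
  - by congr fine; apply: eq_integral => x _; rewrite F'E /= mulr1.
  - by move=> x y _ _; rewrite ltrD2r.
  - by rewrite F'E => x _; exact: cvg_cst.
  - by rewrite F'E; exact: is_cvg_cst.
  - by rewrite F'E; exact: is_cvg_cst.
  - split.
    + by move=> x _; have [] := dF x.
    + by apply: cvg_at_right_filter; apply: cvgD; [exact: cvg_id|exact: cvg_cst].
    + by apply: cvg_at_left_filter; apply: cvgD; [exact: cvg_id|exact: cvg_cst].
  - exact: continuous_subspaceT.
have split3 (b c d : R) : b <= c <= d ->
    \int[mu]_(x in `[b, d]) f x = \int[mu]_(x in `[b, c]) f x + \int[mu]_(x in `[c, d]) f x.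
  move=> bcd; have cc : ccont b d (fun x => (f x)%:C%C : R[i]^o).
    move=> x _; apply: (@continuous_comp _ _ _ f (fun a : R => a%:C%C : R[i]^o)).
      exact: cf.
    exact: continuous_real_complex.
  by have /(congr1 (fun z : R[i] => complex.Re z)) := cint_split bcd cc.
rewrite sub ?ler01// add0r (split3 a 1 (1 + a)); last by rewrite a1 lerDl.
rewrite (split3 0 a 1) ?a0// addrC; congr (_ + _).
have := sub 1 0 a a0; rewrite add0r (addrC a) => <-.
by apply: eq_Rintegral => x _; rewrite pf.
Qed.

Lemma shift_integral_snd f (a : R) : continuous f -> (forall x y, f (x, y + 1) = f (x, y)) ->
  0 <= a <= 1 -> \int[mu2]_(t in square) f (t.1, t.2 + a) = \int[mu2]_(t in square) f t.
Proof.
move=> cf p2 a01.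
have cg : continuous (fun t : R * R => f (t.1, t.2 + a)).
  move=> t; apply: (@continuous_comp _ _ _ (fun t : R * R => (t.1, t.2 + a)) f); last exact: cf.
  by apply: continuous_mkpair; [exact: continuous_fst2|apply: cvgD; [exact: continuous_snd2|exact: cvg_cst]].
rewrite (fubini_square cg) (fubini_square cf) /=; apply: eq_Rintegral => x _.
by apply: (@shift_integral (fun y => f (x, y))) => //; exact: continuous_section.
Qed.

Lemma swap_square f : continuous f ->
  \int[mu2]_(t in square) f t = \int[mu2]_(t in square) f (t.2, t.1).
Proof.
move=> cf; rewrite (fubini_square' cf) fubini_square//.
move=> t; apply: (@continuous_comp _ _ _ (fun t : R * R => (t.2, t.1)) f); last exact: cf.
by apply: continuous_mkpair; [exact: continuous_snd2|exact: continuous_fst2].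
Qed.

Lemma shift_integral2 f (a : R) : continuous f -> (forall x y, f (x + 1, y) = f (x, y)) ->
  (forall x y, f (x, y + 1) = f (x, y)) -> 0 <= a <= 1 ->
  \int[mu2]_(t in square) f (t.1 + a, t.2 + a) = \int[mu2]_(t in square) f t.
Proof.
move=> cf p1 p2 a01.
have cg : continuous (fun t : R * R => f (t.1 + a, t.2)).
  move=> t; apply: (@continuous_comp _ _ _ (fun t : R * R => (t.1 + a, t.2)) f); last exact: cf.
  by apply: continuous_mkpair; [apply: cvgD; [exact: continuous_fst2|exact: cvg_cst]|exact: continuous_snd2].
have ch : continuous (fun t : R * R => f (t.2, t.1)).
  move=> t; apply: (@continuous_comp _ _ _ (fun t : R * R => (t.2, t.1)) f); last exact: cf.
  by apply: continuous_mkpair; [exact: continuous_snd2|exact: continuous_fst2].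
have h1 := @shift_integral_snd _ a cg (fun x y => p2 (x + a) y) a01.
rewrite /= in h1; rewrite {}h1.
rewrite (swap_square cg) /= (swap_square cf).
exact: (@shift_integral_snd (fun t => f (t.2, t.1)) a ch (fun x y => p1 y x) a01).
Qed.

End ContinuousOnSquare.

(** * The maximal inequality for polynomials in two variables *)

Section PolynomialMaximal.
Context (R : realType) (E : sepHilbertType R).

(* A polynomial is a list of pairs (exponents, coefficient). *)
Definition poly2 (s : seq (nat * nat * E)) (z : C2 R) : E :=
  \sum_(x <- s) ((z.1 : R[i]) ^+ x.1.1 * (z.2 : R[i]) ^+ x.1.2) *: x.2.

Lemma continuous_sqnorm (T : topologicalType) (F : T -> E) (t : T) :
  {for t, continuous F} -> {for t, continuous (fun x => sqnorm (F x))}.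
Proof.
move=> /cvgrPdist_lt cF; apply/cvgrPdist_lt => e e0.
pose d := Num.min 1 (e / (2 * hnorm (F t) + 1 + 1)).
have h0 := hnorm_ge0 (F t).
have d0 : 0 < d by rewrite lt_min ltr01 divr_gt0//; lra.
have dc : 0 < d%:C%C by rewrite ltcR.
have := cF _ dc; apply: filterS => x; rewrite normr_hnorm ltcR lt_min => /andP[h1].
rewrite ltr_pdivlMr; last lra.
move=> h2; rewrite -!hnorm_sqr.
have h3 := ler_hnorm_distD (F t) (F x) 0; have h4 := ler_hnorm_distD (F x) (F t) 0.
rewrite !subr0 in h3 h4; rewrite (hnorm_distC (F x)) in h4.
have hx0 := hnorm_ge0 (F x); have hd := hnorm_ge0 (F t - F x).
rewrite subr_sqr normrM (ger0_norm (addr_ge0 h0 hx0)).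
have : `|hnorm (F t) - hnorm (F x)| <= hnorm (F t - F x) by rewrite ler_norml; lra.
have := normr_ge0 (hnorm (F t) - hnorm (F x)); nra.
Qed.

Lemma continuous_cis_fst : continuous (fun t : R * R => cis t.1 : R[i]^o).
Proof.
move=> t; apply: (@continuous_comp _ _ _ (fun t : R * R => t.1) (@cis R : R -> R[i]^o)).
  exact: continuous_fst2.
exact: continuous_cis.
Qed.

Lemma continuous_cis_snd : continuous (fun t : R * R => cis t.2 : R[i]^o).
Proof.
move=> t; apply: (@continuous_comp _ _ _ (fun t : R * R => t.2) (@cis R : R -> R[i]^o)).
  exact: continuous_snd2.
exact: continuous_cis.
Qed.

Lemma continuous_exprn (T : topologicalType) (f : T -> R[i]^o) t n :
  {for t, continuous f} -> {for t, continuous (fun x => (f x : R[i]) ^+ n : R[i]^o)}.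
Proof.
move=> cf; elim: n => [|n IH]; first exact: cvg_cst.
have -> : (fun x => (f x : R[i]) ^+ n.+1 : R[i]^o) = (fun x => f x * ((f x : R[i]) ^+ n : R[i]^o)).
  by apply/funext => x; rewrite exprS.
exact: (cvgM cf IH).
Qed.

Lemma continuous_cprod (T : topologicalType) (f g : T -> R[i]^o) t :
  {for t, continuous f} -> {for t, continuous g} ->
  {for t, continuous (fun x => (f x : R[i]) * (g x : R[i]) : R[i]^o)}.
Proof. exact: cvgM. Qed.

Lemma continuous_poly2 (T : topologicalType) s (f : T -> C2 R) t :
  {for t, continuous (fun x => (f x).1)} -> {for t, continuous (fun x => (f x).2)} ->
  {for t, continuous (fun x => poly2 s (f x))}.
Proof.
move=> c1 c2; rewrite /poly2; elim: s => [|x s IH].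
  have -> : (fun y => \sum_(x <- [::]) (((f y).1 : R[i]) ^+ x.1.1 * ((f y).2 : R[i]) ^+ x.1.2) *: x.2) = fun=> (0 : E).
    by apply/funext => y; rewrite big_nil.
  exact: cvg_cst.
have -> : (fun y => \sum_(x <- x :: s) (((f y).1 : R[i]) ^+ x.1.1 * ((f y).2 : R[i]) ^+ x.1.2) *: x.2) =
  fun y => (((f y).1 : R[i]) ^+ x.1.1 * ((f y).2 : R[i]) ^+ x.1.2) *: x.2 +
   \sum_(x <- s) (((f y).1 : R[i]) ^+ x.1.1 * ((f y).2 : R[i]) ^+ x.1.2) *: x.2.
  by apply/funext => y; rewrite big_cons.
apply: cvgD; last exact: IH.
have h := continuous_cprod (continuous_exprn (n := x.1.1) c1) (continuous_exprn (n := x.1.2) c2).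
exact: (cvgZ h (cvg_cst (x.2 : E))).
Qed.

Lemma continuous_poly2_radial s r :
  continuous (fun t : R * R => sqnorm (poly2 s (radial r t))).
Proof.
move=> t; apply: (@continuous_sqnorm _ (fun t : R * R => poly2 s (radial r t))).
apply: (@continuous_poly2 _ s (fun t : R * R => radial r t)).
  by apply: cvgM; [exact: cvg_cst|exact: continuous_cis_fst].
by apply: cvgM; [exact: cvg_cst|exact: continuous_cis_snd].
Qed.

Lemma radial1 (t : angles R) : radial 1 t = torus t.
Proof. by rewrite /radial rmorph1 !mul1r. Qed.

(** Rotating both angles by [a] turns the polynomial into one in the single variable [r cis a],
    graded by total degree. This reduces the torus to its diagonal circles. *)
Lemma radial_shift s (r a : R) (t : R * R) : poly2 s (radial r (t.1 + a, t.2 + a)) =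
  poly1 [seq ((x.1.1 + x.1.2)%N, ((cis t.1) ^+ x.1.1 * (cis t.2) ^+ x.1.2) *: x.2) | x <- s]
    (r%:C%C * cis a).
Proof.
rewrite /poly1 big_map; apply: eq_bigr => x _ /=; rewrite scalerA; congr (_ *: _).
by rewrite !cisD !exprMn !exprD; ring.
Qed.

Lemma cis_periodic (x : R) : cis (x + 1) = cis x.
Proof. by rewrite cisD cis1 mulr1. Qed.

Lemma continuous_bigsum (I : Type) (F : I -> R * R -> R) :
  (forall i, continuous (F i)) -> forall s, continuous (fun t => \sum_(i <- s) F i t).
Proof.
move=> cF; elim=> [|i s IH] t.
  have -> : (fun t => \sum_(i <- [::]) F i t) = fun=> 0.
    by apply/funext => y; rewrite big_nil.
  exact: cvg_cst.
have -> : (fun t => \sum_(i <- i :: s) F i t) = fun t => F i t + \sum_(i <- s) F i t.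
  by apply/funext => y; rewrite big_cons.
exact: (cvgD (cF i t) (IH t)).
Qed.

Lemma Rintegral_square_sum (I : Type) (s : seq I) (F : I -> R * R -> R) :
  (forall i, continuous (F i)) ->
  \int[mu2]_(t in square) (\sum_(i <- s) F i t) =
  \sum_(i <- s) \int[mu2]_(t in square) F i t.
Proof.
move=> cF; have cS := continuous_bigsum cF.
elim: s => [|i s IH].
  rewrite big_nil; transitivity (\int[mu2]_(t in (square : set (angles R))) (0 : R)).
    by apply: eq_Rintegral => t _; rewrite big_nil.
  by rewrite /Rintegral integral0.
under eq_Rintegral do rewrite big_cons.
rewrite RintegralD//; [|exact: continuous_integrable2|exact: continuous_integrable2].
by rewrite big_cons IH.
Qed.

(** With finitely many radii the maximum is continuous, hence integrable; [radial_grid] later passes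
    to all radii. *)
Definition radial_max s (rs : seq R) (t : R * R) : R :=
  \big[Num.max/0]_(r <- rs) sqnorm (poly2 s (radial r t)).

Lemma continuous_maxr (T : topologicalType) (f g : T -> R) t :
  {for t, continuous f} -> {for t, continuous g} ->
  {for t, continuous (fun x => Num.max (f x) (g x))}.
Proof.
move=> cf cg; have -> : (fun x => Num.max (f x) (g x)) = fun x => (f x + g x + `|f x - g x|) / 2.
  by apply/funext => x; rewrite maxr_absE.
apply: cvgMl; apply: cvgD; first exact: (cvgD cf cg).
by apply: cvg_norm; exact: (cvgB cf cg).
Qed.

Lemma continuous_radial_max s rs : continuous (radial_max s rs).
Proof.
move=> t; elim: rs => [|r rs IH].
  have -> : radial_max s [::] = fun=> 0 by apply/funext => y; rewrite /radial_max big_nil.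
  exact: cvg_cst.
have -> : radial_max s (r :: rs) =
    fun t => Num.max (sqnorm (poly2 s (radial r t))) (radial_max s rs t).
  by apply/funext => y; rewrite /radial_max big_cons.
exact: (continuous_maxr (@continuous_poly2_radial s r t) IH).
Qed.

Lemma radial_max_attained s rs (L : nat) : (0 < L)%N ->
  (forall r, r \in rs -> 0 <= r < 1 /\ r ^+ L <= 2^-1) ->
  forall t, exists r, [/\ 0 <= r < 1, r ^+ L <= 2^-1 &
    radial_max s rs t <= sqnorm (poly2 s (radial r t))].
Proof.
move=> L0 + t; elim: rs => [|r rs IH] hrs.
  (* Without radii the maximum is 0, and the radius 0 is admissible because [0 < L] makes [0 ^+ L]
     vanish. *)
  exists 0; rewrite lexx ltr01 expr0n gtn_eqF// invr_ge0 ler0n; split => //.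
  by rewrite /radial_max big_nil sqnorm_ge0.
have hrs' x : x \in rs -> 0 <= x < 1 /\ x ^+ L <= 2^-1.
  by move=> h; apply: hrs; rewrite inE h orbT.
have [r' [h1 h2 h3]] := IH hrs'.
rewrite /radial_max big_cons -/(radial_max s rs t).
have [le|/ltW ge] := leP (radial_max s rs t) (sqnorm (poly2 s (radial r t))).
  have [r1 r2] := hrs r (mem_head _ _).
  exists r; split; [exact: r1|exact: r2|exact: lexx].
by exists r'; split; [exact: h1|exact: h2|exact: h3].
Qed.

Lemma radii_power (rs : seq R) : (forall r, r \in rs -> 0 <= r < 1) ->
  exists2 L, (0 < L)%N & forall r, r \in rs -> r ^+ L <= 2^-1.
Proof.
elim: rs => [|r rs IH] hrs; first by exists 1%N.
have hrs' x : x \in rs -> 0 <= x < 1 by move=> h; apply: hrs; rewrite inE h orbT.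
have [L L0 hL] := IH hrs'.
have /andP[r0 r1] := hrs r (mem_head _ _).
have /cvgrPdist_le/(_ (2^-1) ltac:(by rewrite invr_gt0))[M _ hM] :=
  @cvg_expr R r ltac:(by rewrite ger0_norm).
exists (L + M)%N; first by rewrite addn_gt0 L0.
move=> r'; rewrite inE => /predU1P[->|r'rs].
  have := hM (L + M)%N (leq_addl _ _); rewrite /= sub0r normrN ger0_norm//.
  by rewrite exprn_ge0.
apply: le_trans (hL _ r'rs); have /andP[a0 a1] := hrs' _ r'rs.
by rewrite ler_wiXn2l ?(ltW a1)// leq_addr.
Qed.

Lemma radial_max_periodic1 s rs x y : radial_max s rs (x + 1, y) = radial_max s rs (x, y).
Proof. by rewrite /radial_max; apply: eq_bigr => r _; rewrite /radial /= cis_periodic. Qed.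

Lemma radial_max_periodic2 s rs x y : radial_max s rs (x, y + 1) = radial_max s rs (x, y).
Proof. by rewrite /radial_max; apply: eq_bigr => r _; rewrite /radial /= cis_periodic. Qed.

(** Each diagonal rotation preserves the integral, so the integral of [f] is that of its average
    over a grid on every diagonal circle. *)
Lemma average_square (f : R * R -> R) (N : nat) : (0 < N)%N -> continuous f ->
  (forall x y, f (x + 1, y) = f (x, y)) -> (forall x y, f (x, y + 1) = f (x, y)) ->
  N%:R * \int[mu2]_(t in square) f t =
  \int[mu2]_(t in square) \sum_(l < N) f (t.1 + l%:R / N%:R, t.2 + l%:R / N%:R).
Proof.
move=> N0 cf p1 p2; rewrite Rintegral_square_sum.
  rewrite (eq_bigr (fun=> \int[mu2]_(t in square) f t)) => [|l _].
    by rewrite sumr_const card_ord mulr_natl.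
  apply: shift_integral2 => //; rewrite divr_ge0 ?ler0n//= ler_pdivrMr ?ltr0n// mul1r.
  by rewrite ler_nat ltnW.
move=> l t; apply: (@continuous_comp _ _ _ (fun t : R * R => (t.1 + l%:R / N%:R, t.2 + l%:R / N%:R)) f);
  last exact: cf.
by apply: continuous_mkpair; (apply: cvgD; last exact: cvg_cst);
  [exact: continuous_fst2|exact: continuous_snd2].
Qed.

Definition maximal_constant : R := 16 * 200 ^+ 2.

(** For each [t] separately, radii attaining the maximum at the grid points are chosen and
    [grid_maximal] is applied. The radii occur in neither of the two sums that are integrated, so
    the choice need not be measurable. *)
Lemma integral_radial_max s (rs : seq R) : (forall r, r \in rs -> 0 <= r < 1) ->
  \int[mu2]_(t in square) radial_max s rs t <=
  maximal_constant * \int[mu2]_(t in square) sqnorm (poly2 s (torus t)).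
Proof.
move=> hrs; have [L L0 hL] := radii_power hrs.
(* The successor makes [d] a strict bound for the total degree of every monomial. *)
pose d := (\sum_(x <- s) (x.1.1 + x.1.2)).+1%N.
pose N := (d + L)%N; have N0 : (0 < N)%N by [].
have NR : 0 < N%:R :> R by rewrite ltr0n.
pose g (t : R * R) := sqnorm (poly2 s (radial 1 t)).
have cm : continuous (radial_max s rs) by exact: continuous_radial_max.
have cg : continuous g by exact: continuous_poly2_radial.
have -> : \int[mu2]_(t in square) sqnorm (poly2 s (torus t)) = \int[mu2]_(t in square) g t.
  by apply: eq_Rintegral => t _; rewrite /g radial1.
rewrite -(ler_pM2l NR) (average_square N0 cm); last 2 first.
- by move=> x y; exact: radial_max_periodic1.
- by move=> x y; exact: radial_max_periodic2.
rewrite mulrCA (average_square N0 cg); last 2 first.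
- by move=> x y; rewrite /g /radial /= cis_periodic.
- by move=> x y; rewrite /g /radial /= cis_periodic.
have cS (f : R * R -> R) : continuous f ->
    continuous (fun t : R * R => \sum_(l < N) f (t.1 + l%:R / N%:R, t.2 + l%:R / N%:R)).
  move=> cf; apply: continuous_bigsum => l t; apply: (@continuous_comp _ _ _ (fun t : R * R => (t.1 + l%:R / N%:R, t.2 + l%:R / N%:R)) f);
    last exact: cf.
  by apply: continuous_mkpair; (apply: cvgD; last exact: cvg_cst);
    [exact: continuous_fst2|exact: continuous_snd2].
rewrite -RintegralZl//; last exact: (continuous_integrable2 (cS _ cg)).
apply: le_Rintegral => //.
- exact: (continuous_integrable2 (cS _ cm)).
- by apply: continuous_integrable2 => t; apply: cvgMr; exact: (cS _ cg).
move=> t _; have /choice[rho hrho] := fun l : 'I_N => radial_max_attained s L0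
  (fun r h => conj (hrs r h) (hL r h)) (t.1 + l%:R / N%:R, t.2 + l%:R / N%:R).
pose q := [seq ((x.1.1 + x.1.2)%N, ((cis t.1) ^+ x.1.1 * (cis t.2) ^+ x.1.2) *: x.2) | x <- s].
apply: (@le_trans _ _ (\sum_(l < N) sqnorm (poly1 q ((rho l)%:C%C * uroot R N l)))).
  by apply: ler_sum => l _; have [_ _] := hrho l; rewrite radial_shift.
have := @grid_maximal R E N N0 q d L rho; rewrite /maximal_constant -mulrA.
have -> : \sum_(l < N) g (t.1 + l%:R / N%:R, t.2 + l%:R / N%:R) =
    \sum_(l < N) sqnorm (poly1 q (uroot R N l)).
  by apply: eq_bigr => l _; rewrite /g radial_shift rmorph1 mul1r.
apply => //; [|by move=> l; have [] := hrho l|by move=> l; have [] := hrho l].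
move=> x /mapP[y ys ->] /=; rewrite /d ltnS (big_rem _ ys) /=.
exact: leq_addr.
Qed.

End PolynomialMaximal.

(** * The Hardy space of the bidisk *)

Section ContinuousL2.
Context (R : realType) (E : sepHilbertType R).
Implicit Types (f g : R * R -> E) (a b : R * R -> R[i]^o) (u v : L2 E).

Lemma toL2_class h (hP : square_integrable h) : toL2 h = L2class hP :> L2 E.
Proof.
rewrite /toL2; case: xgetP => [v _ hv|/(_ (L2class hP))]; last by have := L2fun_class hP.
apply: L2ext; move: hv (L2fun_class hP) => /=.
by apply: filterS2 => t h1 h2 tS; rewrite h1// h2.
Qed.

Lemma toL2E (h : angles R -> E) : square_integrable h -> L2fun (toL2 h) = h %[ae mu2 in square].
Proof. by move=> hP; rewrite (toL2_class hP); exact: L2fun_class. Qed.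

Lemma toL2_eq (h : angles R -> E) v : L2fun v = h %[ae mu2 in square] -> toL2 h = v.
Proof.
move=> vh; rewrite /toL2; case: xgetP => [w _ hw|/(_ v)]; last by move/(_ vh).
apply: L2ext; move: hw vh => /=.
by apply: filterS2 => t h1 h2 tS; rewrite h1// h2.
Qed.

Lemma continuous_innerl (T : topologicalType) (F : T -> E) (y : E) t :
  {for t, continuous F} -> {for t, continuous (fun x => inner (F x) y : R[i]^o)}.
Proof.
move=> /cvgrPdist_lt cF; apply/cvgrPdist_lt => e /gt0_complexE[-> e0].
set e' := complex.Re e in e0 *; have h0 := hnorm_ge0 y.
have dc : 0 < (e' / (2 * hnorm y + 1))%:C%C by rewrite ltcR divr_gt0//; lra.
have := cF _ dc; apply: filterS => x; rewrite normr_hnorm ltcR ltr_pdivlMr; last lra.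
move=> h; rewrite cabsE ltcR -innerNl -innerDl; apply: le_lt_trans (cabs_le_ReIm _) _.
rewrite Im_inner_Rinl -/(Rin _ _).
have h1 := normr_Rin_le (F t - F x) y.
have h2 := normr_Rin_le ((- 'i)%C *: (F t - F x)) y.
have i1 : cabs (- 'i : R[i])%C = 1.
  by rewrite /cabs normc_def /= oppr0 expr0n add0r sqrrN expr1n sqrtr1.
rewrite hnormZ i1 mul1r in h2; have := hnorm_ge0 (F t - F x); nra.
Qed.

Lemma continuous_Rin (T : topologicalType) (F : T -> E) (y : E) t :
  {for t, continuous F} -> {for t, continuous (fun x => Rin (F x) y)}.
Proof.
move=> cF; apply: (@continuous_comp _ _ _ (fun x => inner (F x) y : R[i]^o) (fun z : R[i]^o => complex.Re z)).
  exact: continuous_innerl.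
exact: continuous_Re.
Qed.

Lemma continuous_weakly_measurable f : continuous f -> weakly_measurable (f : angles R -> E).
Proof.
move=> cf; apply: weakly_measurable_Rin => y; apply: measurable_funTS.
apply: (@continuous_measurable2 R (fun t => Rin (f t) y)) => t.
exact: (continuous_Rin (cf t)).
Qed.

Lemma continuous_square_integrable f : continuous f -> square_integrable (f : angles R -> E).
Proof.
move=> cf; split; first exact: continuous_weakly_measurable.
have cs : continuous (fun t => sqnorm (f t)) by move=> t; exact: (continuous_sqnorm (cf t)).
have /integrableP[_] := continuous_integrable2 cs.
by under eq_integral do rewrite /= ger0_norm ?sqnorm_ge0//.
Qed.

Lemma sqnorm_toL2 h : square_integrable h ->
  sqnorm (toL2 h : L2 E) = \int[mu2]_(t in square) sqnorm (h t).
Proof.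
move=> hP; rewrite sqnorm_L2; apply: ae_eq_Rintegral.
- exact: integrable_sqnorm (L2funP _).
- exact: integrable_sqnorm hP.
- by move: (toL2E hP); apply: filterS => t h1 tS; rewrite h1.
Qed.

Lemma toL2D h k : square_integrable h -> square_integrable k ->
  toL2 (h + k) = toL2 h + toL2 k :> L2 E.
Proof.
move=> hP kP; apply: toL2_eq; move: (L2funD (toL2 h) (toL2 k)) (toL2E hP) (toL2E kP).
by apply: filterS3 => t h1 h2 h3 tS; rewrite h1//= h2// h3.
Qed.

Lemma toL2Z (c : R[i]) h : square_integrable h -> toL2 (c *: h) = c *: toL2 h :> L2 E.
Proof.
move=> hP; apply: toL2_eq; move: (L2funZ c (toL2 h)) (toL2E hP).
by apply: filterS2 => t h1 h2 tS; rewrite h1//= h2.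
Qed.

Lemma inner_toL2 f g : continuous f -> continuous g ->
  continuous (fun t => inner (f t) (g t) : R[i]^o) ->
  inner (toL2 f : L2 E) (toL2 g) =
  cint 0 1 (fun x => cint 0 1 (fun y => inner (f (x, y)) (g (x, y)))).
Proof.
move=> cf cg cfg; have fP := continuous_square_integrable cf.
have gP := continuous_square_integrable cg.
have [i1 i2] := integrable_inner (L2funP (toL2 f)) (L2funP (toL2 g)).
have [j1 j2] := integrable_inner fP gP.
have c1 : continuous (fun t => complex.Re (inner (f t) (g t))).
  move=> t; exact: (@continuous_comp _ _ _ (fun t => inner (f t) (g t) : R[i]^o)
    (fun z : R[i]^o => complex.Re z) t (cfg t) (@continuous_Re R _)).
have c2 : continuous (fun t => complex.Im (inner (f t) (g t))).
  move=> t; exact: (@continuous_comp _ _ _ (fun t => inner (f t) (g t) : R[i]^o)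
    (fun z : R[i]^o => complex.Im z) t (cfg t) (@continuous_Im R _)).
rewrite -[inner _ _]/(L2inner _ _); apply: complex_eq.
- rewrite Re_L2inner.
  transitivity (\int[mu2]_(t in square) complex.Re (inner (f t) (g t))).
    apply: ae_eq_Rintegral => //; move: (toL2E fP) (toL2E gP).
    by apply: filterS2 => t h1 h2 tS; rewrite h1// h2.
  by rewrite (fubini_square c1).
- rewrite Im_L2inner.
  transitivity (\int[mu2]_(t in square) complex.Im (inner (f t) (g t))).
    apply: ae_eq_Rintegral => //; move: (toL2E fP) (toL2E gP).
    by apply: filterS2 => t h1 h2 tS; rewrite h1// h2.
  by rewrite (fubini_square c2).
Qed.

Lemma continuous_scale a (y : E) : continuous a -> continuous (fun t => (a t : R[i]) *: y).
Proof. by move=> ca t; exact: (cvgZ (ca t) (cvg_cst y)). Qed.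

Definition mulE a (y : E) : L2 E := toL2 (fun t : angles R => (a t : R[i]) *: y).

Lemma mulE_linear a : continuous a -> linear (mulE a).
Proof.
move=> ca c x y; rewrite /mulE.
have P z := continuous_square_integrable (@continuous_scale a z ca).
rewrite -toL2Z// -toL2D//; last exact: square_integrableZ.
congr toL2; apply/funext => t.
by rewrite -[RHS]/(c *: ((a t : R[i]) *: x) + (a t : R[i]) *: y) scalerDr !scalerA mulrC.
Qed.

Lemma mulE_bound a (y : E) (M : R) : continuous a -> (forall t, cabs (a t) <= M) ->
  hnorm (mulE a y) <= M * hnorm y.
Proof.
move=> ca aM; have M0 : 0 <= M by apply: le_trans (aM (0, 0)); exact: cabs_ge0.
have P := continuous_square_integrable (@continuous_scale a y ca).
rewrite ler_hnorm ?mulr_ge0 ?hnorm_ge0// sqnorm_toL2//.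
have -> : (M * hnorm y) ^+ 2 = \int[mu2]_(t in (square : set (angles R))) (M * hnorm y) ^+ 2.
  transitivity ((M * hnorm y) ^+ 2 * fine (mu2 (square : set (angles R)))).
    by rewrite mu2_square mulr1.
  by symmetry; exact: Rintegral_cst.
apply: le_Rintegral => //.
- exact: integrable_sqnorm P.
- by apply: (@continuous_integrable2 R (fun=> _)) => t; exact: cvg_cst.
- move=> t _; rewrite -hnorm_sqr hnormZ ler_pXn2r ?nnegrE ?mulr_ge0 ?cabs_ge0 ?hnorm_ge0//.
  by rewrite ler_wpM2r ?hnorm_ge0.
Qed.

Lemma mulE_bounded a : continuous a -> (exists M, forall t, cabs (a t) <= M) ->
  bounded_operator (mulE a).
Proof.
move=> ca [M aM]; split; first exact: mulE_linear.
by exists M => x; exact: mulE_bound.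
Qed.

(* [\int conj(a t) u t dt]. *)
Definition coefE a (u : L2 E) : E := adjoint (mulE a) u.

Definition bcont a := continuous a /\ exists M, forall t, cabs (a t) <= M.

Lemma inner_coefE a u y : bcont a -> inner (mulE a y) u = inner y (coefE a u).
Proof.
move=> [ca aM]; rewrite /coefE adjoint_bounded//; first exact: hcomplete_hilbert.
exact: mulE_bounded.
Qed.

Lemma coefE_eq a u (x : E) : bcont a -> (forall y, inner (mulE a y) u = inner y x) ->
  coefE a u = x.
Proof.
by move=> ba h; apply: Rin_inj => z; rewrite /Rin -inner_coefE// h.
Qed.

Lemma Rin_coefE a u y : bcont a -> Rin (mulE a y) u = Rin y (coefE a u).
Proof. by move=> ba; rewrite /Rin inner_coefE. Qed.

Lemma coefE_bound a u (M : R) : bcont a -> (forall t, cabs (a t) <= M) ->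
  hnorm (coefE a u) <= M * hnorm u.
Proof.
move=> ba aM; have M0 : 0 <= M by apply: le_trans (aM (0, 0)); exact: cabs_ge0.
have : sqnorm (coefE a u) <= hnorm (coefE a u) * (M * hnorm u).
  rewrite -Rinxx -Rin_coefE//; apply: le_trans (Rin_le_hnorm _ _) _.
  rewrite mulrA ler_wpM2r ?hnorm_ge0// mulrC mulE_bound//; exact: ba.1.
rewrite -hnorm_sqr; have := hnorm_ge0 (coefE a u).
have := mulr_ge0 M0 (hnorm_ge0 u); nra.
Qed.

Lemma bcontD a b : bcont a -> bcont b -> bcont (fun t => a t + b t).
Proof.
move=> [ca [M aM]] [cb [M' bM]]; split; first by move=> t; exact: (cvgD (ca t) (cb t)).
by exists (M + M') => t; apply: le_trans (cabsD _ _) _; exact: lerD.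
Qed.

Lemma bcontZ (c : R[i]) a : bcont a -> bcont (fun t => c * (a t : R[i])).
Proof.
move=> [ca [M aM]]; split; first by move=> t; exact: (cvgM (cvg_cst (c : R[i]^o)) (ca t)).
by exists (cabs c * M) => t; rewrite cabsM ler_wpM2l ?cabs_ge0.
Qed.

Lemma mulED a b y : bcont a -> bcont b -> mulE (fun t => a t + b t) y = mulE a y + mulE b y.
Proof.
move=> [ca _] [cb _]; rewrite /mulE -toL2D; [|exact: continuous_square_integrable (@continuous_scale a y ca)|
  exact: continuous_square_integrable (@continuous_scale b y cb)].
congr toL2; apply/funext => t.
by rewrite -[RHS]/((a t : R[i]) *: y + (b t : R[i]) *: y) scalerDl.
Qed.

Lemma mulEZ c a y : bcont a -> mulE (fun t => c * (a t : R[i])) y = c *: mulE a y.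
Proof.
move=> [ca _]; rewrite /mulE -toL2Z; last exact: continuous_square_integrable (@continuous_scale a y ca).
congr toL2; apply/funext => t.
by rewrite -[RHS]/(c *: ((a t : R[i]) *: y)) scalerA.
Qed.

Lemma coefED a b u : bcont a -> bcont b -> coefE (fun t => a t + b t) u = coefE a u + coefE b u.
Proof.
move=> ba bb; apply: coefE_eq => [|y]; first exact: bcontD.
by rewrite mulED// innerDl innerDr !inner_coefE.
Qed.

Lemma coefEZ c a u : bcont a -> coefE (fun t => c * (a t : R[i])) u = c^* *: coefE a u.
Proof.
move=> ba; apply: coefE_eq => [|y]; first exact: bcontZ.
by rewrite mulEZ// innerZl innerZr conjCK inner_coefE.
Qed.

End ContinuousL2.

(** * Holomorphic functions and Cauchy's formula on the bidisk *)

Section HolomorphicC2.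
Context (R : realType) (E : sepHilbertType R).
Implicit Types (F : C2 R -> E) (z h : C2 R).

Definition cnorm2 (h : C2 R) : R := complex.Re `|h|.

Lemma cnorm2E h : `|h| = (cnorm2 h)%:C%C.
Proof. by have := normr_ge0 h; rewrite /cnorm2 lecE => /andP[/eqP]; case: (`|h|) => a b /= ->. Qed.

Lemma cnorm2_max h : cnorm2 h = Num.max (cabs h.1) (cabs h.2).
Proof.
rewrite /cnorm2 prod_normE /= !cabsE; have [le|lt] := leP (cabs h.1) (cabs h.2).
  by rewrite max_r ?lecR.
by rewrite max_l ?lecR ?ltW.
Qed.

Lemma cnorm2_ge0 h : 0 <= cnorm2 h.
Proof. by rewrite cnorm2_max le_max cabs_ge0. Qed.

Lemma cabs1_le h : cabs h.1 <= cnorm2 h.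
Proof. by rewrite cnorm2_max le_max lexx. Qed.

Lemma cabs2_le h : cabs h.2 <= cnorm2 h.
Proof. by rewrite cnorm2_max le_max lexx orbT. Qed.

Lemma cnorm2_snd (a : R[i]) : cnorm2 (0, a) = cabs a.
Proof. by rewrite cnorm2_max /= cabs0 max_r ?cabs_ge0. Qed.

Lemma nbhs_C2P z (P : set (C2 R)) :
  nbhs z P <-> exists2 d : R, 0 < d & forall h, cnorm2 h < d -> P (z + h).
Proof.
split=> [/nbhs_ballP[e /= /gt0_complexE[eE e0]] he|[d d0 hd]].
  exists (complex.Re e) => // h hd; apply: he.
  by rewrite -ball_normE /= opprD addrA subrr add0r normrN cnorm2E eE ltcR.
apply/nbhs_ballP; exists d%:C%C => /=; first by rewrite ltcR.
move=> y; rewrite -ball_normE /= distrC cnorm2E ltcR => /hd.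
by rewrite addrC subrK.
Qed.

(* Complex differentiability with explicit epsilons, so that the two partial
   derivatives are available. *)
Definition cdiff F z := exists A1 A2 : E, forall e : R, 0 < e ->
  exists2 d : R, 0 < d & forall h, cnorm2 h < d ->
    hnorm (F (z + h) - F z - ((h.1 : R[i]) *: A1 + (h.2 : R[i]) *: A2)) <= e * cnorm2 h.

Lemma differentiable_cdiff F z : differentiable F z -> cdiff F z.
Proof.
move=> /diff_locallyP[_ /eqaddoP dF].
pose D := 'd F z; exists (D (1, 0)), (D (0, 1)) => e e0.
have e0' : 0 < e%:C%C by rewrite ltcR.
have [d d0 hd] := (nbhs_C2P _ _).1 (dF _ e0'); exists d => // h /hd.
rewrite add0r => hh; have {}hh : `|F (h + z) - (F z + D h)| <= e%:C%C * `|h| := hh.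
move: hh; rewrite normr_hnorm cnorm2E -rmorphM lecR.
suff -> : D h = (h.1 : R[i]) *: D (1, 0) + (h.2 : R[i]) *: D (0, 1).
  by rewrite opprD addrA (addrC h).
rewrite -!linearZ -linearD; congr (D _); rewrite /GRing.scale /=.
by case: h => a b; congr (_, _); rewrite /= /GRing.scale /= ?mulr1 ?mulr0 ?addr0 ?add0r.
Qed.

Section LinearForm.
Context (A1 A2 : E).

Definition linear_form2 (h : C2 R) : E := (h.1 : R[i]) *: A1 + (h.2 : R[i]) *: A2.

Let linear_form2_linear : linear linear_form2.
Proof.
move=> a x y; rewrite /linear_form2 /= !scalerDl scalerDr !scalerA.
by rewrite addrACA.
Qed.

HB.instance Definition _ := GRing.isLinear.Build R[i] (C2 R) E _ linear_form2 linear_form2_linear.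

Lemma continuous_linear_form2 : continuous linear_form2.
Proof.
move=> z; apply: cvgD; apply: cvgZ; (try exact: cvg_cst).
  exact: continuous_fst2.
exact: continuous_snd2.
Qed.

End LinearForm.

Lemma cdiff_differentiable F z : cdiff F z -> differentiable F z.
Proof.
move=> [A1 [A2 hA]].
have E1 : F \o shift z = cst (F z) + (linear_form2 A1 A2 : {linear C2 R -> E}) +o_ (0 : C2 R) id.
  apply/eqaddoP => e /gt0_complexE[eE e0]; have [d d0 hd] := hA _ e0.
  apply/nbhs_C2P; exists d => // h hh; rewrite add0r /=.
  have := hd h hh; rewrite normr_hnorm eE cnorm2E -rmorphM lecR; apply: le_trans.
  rewrite le_eqVlt; apply/orP; left; apply/eqP; congr hnorm.
  by rewrite -[LHS]/(F (h + z) - (F z + linear_form2 A1 A2 h)) opprD addrA (addrC h).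
have c1 := @continuous_linear_form2 A1 A2.
by apply/diff_locallyP; rewrite (diff_unique c1 E1); split.
Qed.

Lemma cdiff_continuous F z : cdiff F z -> {for z, continuous F}.
Proof.
by move=> /cdiff_differentiable; exact: differentiable_continuous.
Qed.

Lemma cdiff_cderivable2 F (a b : R[i]) (r : R) (u : R[i]) (y : E) :
  b = r%:C%C * u -> cdiff F (a, b) ->
  exists d, cderivable (fun u => inner (F (a, r%:C%C * u)) y) u d.
Proof.
move=> -> [A1 [A2 hA]]; exists (r%:C%C * inner A2 y) => e e0.
have h0 := hnorm_ge0 y; have K0 : 0 < `|r| * (2 * hnorm y + 1) + 1.
  by rewrite ltr_pwDr// mulr_ge0//; lra.
have [|d d0 hd] := hA (e / (`|r| * (2 * hnorm y + 1) + 1)); first exact: divr_gt0.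
exists (d / (`|r| + 1)); first by rewrite divr_gt0// ltr_pwDr.
move=> v; rewrite ltr_pdivlMr; last by rewrite ltr_pwDr.
move=> vu; pose h : C2 R := (0, r%:C%C * (v - u)).
have c0 := cabs_ge0 (v - u); have r0 := normr_ge0 r.
have hh : cnorm2 h = `|r| * cabs (v - u) by rewrite cnorm2_snd cabsM cabsR.
have hlt : cnorm2 h < d by rewrite hh; nra.
have := hd h hlt; rewrite hh.
have -> : (a, r%:C%C * u) + h = (a, r%:C%C * v) :> C2 R.
  by congr (_, _); rewrite /= ?addr0//; ring.
rewrite scale0r add0r /=; set G := F _ - F _ - _ => hG.
have -> : inner (F (a, r%:C%C * v)) y - inner (F (a, r%:C%C * u)) y -
    r%:C%C * inner A2 y * (v - u) = inner G y.
  by rewrite /G !innerDl !innerNl innerZl; ring.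
apply: le_trans (cabs_le_ReIm _) _; rewrite Im_inner_Rinl -/(Rin _ _).
have h1 := normr_Rin_le G y; have h2 := normr_Rin_le ((- 'i)%C *: G) y.
have i1 : cabs (- 'i : R[i])%C = 1.
  by rewrite /cabs normc_def /= oppr0 expr0n add0r sqrrN expr1n sqrtr1.
rewrite hnormZ i1 mul1r in h2.
apply: (@le_trans _ _ (2 * (hnorm G * hnorm y))); first lra.
apply: (@le_trans _ _ (2 * ((e / (`|r| * (2 * hnorm y + 1) + 1) * (`|r| * cabs (v - u))) * hnorm y))).
  by rewrite ler_wpM2l// ler_wpM2r.
have -> : 2 * (e / (`|r| * (2 * hnorm y + 1) + 1) * (`|r| * cabs (v - u)) * hnorm y) =
  (e * cabs (v - u)) * ((`|r| * (2 * hnorm y)) / (`|r| * (2 * hnorm y + 1) + 1)) by ring.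
rewrite ler_piMr//; first by rewrite mulr_ge0// ltW.
by rewrite ler_pdivrMr// mul1r; lra.
Qed.

Definition swapC2 (z : C2 R) : C2 R := (z.2, z.1).

Lemma cdiff_swap F z : cdiff F z -> cdiff (F \o swapC2) (swapC2 z).
Proof.
move=> [A1 [A2 hA]]; exists A2, A1 => e /hA[d d0 hd]; exists d => // h hh.
have hs : cnorm2 (swapC2 h) = cnorm2 h by rewrite !cnorm2_max maxC.
have := hd (swapC2 h); rewrite hs => /(_ hh); rewrite /= [X in hnorm (_ - X)]addrC.
by move: {hA hd} z hh hs => [a b]; case: h.
Qed.

Lemma bidiskE z : bidisk z <-> cabs z.1 < 1 /\ cabs z.2 < 1.
Proof.
have E1 (a : R[i]) : (`|a| < 1) = (cabs a < 1) by rewrite cabsE -(rmorph1 (real_complex R)) ltcR.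
by rewrite /bidisk /=; split=> -[]; rewrite ?E1 -?E1.
Qed.

Lemma bidisk_scale (r : R) (a b : R[i]) : 0 <= r < 1 -> cabs a <= 1 -> cabs b <= 1 ->
  bidisk ((r%:C%C * a, r%:C%C * b) : C2 R).
Proof.
move=> /andP[r0 r1] a1 b1; apply/bidiskE; rewrite /= !cabsM !cabsR ger0_norm//.
by split; (apply: (@le_lt_trans _ _ r) => //); rewrite ler_piMr.
Qed.

Lemma bidisk_radial (r : R) t : 0 <= r < 1 -> bidisk (radial r t).
Proof. by move=> r01; apply: bidisk_scale; rewrite ?cabs_cis. Qed.

Lemma continuous_radial (r : R) : continuous (fun t : R * R => radial r t : C2 R).
Proof.
move=> t; apply: (@continuous_mkpair _ R[i]^o R[i]^o t (fun t => r%:C%C * cis t.1) (fun t => r%:C%C * cis t.2)).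
  by apply: cvgM; [exact: cvg_cst|exact: continuous_cis_fst].
by apply: cvgM; [exact: cvg_cst|exact: continuous_cis_snd].
Qed.

Lemma cdiff_radial F (r : R) : (forall z, bidisk z -> cdiff F z) -> 0 <= r < 1 ->
  continuous (fun t : R * R => F (radial r t)).
Proof.
move=> hF r01 t; apply: (@continuous_comp _ _ _ (fun t : R * R => radial r t : C2 R) F).
  exact: continuous_radial.
by apply: cdiff_continuous; apply: hF; exact: bidisk_radial.
Qed.

Definition szego_fun (w : C2 R) (t : R * R) : R[i]^o :=
  (1 - (w.1 : R[i])^* * cis t.1)^-1 * (1 - (w.2 : R[i])^* * cis t.2)^-1.

Definition szego (w : C2 R) (y : E) : L2 E := mulE (szego_fun w) y.

Lemma szego_denominator (a : R[i]) (x : R) : cabs a < 1 -> 1 - cabs a <= cabs (1 - a^* * cis x).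
Proof.
move=> a1; have := cabsD (1 - a^* * cis x) (a^* * cis x).
by rewrite subrK cabs1 cabsM cabsJ cabs_cis; lra.
Qed.

Lemma szego_denominator_neq0 (a : R[i]) (x : R) : cabs a < 1 -> 1 - a^* * cis x != 0.
Proof.
move=> a1; rewrite -cabs_gt0; apply: lt_le_trans (szego_denominator x a1).
by rewrite subr_gt0.
Qed.

Lemma continuous_szego_factor (T : topologicalType) (g : T -> R[i]^o) (a : R[i]^o) t :
  {for t, continuous g} -> 1 - a * g t != 0 ->
  {for t, continuous (fun x => (1 - a * g x)^-1 : R[i]^o)}.
Proof.
move=> cg n0; have h : (1 - a * g x : R[i]^o) @[x --> t] --> (1 - a * g t : R[i]^o).
  by apply: cvgB; [exact: cvg_cst|apply: cvgM; [exact: cvg_cst|exact: cg]].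
exact: (@cvgV R[i] T (nbhs t) (nbhs_filter t) (fun x => 1 - a * g x) (1 - a * g t) n0 h).
Qed.

Lemma szego_bcont w : bidisk w -> bcont (szego_fun w).
Proof.
move=> /bidiskE[w1 w2]; split.
  move=> t; apply: cvgM.
    by apply: (continuous_szego_factor (@continuous_cis_fst R t)); exact: szego_denominator_neq0.
  by apply: (continuous_szego_factor (@continuous_cis_snd R t)); exact: szego_denominator_neq0.
exists ((1 - cabs w.1)^-1 * (1 - cabs w.2)^-1) => t; rewrite cabsM.
have p1 : 0 < 1 - cabs w.1 by rewrite subr_gt0.
have p2 : 0 < 1 - cabs w.2 by rewrite subr_gt0.
have q1 := szego_denominator t.1 w1; have q2 := szego_denominator t.2 w2.
apply: ler_pM; [exact: cabs_ge0|exact: cabs_ge0| |]; rewrite cabsV lef_pV2 ?posrE//.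
- exact: lt_le_trans q1.
- exact: lt_le_trans q2.
Qed.

Lemma szego_linear w : bidisk w -> linear (szego w).
Proof. by move=> /szego_bcont[cw _]; exact: mulE_linear. Qed.

(** The conjugate of the Szego kernel is a product of one-variable Cauchy kernels. After Fubini the
    formula is used in the second variable, then in the first; [r < 1] makes the slices
    differentiable on the closed disc. *)
Lemma cauchy_szego F (r : R) (w : C2 R) (y : E) : (forall z, bidisk z -> cdiff F z) ->
  0 <= r < 1 -> bidisk w ->
  inner (toL2 (fun t : angles R => F (radial r t)) : L2 E) (szego w y) =
  inner (F (r%:C%C * (w.1 : R[i]), r%:C%C * (w.2 : R[i]))) y.
Proof.
move=> hF r01 bw; have cF := cdiff_radial hF r01.
have [cs _] := szego_bcont bw; have /bidiskE[w1 w2] := bw.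
have cg := @continuous_scale R E _ y cs.
pose K (a : R[i]) (x : R) := (1 - a * (cis x)^*)^-1.
have KE t : (szego_fun w t : R[i])^* = K w.1 t.1 * K w.2 t.2.
  by rewrite /szego_fun /K rmorphM !fmorphV !rmorphB !rmorph1 !rmorphM /= !conjCK.
have iE t : inner (F (radial r t)) ((szego_fun w t : R[i]) *: y) =
    K w.1 t.1 * (inner (F (radial r t)) y * K w.2 t.2).
  by rewrite innerZr KE; ring.
have cfy : continuous (fun t : R * R => inner (F (radial r t)) y : R[i]^o).
  by move=> t; apply: continuous_innerl; exact: cF.
have cfg : continuous (fun t : R * R => inner (F (radial r t)) ((szego_fun w t : R[i]) *: y) : R[i]^o).
  have -> : (fun t => inner (F (radial r t)) ((szego_fun w t : R[i]) *: y) : R[i]^o) =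
     fun t => ((szego_fun w t : R[i])^* : R[i]^o) * (inner (F (radial r t)) y : R[i]^o).
    by apply/funext => t; rewrite innerZr.
  move=> t; apply: cvgM; last exact: cfy.
  apply: (@continuous_comp _ _ _ (szego_fun w) (fun z : R[i]^o => z^* : R[i]^o)).
    exact: cs.
  exact: continuous_conj.
transitivity (cint 0 1 (fun x => cint 0 1 (fun s => inner (F (radial r (x, s))) ((szego_fun w (x, s) : R[i]) *: y)))).
  exact: (inner_toL2 cF cg cfg).
transitivity (cint 0 1 (fun x => inner (F (r%:C%C * cis x, r%:C%C * (w.2 : R[i]))) y * K w.1 x)).
  apply: eq_cint => x _.
  have cx : ccont 0 1 (fun t => inner (F (r%:C%C * cis x, r%:C%C * cis t)) y * K w.2 t : R[i]^o).
    move=> t _; apply: cvgM; last exact: continuous_cauchy_kernel.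
    apply: (@continuous_comp _ _ _ (fun t => (x, t)) (fun t : R * R => inner (F (radial r t)) y : R[i]^o)).
      by apply: continuous_mkpair; [exact: cvg_cst|exact: cvg_id].
    exact: cfy.
  under eq_cint do rewrite iE /=.
  rewrite (cintZ (K w.1 x) cx) mulrC; congr (_ * _).
  apply: (@cauchy_formula R (fun u => inner (F (r%:C%C * cis x, r%:C%C * u)) y)) => // u u1.
  apply: cdiff_cderivable2; first by [].
  by apply: hF; apply: bidisk_scale => //; rewrite cabs_cis.
apply: (@cauchy_formula R (fun u => inner (F (r%:C%C * u, r%:C%C * (w.2 : R[i]))) y)) => // u u1.
(* The slice in the first variable is the slice in the second variable after exchanging
   coordinates. *)
have [d hd] := @cdiff_cderivable2 (F \o swapC2) (r%:C%C * (w.2 : R[i])) (r%:C%C * u) r u y erefl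
  (@cdiff_swap F (r%:C%C * u, r%:C%C * (w.2 : R[i])) (hF _ (bidisk_scale r01 u1 (ltW w2)))).
by exists d; exact: hd.
Qed.

End HolomorphicC2.

(** * Polynomials on the torus *)

Section Polynomials.
Context (R : realType) (E : sepHilbertType R).
Implicit Types (s : seq (nat * nat * E)) (z w : C2 R) (u : L2 E).

Lemma poly2_nil z : poly2 [::] z = 0 :> E.
Proof. exact: big_nil. Qed.

Lemma poly2_cons x s z : poly2 (x :: s) z =
  ((z.1 : R[i]) ^+ x.1.1 * (z.2 : R[i]) ^+ x.1.2) *: x.2 + poly2 s z.
Proof. exact: big_cons. Qed.

Lemma poly2_cdiff s z : cdiff (poly2 s) z.
Proof.
apply: differentiable_cdiff.
have d1 : differentiable (fst : C2 R -> R[i]^o) z.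
  apply: (linear_differentiable (f := fst : {linear C2 R -> R[i]^o})).
  exact: continuous_fst2.
have d2 : differentiable (snd : C2 R -> R[i]^o) z.
  apply: (linear_differentiable (f := snd : {linear C2 R -> R[i]^o})).
  exact: continuous_snd2.
have dX (f : C2 R -> R[i]^o) n : differentiable f z -> differentiable (f ^+ n) z.
  by case: n => [|n] df; [exact: differentiable_cst|exact: differentiableX].
elim: s => [|x s IH].
  by rewrite (_ : poly2 [::] = cst 0); [exact: differentiable_cst|apply/funext => y; rewrite /poly2 big_nil].
rewrite (_ : poly2 (x :: s) = (fun y : C2 R => (((fst : C2 R -> R[i]^o) ^+ x.1.1 *
   (snd : C2 R -> R[i]^o) ^+ x.1.2) y : R[i]) *: x.2) + poly2 s); last first.
  apply/funext => y; rewrite /poly2 big_cons; congr (_ + _); congr (_ *: _).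
  by rewrite [RHS]/GRing.mul /= !fctE.
apply: differentiableD => //; apply: differentiableZl.
by apply: differentiableM; exact: dX.
Qed.

Definition poly2_sub s s' := s ++ [seq (x.1, - x.2) | x <- s'].

Lemma poly2_subE s s' z : poly2 (poly2_sub s s') z = poly2 s z - poly2 s' z.
Proof.
rewrite /poly2 big_cat big_map; congr (_ + _); rewrite -sumrN.
by apply: eq_bigr => x _; rewrite scalerN.
Qed.

Definition polyL s : L2 E := toL2 (fun t : angles R => poly2 s (torus t)).

Lemma continuous_poly2_torus s : continuous (fun t : R * R => poly2 s (torus t)).
Proof.
move=> t; apply: (@continuous_comp _ _ _ (fun t : R * R => torus t : C2 R) (poly2 s)).
  by apply: (@continuous_mkpair _ R[i]^o R[i]^o); [exact: continuous_cis_fst|exact: continuous_cis_snd].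
by apply: cdiff_continuous; exact: poly2_cdiff.
Qed.

Lemma polyL_square_integrable s : square_integrable (fun t : angles R => poly2 s (torus t)).
Proof. exact: continuous_square_integrable (@continuous_poly2_torus s). Qed.

Lemma polyL_sub s s' : polyL (poly2_sub s s') = polyL s - polyL s'.
Proof.
rewrite /polyL -scaleN1r -toL2Z; last exact: polyL_square_integrable.
rewrite -toL2D; [|exact: polyL_square_integrable|].
  congr toL2; apply/funext => t; rewrite poly2_subE -scaleN1r.
  by [].
apply: square_integrableZ; exact: polyL_square_integrable.
Qed.

Definition poly2_rescale (c : R[i]) s := [seq (x.1, c ^+ (x.1.1 + x.1.2) *: x.2) | x <- s].

Lemma poly2_rescaleE (c a b : R[i]) s :
  poly2 (poly2_rescale c s) (a, b) = poly2 s (c * a, c * b).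
Proof.
rewrite /poly2 big_map; apply: eq_bigr => x _; rewrite scalerA /=; congr (_ *: _).
by rewrite !exprMn exprD; ring.
Qed.

(* The Cauchy formula on the torus of radius [1/2], for the rescaled polynomial. *)
Lemma inner_polyL_szego s w y : bidisk w -> inner (polyL s) (szego w y) = inner (poly2 s w) y.
Proof.
move=> bw; pose s' := poly2_rescale 2 s.
have h2 : 0 <= (2^-1 : R) < 1 by apply/andP; split; lra.
have E2 (a : R[i]) : 2 * ((2^-1 : R)%:C%C * a) = a.
  by rewrite mulrA fmorphV rmorph_nat divff ?mul1r// pnatr_eq0.
have hs (a b : R[i]) : poly2 s' ((2^-1 : R)%:C%C * a, (2^-1 : R)%:C%C * b) = poly2 s (a, b).
  by rewrite poly2_rescaleE !E2.
have C := @cauchy_szego R E (poly2 s') 2^-1 w y (fun z _ => @poly2_cdiff s' z) h2 bw.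
have hT : (fun t : angles R => poly2 s (torus t)) = (fun t => poly2 s' (radial 2^-1 t)).
  by apply/funext => t; exact: (esym (hs (cis t.1) (cis t.2))).
have hw : poly2 s' ((2^-1 : R)%:C%C * (w.1 : R[i]), (2^-1 : R)%:C%C * (w.2 : R[i])) = poly2 s w.
  by apply: etrans (hs _ _) _; case: (w).
by rewrite /polyL hT; apply: (etrans C); rewrite hw.
Qed.

(** The constant is uniform in [t]; this serves to pass from finitely many radii to all of them, and
    from interior radii to the torus. *)
Lemma poly2_lip s : exists2 L : R, 0 < L & forall (r r' : R) (t : R * R),
  0 <= r <= 1 -> 0 <= r' <= 1 ->
  hnorm (poly2 s (radial r t) - poly2 s (radial r' t)) <= L * `|r - r'|.
Proof.
have lipX n (r r' : R) : 0 <= r <= 1 -> 0 <= r' <= 1 -> `|r ^+ n - r' ^+ n| <= n%:R * `|r - r'|.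
  move=> r1 r1'; elim: n => [|n IH]; first by rewrite !expr0 subrr normr0 mul0r.
  have -> : r ^+ n.+1 - r' ^+ n.+1 = r * (r ^+ n - r' ^+ n) + (r - r') * r' ^+ n.
    by rewrite !exprS; ring.
  apply: le_trans (ler_normD _ _) _; rewrite -natr1 [leRHS]mulrDl mul1r !normrM; apply: lerD.
    by apply: le_trans IH; rewrite ler_piMl// ger0_norm; lra.
  by rewrite ler_piMr// ger0_norm ?exprn_ge0 ?exprn_ile1//; lra.
elim: s => [|x s [L L0 hL]].
  by exists 1 => // r r' t _ _; rewrite !poly2_nil subrr hnorm0 mul1r.
have n0 := hnorm_ge0 x.2; exists (L + (x.1.1 + x.1.2)%:R * hnorm x.2).
  by rewrite ltr_pwDl// mulr_ge0.
move=> r r' t hr hr'; rewrite !poly2_cons opprD addrACA.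
apply: le_trans (ler_hnormD _ _) _; rewrite [leRHS]mulrDl [leRHS]addrC; apply: lerD; last exact: hL.
have E1 (q : R) : ((radial q t).1 : R[i]) ^+ x.1.1 * ((radial q t).2 : R[i]) ^+ x.1.2 =
    (q ^+ (x.1.1 + x.1.2))%:C%C * (cis t.1 ^+ x.1.1 * cis t.2 ^+ x.1.2).
  by rewrite /= !exprMn exprD rmorphM !rmorphXn /=; ring.
rewrite !E1 -scalerBl -mulrBl -rmorphB hnormZ !cabsM !cabsX !cabs_cis !expr1n !mulr1 cabsR.
by rewrite mulrAC ler_wpM2r// lipX.
Qed.

End Polynomials.

(** * The closure of the polynomials contains the Szego kernels *)

Section SzegoClosure.
Context (R : realType) (E : sepHilbertType R).
Implicit Types (s : seq (nat * nat * E)) (z w : C2 R) (u : L2 E).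

(* The closed span of the polynomials, which is [H2_subspace] by [H2_subspaceP]. *)
Definition analytic u := forall e : R, 0 < e -> exists s, hnorm (u - polyL s) < e.

Lemma analytic_limit u : (forall e : R, 0 < e -> exists2 v, analytic v & hnorm (u - v) < e) -> analytic u.
Proof.
move=> h e e0; have e2 : 0 < e / 2 by rewrite divr_gt0.
have [v av uv] := h _ e2; have [s hs] := av _ e2; exists s.
by apply: le_lt_trans (ler_hnorm_distD u v _) _; lra.
Qed.

Lemma analytic_polyL s : analytic (polyL s).
Proof. by move=> e e0; exists s; rewrite subrr hnorm0. Qed.

Lemma polyL_nil : polyL [::] = 0 :> L2 E.
Proof.
apply: toL2_eq; apply: filterS (@L2fun0 R E) => t h tS.
by rewrite h// poly2_nil.
Qed.

Lemma polyL_cat s s' : polyL (s ++ s') = polyL s + polyL s'.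
Proof.
rewrite /polyL -toL2D; try exact: polyL_square_integrable.
by congr toL2; apply/funext => t; rewrite /poly2 big_cat.
Qed.

Lemma polyL_scale (c : R[i]) s : polyL [seq (x.1, c *: x.2) | x <- s] = c *: polyL s.
Proof.
rewrite /polyL -toL2Z; last exact: polyL_square_integrable.
congr toL2; apply/funext => t; rewrite -[RHS]/(c *: poly2 s (torus t)) /poly2 big_map scaler_sumr.
by apply: eq_bigr => x _; rewrite !scalerA mulrC.
Qed.

Lemma analytic_subspace : is_subspace analytic.
Proof.
split=> [|a x y ax ay e e0]; first by rewrite -polyL_nil; exact: analytic_polyL.
have c0 := cabs_ge0 a; have d0 : 0 < e / (2 * (cabs a + 1)) by rewrite divr_gt0// mulr_gt0//; lra.
have [s hs] := ax _ d0; have e2 : 0 < e / 2 by rewrite divr_gt0.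
have [s' hs'] := ay _ e2.
exists ([seq (x.1, a *: x.2) | x <- s] ++ s'); rewrite polyL_cat polyL_scale opprD addrACA -scalerBr.
apply: le_lt_trans (ler_hnormD _ _) _; rewrite hnormZ.
have h1 : cabs a * hnorm (x - polyL s) <= e / 2.
  have -> : e / 2 = (cabs a + 1) * (e / (2 * (cabs a + 1))).
    have {}c0 : cabs a + 1 != 0 by rewrite gt_eqF// ltr_pwDr.
    by rewrite mulrCA invfM (mulrC (2^-1)) mulVKf.
  by apply: ler_pM; [exact: c0|exact: hnorm_ge0|rewrite lerDl ler01|exact: ltW].
by rewrite (splitr e); apply: ler_ltD.
Qed.

Lemma expr_small (rho e : R) : 0 <= rho < 1 -> 0 < e -> exists N, rho ^+ N < e.
Proof.
move=> /andP[r0 r1] e0; have r1' : `|rho| < 1 by rewrite ger0_norm.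
have /cvgrPdist_lt/(_ e e0)[N _ hN] := cvg_expr r1'.
exists N; have := hN N (leqnn N); rewrite /= sub0r normrN ger0_norm//; exact: exprn_ge0.
Qed.

Definition szego_partial (N : nat) w (y : E) : seq (nat * nat * E) :=
  [seq (m, n, ((w.1 : R[i])^* ^+ m * (w.2 : R[i])^* ^+ n) *: y) | m <- index_iota 0 N, n <- index_iota 0 N].

Definition geometric_sum (N : nat) (a : R[i]) : R[i] := \sum_(0 <= m < N) a ^+ m.

Lemma poly2_szego_partial N w y z : poly2 (szego_partial N w y) z =
  (geometric_sum N ((w.1 : R[i])^* * (z.1 : R[i])) * geometric_sum N ((w.2 : R[i])^* * (z.2 : R[i]))) *: y.
Proof.
rewrite /poly2 big_allpairs_dep big_distrlr scaler_suml; apply: eq_bigr => m _.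
by rewrite scaler_suml; apply: eq_bigr => n _; rewrite /= scalerA !exprMn mulrC mulrACA.
Qed.

Lemma geometric_sumE N (a : R[i]) : 1 - a != 0 -> geometric_sum N a = (1 - a ^+ N) * (1 - a)^-1.
Proof.
move=> a1; elim: N => [|N IH] /=.
  by rewrite /geometric_sum big_nil expr0 subrr mul0r.
by rewrite /geometric_sum big_nat_recr//= -/(geometric_sum N a) IH exprS; move: (a ^+ N) => b; field.
Qed.

(** The error has the factor [a^N + b^N - a^N b^N], whence the constant 3. *)
Lemma geometric_tail (N : nat) (a b : R[i]) (rho : R) : cabs a <= rho -> cabs b <= rho -> 0 <= rho < 1 ->
  cabs ((1 - a)^-1 * (1 - b)^-1 - geometric_sum N a * geometric_sum N b) <=
  3 * rho ^+ N * ((1 - rho)^-1 * (1 - rho)^-1).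
Proof.
move=> ca cb /andP[r0 r1']; have p0 : 0 < 1 - rho by rewrite subr_gt0.
have D x : cabs x <= rho -> 1 - rho <= cabs (1 - x).
  by move=> hx; have := cabsD (1 - x) x; rewrite subrK cabs1; lra.
have [Da Db] := (D a ca, D b cb).
have n1 : 1 - a != 0 by rewrite -cabs_gt0; exact: lt_le_trans Da.
have n2 : 1 - b != 0 by rewrite -cabs_gt0; exact: lt_le_trans Db.
rewrite !geometric_sumE//.
have -> : (1 - a)^-1 * (1 - b)^-1 - (1 - a ^+ N) * (1 - a)^-1 * ((1 - b ^+ N) * (1 - b)^-1) =
  (a ^+ N + b ^+ N - a ^+ N * b ^+ N) * ((1 - a)^-1 * (1 - b)^-1) by ring.
have X x : cabs x <= rho -> cabs (x ^+ N) <= rho ^+ N.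
  by move=> hx; rewrite cabsX; apply: lerXn2r; rewrite ?nnegrE ?cabs_ge0.
have [Xa Xb] := (X _ ca, X _ cb).
have rN1 : rho ^+ N <= 1 by rewrite exprn_ile1// ltW.
rewrite cabsM; apply: ler_pM; [exact: cabs_ge0|exact: cabs_ge0| |].
  have -> : 3 * rho ^+ N = rho ^+ N + rho ^+ N + rho ^+ N by ring.
  apply: le_trans (cabsB _ _) _; rewrite cabsM; apply: lerD.
    by apply: le_trans (cabsD _ _) _; apply: lerD.
  by rewrite -[leRHS]mulr1; apply: ler_pM; [exact: cabs_ge0|exact: cabs_ge0|exact: Xa|exact: le_trans rN1].
by rewrite cabsM; apply: ler_pM; [exact: cabs_ge0|exact: cabs_ge0| |]; rewrite cabsV lef_pV2 ?posrE//; exact: lt_le_trans p0 _.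
Qed.

Lemma szego_partial_rate (rho : R) (N : nat) w y : cabs w.1 <= rho -> cabs w.2 <= rho -> 0 <= rho < 1 ->
  hnorm (szego w y - polyL (szego_partial N w y)) <=
  3 * rho ^+ N * ((1 - rho)^-1 * (1 - rho)^-1) * hnorm y.
Proof.
move=> r1 r2 r01; have /andP[r0 rho1] := r01.
have bw : bidisk w by apply/bidiskE; split; apply: le_lt_trans rho1.
pose g (t : R * R) : R[i]^o := geometric_sum N ((w.1 : R[i])^* * cis t.1) * geometric_sum N ((w.2 : R[i])^* * cis t.2).
have cg : continuous g.
  have cG (a : R[i]) (h : R * R -> R[i]^o) : continuous h -> continuous (fun t => geometric_sum N (a * h t) : R[i]^o).
    move=> ch t; elim: (N) => [|n IH].
      have -> : (fun t => geometric_sum 0 (a * h t) : R[i]^o) = cst 0.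
        by apply/funext => x; rewrite /geometric_sum big_nil.
      exact: cvg_cst.
    have -> : (fun t => geometric_sum n.+1 (a * h t) : R[i]^o) =
        (fun t => (geometric_sum n (a * h t) : R[i]^o) + ((a * h t) ^+ n : R[i]^o)).
      by apply/funext => x; rewrite /geometric_sum big_nat_recr.
    apply: cvgD; first exact: IH.
    apply: (@continuous_exprn R _ (fun x => (a : R[i]^o) * h x) t n).
    by apply: cvgM; [exact: cvg_cst|exact: ch].
  move=> t; apply: cvgM; first exact: (cG _ _ (@continuous_cis_fst R)).
  exact: (cG _ _ (@continuous_cis_snd R)).
have [cs _] := szego_bcont bw.
have cd : continuous (fun t => szego_fun w t + (-1) * (g t : R[i]) : R[i]^o).
  move=> t; apply: cvgD; first exact: cs.
  by apply: cvgM; [exact: cvg_cst|exact: cg].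
have hE : szego w y - polyL (szego_partial N w y) = mulE (fun t => szego_fun w t + (-1) * (g t : R[i]) : R[i]^o) y.
  rewrite /szego /polyL -scaleN1r /mulE -toL2Z; last exact: polyL_square_integrable.
  rewrite -toL2D.
  - congr toL2; apply/funext => t.
    have hp : poly2 (szego_partial N w y) (torus t) = (g t : R[i]) *: y by exact: poly2_szego_partial.
    rewrite -[LHS]/((szego_fun w t : R[i]) *: y + (-1) *: poly2 (szego_partial N w y) (torus t)) hp.
    by rewrite scalerA -scalerDl.
  - exact: continuous_square_integrable (@continuous_scale R E _ y cs).
  - by apply: square_integrableZ; exact: polyL_square_integrable.
rewrite hE; apply: mulE_bound => // t; rewrite mulN1r.
by apply: geometric_tail => //; rewrite cabsM cabsJ cabs_cis mulr1.
Qed.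

Lemma bidisk_radius w : bidisk w -> exists rho : R, [/\ cabs w.1 <= rho, cabs w.2 <= rho & 0 <= rho < 1].
Proof.
move=> /bidiskE[w1 w2]; exists (Num.max (cabs w.1) (cabs w.2)).
have r1 : cabs w.1 <= Num.max (cabs w.1) (cabs w.2) by rewrite le_max lexx.
by split=> //; [rewrite le_max lexx orbT|rewrite (le_trans (cabs_ge0 _) r1) gt_max w1 w2].
Qed.

Lemma geometric_rate_small (rho C : R) : 0 <= rho < 1 -> 0 <= C -> forall e : R, 0 < e ->
  exists N, forall n, (N <= n)%N -> 3 * rho ^+ n * ((1 - rho)^-1 * (1 - rho)^-1) * C < e.
Proof.
move=> r01 C0 e e0; have /andP[r0 rho1] := r01; have p0 : 0 < 1 - rho by rewrite subr_gt0.
have q0 : 0 <= (1 - rho)^-1 by rewrite invr_ge0 ltW.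
pose B := 3 * ((1 - rho)^-1 * (1 - rho)^-1) * C + 1.
have B0 : 0 < B by rewrite ltr_pwDr// mulr_ge0// mulr_ge0// mulr_ge0.
have [N hN] := expr_small r01 (divr_gt0 e0 B0); exists N => n Nn.
have h : rho ^+ n < e / B by apply: le_lt_trans hN; apply: ler_wiXn2l => //; exact: ltW.
move: h; rewrite ltr_pdivlMr//; apply: le_lt_trans.
rewrite /B mulrDr mulr1 -[leLHS]addr0; apply: lerD; last by rewrite exprn_ge0.
by rewrite le_eqVlt; apply/orP; left; apply/eqP; ring.
Qed.

Lemma szego_partial_cvg w y : bidisk w -> hcvg (fun N => polyL (szego_partial N w y)) (szego w y).
Proof.
move=> /bidisk_radius[rho [r1 r2 r01]]; apply/hcvgP => e e0.
have [N hN] := geometric_rate_small r01 (hnorm_ge0 y) e0; exists N => n Nn.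
by rewrite hnorm_distC; apply: le_lt_trans (szego_partial_rate _ _ r1 r2 r01) (hN n Nn).
Qed.

Lemma analytic_szego w y : bidisk w -> analytic (szego w y).
Proof.
move=> bw e e0; have [N hN] := (hcvgP _ _).1 (szego_partial_cvg y bw) e e0.
by exists (szego_partial N w y); rewrite hnorm_distC hN.
Qed.

End SzegoClosure.

(** * Holomorphic extension from the torus to the bidisk *)

Section Extension.
Context (R : realType) (E : sepHilbertType R).
Implicit Types (s : seq (nat * nat * E)) (z w : C2 R) (u : L2 E) (a b : R * R -> R[i]^o).

Lemma bcontM a b : bcont a -> bcont b -> bcont (fun t => a t * b t).
Proof.
move=> [ca [M aM]] [cb [M' bM]]; split; first by move=> t; apply: cvgM; [exact: ca|exact: cb].
exists (M * M') => t; rewrite cabsM; apply: ler_pM => //; exact: cabs_ge0.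
Qed.

Lemma bcont_cis_fst : bcont (fun t : R * R => cis t.1 : R[i]^o).
Proof.
split; first exact: continuous_cis_fst.
by exists 1 => t; rewrite cabs_cis.
Qed.

Lemma bcont_cis_snd : bcont (fun t : R * R => cis t.2 : R[i]^o).
Proof.
split; first exact: continuous_cis_snd.
by exists 1 => t; rewrite cabs_cis.
Qed.

Lemma cabs_szego_factor (c : R[i]) (x rho : R) : cabs c <= rho -> rho < 1 ->
  cabs (1 - c^* * cis x)^-1 <= (1 - rho)^-1.
Proof.
move=> c1 r1; have c1' : cabs c < 1 by apply: le_lt_trans r1.
rewrite cabsV lef_pV2 ?posrE ?subr_gt0//; last by rewrite cabs_gt0 szego_denominator_neq0.
by apply: le_trans (szego_denominator x c1'); lra.
Qed.

Lemma bcont_szego_fst (c : R[i]) : cabs c < 1 ->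
  bcont (fun t : R * R => (1 - c^* * cis t.1)^-1 : R[i]^o).
Proof.
move=> c1; split.
  by move=> t; apply: (continuous_szego_factor (@continuous_cis_fst R t)); exact: szego_denominator_neq0.
by exists (1 - cabs c)^-1 => t; exact: cabs_szego_factor.
Qed.

Lemma bcont_szego_snd (c : R[i]) : cabs c < 1 ->
  bcont (fun t : R * R => (1 - c^* * cis t.2)^-1 : R[i]^o).
Proof.
move=> c1; split.
  by move=> t; apply: (continuous_szego_factor (@continuous_cis_snd R t)); exact: szego_denominator_neq0.
by exists (1 - cabs c)^-1 => t; exact: cabs_szego_factor.
Qed.

Definition szego_d1 w (t : R * R) : R[i]^o :=
  cis t.1 * ((1 - (w.1 : R[i])^* * cis t.1)^-1 * szego_fun w t).

Definition szego_d2 w (t : R * R) : R[i]^o :=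
  cis t.2 * ((1 - (w.2 : R[i])^* * cis t.2)^-1 * szego_fun w t).

Lemma szego_d1_bcont w : bidisk w -> bcont (szego_d1 w).
Proof.
move=> bw; have /bidiskE[w1 w2] := bw.
exact: (bcontM bcont_cis_fst (bcontM (bcont_szego_fst w1) (szego_bcont bw))).
Qed.

Lemma szego_d2_bcont w : bidisk w -> bcont (szego_d2 w).
Proof.
move=> bw; have /bidiskE[w1 w2] := bw.
exact: (bcontM bcont_cis_snd (bcontM (bcont_szego_snd w2) (szego_bcont bw))).
Qed.

Lemma inverse_expansion (K : fieldType) (p x : K) : p != 0 -> p - x != 0 ->
  (p - x)^-1 = p^-1 + x * (p^-1 * p^-1) + x * x * (p^-1 * p^-1 * (p - x)^-1).
Proof. by move=> p0 px0; field; rewrite p0 px0. Qed.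

Lemma cabs_mul_le (x y : R[i]) (M M' : R) : cabs x <= M -> cabs y <= M' -> cabs (x * y) <= M * M'.
Proof. by move=> xM yM; rewrite cabsM ler_pM ?cabs_ge0. Qed.

(** The remainder splits into three terms of size [L^4 d^2] and one of size [L^5 d^3]; with [1 <= L]
    and [d <= 1] each is at most [L^5 d^2]. *)
Lemma product_expansion (P Q P' Q' x y : R[i]) (L d : R) :
  P' = P + x * (P * P) + x * x * (P * P * P') -> Q' = Q + y * (Q * Q) + y * y * (Q * Q * Q') ->
  1 <= L -> 0 <= d -> d <= 1 -> cabs P <= L -> cabs Q <= L -> cabs P' <= L -> cabs Q' <= L ->
  cabs x <= d -> cabs y <= d ->
  cabs (P' * Q' - P * Q - x * (P * (P * Q)) - y * (Q * (P * Q))) <= 4 * L ^+ 5 * d ^+ 2.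
Proof.
move=> hP hQ L1 d0 d1 P1 Q1 P1' Q1' x1 y1.
have eP : P' - P - x * (P * P) = x * x * (P * P * P') by rewrite {1}hP; ring.
have eQ : Q' - Q - y * (Q * Q) = y * y * (Q * Q * Q') by rewrite {1}hQ; ring.
have -> : P' * Q' - P * Q - x * (P * (P * Q)) - y * (Q * (P * Q)) =
    (P' - P - x * (P * P)) * Q' + (P + x * (P * P)) * (Q' - Q - y * (Q * Q)) +
    x * y * (P * P * (Q * Q)) by ring.
rewrite eP eQ.
have -> : x * x * (P * P * P') * Q' + (P + x * (P * P)) * (y * y * (Q * Q * Q')) +
    x * y * (P * P * (Q * Q)) = x * x * (P * P * (P' * Q')) + y * y * (P * Q * (Q * Q')) +
    x * (y * y * (P * P * (Q * Q * Q'))) + x * y * (P * P * (Q * Q)) by ring.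
have L0 : 0 <= L by apply: le_trans L1.
have L45 : d * d * (L * L * (L * L)) <= L ^+ 5 * d ^+ 2.
  have -> : L ^+ 5 * d ^+ 2 = d * d * (L * L * (L * L)) * L by ring.
  by rewrite ler_peMr// mulr_ge0// ?mulr_ge0// mulr_ge0.
have h1 : cabs (x * x * (P * P * (P' * Q'))) <= L ^+ 5 * d ^+ 2.
  by apply: le_trans L45; apply: cabs_mul_le; apply: cabs_mul_le => //; apply: cabs_mul_le.
have h2 : cabs (y * y * (P * Q * (Q * Q'))) <= L ^+ 5 * d ^+ 2.
  by apply: le_trans L45; apply: cabs_mul_le; apply: cabs_mul_le => //; apply: cabs_mul_le.
have h4 : cabs (x * y * (P * P * (Q * Q))) <= L ^+ 5 * d ^+ 2.
  by apply: le_trans L45; apply: cabs_mul_le; apply: cabs_mul_le => //; apply: cabs_mul_le.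
have h3 : cabs (x * (y * y * (P * P * (Q * Q * Q')))) <= L ^+ 5 * d ^+ 2.
  apply: (@le_trans _ _ (1 * (d * d * (L * L * (L * L * L))))); last by rewrite le_eqVlt; apply/orP; left; apply/eqP; ring.
  apply: cabs_mul_le; first exact: le_trans d1.
  by apply: cabs_mul_le; [apply: cabs_mul_le|apply: cabs_mul_le; [apply: cabs_mul_le|apply: cabs_mul_le => //; apply: cabs_mul_le]].
have -> : 4 * L ^+ 5 * d ^+ 2 = L ^+ 5 * d ^+ 2 + L ^+ 5 * d ^+ 2 + L ^+ 5 * d ^+ 2 + L ^+ 5 * d ^+ 2 by ring.
by apply: le_trans (cabsD _ _) _; apply: lerD => //; apply: le_trans (cabsD _ _) _; apply: lerD => //;
  apply: le_trans (cabsD _ _) _; apply: lerD.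
Qed.

(** The kernel is antiholomorphic in [w], hence the conjugates of [h]. For small [h] both
    coordinates stay within [rho' = (1 + rho) / 2], which makes the remainder uniform in [t]. *)
Lemma szego_expansion w : bidisk w -> exists C : R, exists2 d : R, 0 < d & 0 <= C /\ forall h : C2 R, cnorm2 h < d -> bidisk (w + h) /\ forall t, cabs ((szego_fun (w + h) t : R[i]) -
    szego_fun w t - (h.1 : R[i])^* * szego_d1 w t - (h.2 : R[i])^* * szego_d2 w t) <= C * cnorm2 h ^+ 2.
Proof.
move=> bw; have /bidiskE[w1 w2] := bw.
pose rho := Num.max (cabs w.1) (cabs w.2).
have r1 : cabs w.1 <= rho by rewrite le_max lexx.
have r2 : cabs w.2 <= rho by rewrite le_max lexx orbT.
have r0 : 0 <= rho by apply: le_trans r1; exact: cabs_ge0.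
have rho1 : rho < 1 by rewrite gt_max w1 w2.
clearbody rho; pose rho' := (1 + rho) / 2.
have rho1' : rho' < 1 by rewrite /rho'; lra.
have rr' : rho <= rho' by rewrite /rho'; lra.
pose L := (1 - rho')^-1; have p0 : 0 < 1 - rho' by rewrite subr_gt0.
have L1 : 1 <= L by rewrite /L invf_ge1// /rho'; lra.
exists (4 * L ^+ 5); exists ((1 - rho) / 2); first by lra.
have L0 : 0 <= L by apply: le_trans L1.
split; first by rewrite mulr_ge0// exprn_ge0.
move=> h hd; have [h1 h2] := (cabs1_le h, cabs2_le h).
have q1 : cabs ((w.1 : R[i]) + h.1) <= rho' by apply: le_trans (cabsD _ _) _; rewrite /rho'; lra.
have q2 : cabs ((w.2 : R[i]) + h.2) <= rho' by apply: le_trans (cabsD _ _) _; rewrite /rho'; lra.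
have q1' : cabs ((w.1 : R[i]) + h.1) < 1 by apply: le_lt_trans rho1'.
have q2' : cabs ((w.2 : R[i]) + h.2) < 1 by apply: le_lt_trans rho1'.
split; first by apply/bidiskE; split.
move=> t.
have -> : (h.1 : R[i])^* * szego_d1 w t = ((h.1 : R[i])^* * cis t.1) *
   ((1 - (w.1 : R[i])^* * cis t.1)^-1 * ((1 - (w.1 : R[i])^* * cis t.1)^-1 * (1 - (w.2 : R[i])^* * cis t.2)^-1)).
  exact: mulrA.
have -> : (h.2 : R[i])^* * szego_d2 w t = ((h.2 : R[i])^* * cis t.2) *
   ((1 - (w.2 : R[i])^* * cis t.2)^-1 * ((1 - (w.1 : R[i])^* * cis t.1)^-1 * (1 - (w.2 : R[i])^* * cis t.2)^-1)).
  exact: mulrA.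
have E1 : 1 - ((w.1 : R[i]) + h.1)^* * cis t.1 = 1 - (w.1 : R[i])^* * cis t.1 - (h.1 : R[i])^* * cis t.1.
  by rewrite rmorphD; ring.
have E2 : 1 - ((w.2 : R[i]) + h.2)^* * cis t.2 = 1 - (w.2 : R[i])^* * cis t.2 - (h.2 : R[i])^* * cis t.2.
  by rewrite rmorphD; ring.
have n1 := szego_denominator_neq0 t.1 w1; have n2 := szego_denominator_neq0 t.2 w2.
have n1' := szego_denominator_neq0 t.1 q1'; have n2' := szego_denominator_neq0 t.2 q2'.
apply: (@product_expansion _ _ ((1 - ((w.1 : R[i]) + h.1)^* * cis t.1)^-1) ((1 - ((w.2 : R[i]) + h.2)^* * cis t.2)^-1)).
- by rewrite E1; apply: inverse_expansion => //; rewrite -E1.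
- by rewrite E2; apply: inverse_expansion => //; rewrite -E2.
- exact: L1.
- exact: cnorm2_ge0.
- by lra.
- by apply: cabs_szego_factor => //; exact: le_trans rr'.
- by apply: cabs_szego_factor => //; exact: le_trans rr'.
- exact: cabs_szego_factor.
- exact: cabs_szego_factor.
- by rewrite cabsM cabsJ cabs_cis mulr1.
- by rewrite cabsM cabsJ cabs_cis mulr1.
Qed.

(* The holomorphic extension of [u] when [u] is analytic. *)
Definition szego_ext u w := coefE (szego_fun w) u.

Lemma inner_szego_ext u w y : bidisk w -> inner u (szego w y) = inner (szego_ext u w) y.
Proof. by move=> bw; rewrite innerC [RHS]innerC inner_coefE//; exact: szego_bcont. Qed.

Lemma szego_ext_eq u w x : bidisk w -> (forall y, inner u (szego w y) = inner x y) -> szego_ext u w = x.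
Proof.
move=> bw h; apply: coefE_eq => [|y]; first exact: szego_bcont.
by rewrite innerC [RHS]innerC -h.
Qed.

Lemma szego_ext_polyL s w : bidisk w -> szego_ext (polyL s) w = poly2 s w.
Proof. by move=> bw; apply: szego_ext_eq => // y; exact: inner_polyL_szego. Qed.

Lemma szego_extB u v w : bidisk w -> szego_ext (u - v) w = szego_ext u w - szego_ext v w.
Proof.
by move=> bw; apply: szego_ext_eq => // y; rewrite innerDl innerNl !inner_szego_ext// -innerNl -innerDl.
Qed.

(** Pair the expansion of the kernel with [u]. As [coefE] is conjugate-linear in the symbol,
    antiholomorphic dependence of the kernel becomes holomorphic dependence of the extension. *)
Lemma szego_ext_cdiff u w : bidisk w -> cdiff (szego_ext u) w.
Proof.
move=> bw; have [C [d d0 [C0 hC]]] := szego_expansion bw.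
exists (coefE (szego_d1 w) u), (coefE (szego_d2 w) u) => e e0.
have u0 := hnorm_ge0 u; have D0 : 0 < C * hnorm u + 1 by rewrite ltr_pwDr// mulr_ge0.
exists (Num.min d (e / (C * hnorm u + 1))); first by rewrite lt_min d0 divr_gt0.
move=> h; rewrite lt_min => /andP[/hC[bwh hb] hd].
have bs := szego_bcont bw; have bs' := szego_bcont bwh.
have b1 := szego_d1_bcont bw; have b2 := szego_d2_bcont bw.
have -> : szego_ext u (w + h) - szego_ext u w - ((h.1 : R[i]) *: coefE (szego_d1 w) u + (h.2 : R[i]) *: coefE (szego_d2 w) u) =
  coefE (fun t => (szego_fun (w + h) t + (-1) * (szego_fun w t : R[i])) +
   (- (h.1 : R[i])^* * (szego_d1 w t : R[i]) + - (h.2 : R[i])^* * (szego_d2 w t : R[i])) : R[i]^o) u.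
  rewrite coefED; [|exact: bcontD bs' (bcontZ _ bs)|exact: bcontD (bcontZ _ b1) (bcontZ _ b2)].
  rewrite (coefED _ bs' (bcontZ _ bs)) (coefED _ (bcontZ _ b1) (bcontZ _ b2)) !coefEZ//.
  have cN (a : R[i]) : (- a^* )^* = - a.
    by case: a => x y; apply: complex_eq; rewrite /= ?opprK.
  have cN1 : (-1 : R[i])^* = -1 by rewrite rmorphN rmorph1.
  by rewrite (cN h.1) (cN h.2) cN1 !scaleNr scale1r opprD.
apply: (@le_trans _ _ ((C * cnorm2 h ^+ 2) * hnorm u)).
  apply: coefE_bound => [|t].
    exact: bcontD (bcontD bs' (bcontZ _ bs)) (bcontD (bcontZ _ b1) (bcontZ _ b2)).
  by have := hb t; rewrite mulN1r !mulNr addrA.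
have n0 := cnorm2_ge0 h; rewrite ltr_pdivlMr// in hd.
have -> : C * cnorm2 h ^+ 2 * hnorm u = cnorm2 h * (C * hnorm u) * cnorm2 h by ring.
rewrite ler_wpM2r//; apply: le_trans (ltW hd); rewrite ler_wpM2l//; lra.
Qed.

End Extension.

(** * Radial bounds and Hardy means *)

Section Fatou.
Context (R : realType) (E : sepHilbertType R).
Implicit Types (s d : seq (nat * nat * E)) (z w : C2 R) (u : L2 E).

Lemma maximal_constant_gt0 : 0 < maximal_constant R.
Proof. by rewrite /maximal_constant mulr_gt0// exprn_gt0. Qed.

Lemma sqnorm_polyL s : sqnorm (polyL s) = \int[mu2]_(t in square) sqnorm (poly2 s (torus t)).
Proof. exact: (sqnorm_toL2 (@polyL_square_integrable R E s)). Qed.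

(** A mesh [1 / K] with [L / K <= e], where [L] is the Lipschitz constant in the radius: rounding
    [r] down to the mesh costs at most [e]. *)
Lemma radial_grid d (e : R) : 0 < e -> exists rs : seq R, (forall r, r \in rs -> 0 <= r < 1) /\
  forall (t : R * R) (C r : R), 0 <= C -> radial_max d rs t <= C ^+ 2 -> 0 <= r < 1 ->
    hnorm (poly2 d (radial r t)) <= C + e.
Proof.
move=> e0; have [L L0 hL] := poly2_lip d; pose K := (Num.truncn (L / e)).+1.
have K0 : 0 < K%:R :> R by rewrite ltr0n.
have LK : L / K%:R <= e.
  by rewrite ler_pdivrMr// mulrC -ler_pdivrMr// ltW// truncnS_gt.
exists [seq i%:R / K%:R | i <- iota 0 K]; split.
  move=> r; case/mapP => i; rewrite mem_iota add0n => /andP[_ iK] ->.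
  by rewrite divr_ge0//= ltr_pdivrMr// mul1r ltr_nat.
move=> t C r C0 hC /andP[r0 r1]; pose i := Num.truncn (r * K%:R).
have rK0 : 0 <= r * K%:R by rewrite mulr_ge0// ltW.
have /andP[i1 i2] := truncn_itv rK0; rewrite -/i in i1 i2.
have iK : (i < K)%N.
  by rewrite -(ltr_nat R); apply: le_lt_trans i1 _; rewrite gtr_pMl.
have q1 : i%:R / K%:R <= r by rewrite ler_pdivrMr.
have q2 : r - i%:R / K%:R <= K%:R^-1.
  have -> : r - i%:R / K%:R = (r * K%:R - i%:R) / K%:R by rewrite mulrBl mulfK ?gt_eqF.
  by rewrite ler_pdivrMr// mulVf ?gt_eqF// lerBlDr addrC natr1 ltW.
have q0 : 0 <= i%:R / K%:R :> R by rewrite divr_ge0.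
have h1 : hnorm (poly2 d (radial (i%:R / K%:R) t)) <= C.
  rewrite ler_hnorm//; apply: le_trans hC; rewrite /radial_max.
  apply: (@Order.TotalTheory.le_bigmax_seq _ _ _ _ 0 (i%:R / K%:R) xpredT
    (fun r => sqnorm (poly2 d (radial r t)))) => //.
  by apply: (map_f (fun i => i%:R / K%:R : R)); rewrite mem_iota.
have h2 := hL r (i%:R / K%:R) t.
rewrite -[poly2 d (radial r t)](subrK (poly2 d (radial (i%:R / K%:R) t))).
apply: le_trans (ler_hnormD _ _) _; rewrite addrC; apply: lerD => //.
apply: le_trans (h2 _ _) _; [by lra|by lra|].
apply: le_trans LK; rewrite ler_pM2l// ger0_norm//; lra.
Qed.

Lemma fast_radial_bound (s : nat -> seq (nat * nat * E)) :
  (forall n, sqnorm (polyL (s n.+1) - polyL (s n)) <= 8^-1 ^+ n / maximal_constant R) ->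
  {ae mu2, forall t, square t -> exists2 C : R, 0 <= C & forall n (r : R), 0 <= r < 1 ->
    hnorm (poly2 (s n.+1) (radial r t) - poly2 (s n) (radial r t)) <= C * 2^-1 ^+ n}.
Proof.
move=> hs; pose d n := poly2_sub (s n.+1) (s n).
have e0 n : 0 < 2^-1 ^+ n :> R by rewrite exprn_gt0.
pose rs n := projT1 (cid (radial_grid (d n) (e0 n))).
have hrs n : (forall r, r \in rs n -> 0 <= r < 1) by exact: (projT2 (cid (radial_grid (d n) (e0 n)))).1.
have hb n := (projT2 (cid (radial_grid (d n) (e0 n)))).2.
(* The weight [2^n] turns the decay [8^-n] of the integrals into [4^-n]. Then almost everywhere
   [2^n] times the maximum is at most [C 2^-n], so the maximal squared norm decays like [4^-n] and
   the norm like [2^-n]. *)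
pose g n (t : angles R) := 2 ^+ n * radial_max (d n) (rs n) t.
have cg n : continuous (g n : R * R -> R).
  by move=> t; apply: cvgM; [exact: cvg_cst|exact: continuous_radial_max].
have rm0 n t : 0 <= radial_max (d n) (rs n) t by exact: bigmax_ge_id.
have ig n : (\int[mu2]_(t in square) (g n t)%:E <= (4^-1 ^+ n)%:E)%E.
  have /integrable_fin_num : mu2.-integrable square (EFin \o g n) by exact: continuous_integrable2.
  move=> /(_ (@measurable_square R)) fin.
  rewrite -(fineK fin) lee_fin -[fine _]/(\int[mu2]_(t in square) g n t).
  rewrite /g RintegralZl//; last by apply: continuous_integrable2; exact: continuous_radial_max.
  apply: (@le_trans _ _ (2 ^+ n * (maximal_constant R * (8^-1 ^+ n / maximal_constant R)))).
    rewrite ler_wpM2l ?exprn_ge0//; apply: le_trans (integral_radial_max (d n) (hrs n)) _.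
    by rewrite -sqnorm_polyL /d polyL_sub; apply: ler_wpM2l; [exact: ltW maximal_constant_gt0|exact: hs].
  have -> : maximal_constant R * (8^-1 ^+ n / maximal_constant R) = 8^-1 ^+ n.
    by rewrite mulrC divfK// gt_eqF// maximal_constant_gt0.
  by rewrite -exprMn (_ : 2 * 8^-1 = 4^-1)//; field.
have mg n : measurable_fun square (g n) by apply: measurable_funTS; exact: continuous_measurable2.
have g0 n t : 0 <= g n t by rewrite mulr_ge0// exprn_ge0.
apply: filterS (ae_geometric_bound mg g0 ig) => t ht /ht[C hC].
(* [C' ^+ 2] dominates [C], which avoids a square root; the further 1 absorbs the grid error
   [2^-n]. *)
pose C' := `|C| + 1; exists (C' + 1); first by rewrite addr_ge0// addr_ge0.
move=> n r r01; rewrite -poly2_subE -/(d n) mulrDl mul1r.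
apply: (hb n t) => //; first by rewrite mulr_ge0 ?exprn_ge0// addr_ge0.
have := hC n; rewrite /g mulrC -ler_pdivlMr ?exprn_gt0// => /le_trans; apply.
rewrite -exprVn -mulrA -expr2 exprMn; apply: ler_wpM2r; first exact: sqr_ge0.
rewrite /C'; have := ler_norm C; move: (normr_ge0 C); move: `|C| (C) => x y x0 yx; nra.
Qed.

Lemma telescope_bound (V : innerType R) (p : nat -> V) (C : R) :
  (forall n, hnorm (p n.+1 - p n) <= C * 2^-1 ^+ n) ->
  forall n m, hnorm (p (n + m)%N - p n) <= 2 * C * 2^-1 ^+ n.
Proof.
move=> hp n m; have C0 : 0 <= C by have := hp 0%N; rewrite expr0 mulr1; apply: le_trans; exact: hnorm_ge0.
suff : hnorm (p (n + m)%N - p n) <= 2 * C * (2^-1 ^+ n - 2^-1 ^+ (n + m)).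
  by move/le_trans; apply; rewrite ler_wpM2l ?mulr_ge0// gerBl exprn_ge0.
elim: m => [|m IH]; first by rewrite addn0 !subrr mulr0 hnorm0.
rewrite addnS; apply: le_trans (ler_hnorm_distD _ (p (n + m)%N) _) _.
apply: le_trans (lerD (hp _) IH) _; rewrite exprS le_eqVlt; apply/orP; left; apply/eqP.
by move: (2^-1 ^+ n) (2^-1 ^+ (n + m)) => x y; field.
Qed.

Lemma szego_ext_bound w : bidisk w -> exists M : R, forall u, hnorm (szego_ext u w) <= M * hnorm u.
Proof.
move=> bw; have [cs [M hM]] := szego_bcont bw; exists M => u.
by apply: coefE_bound => //; exact: szego_bcont.
Qed.

Lemma szego_ext_approx u (s : nat -> seq (nat * nat * E)) w : bidisk w ->
  hcvg (fun n => polyL (s n)) u -> hcvg (fun n => poly2 (s n) w) (szego_ext u w).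
Proof.
move=> bw /hcvgP hs; have [M hM] := szego_ext_bound bw; apply/hcvgP => e e0.
have d0 : 0 < e / (`|M| + 1) by rewrite divr_gt0// ltr_pwDr.
have [N hN] := hs _ d0; exists N => n /hN; rewrite ltr_pdivlMr ?ltr_pwDr// => h.
rewrite -szego_ext_polyL// -szego_extB//; apply: le_lt_trans (hM _) _.
apply: le_lt_trans h; rewrite mulrC ler_wpM2l ?hnorm_ge0//.
by apply: le_trans (ler_norm M) _; rewrite lerDl.
Qed.

Lemma analytic_fast u (e : nat -> R) : analytic u -> (forall n, 0 < e n) ->
  exists s : nat -> seq (nat * nat * E), forall n, hnorm (u - polyL (s n)) < e n.
Proof.
move=> au e0; exists (fun n => projT1 (cid (au _ (e0 n)))) => n.
exact: (projT2 (cid (au _ (e0 n)))).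
Qed.

Lemma poly2_means (s : seq (nat * nat * E)) (r : R) : 0 <= r < 1 ->
  (\int[mu2]_(t in square) (sqnorm (poly2 s (radial r t)))%:E <=
    (maximal_constant R * sqnorm (polyL s))%:E)%E.
Proof.
move=> r01; have cg : continuous (fun t : R * R => sqnorm (poly2 s (radial r t))) by exact: continuous_poly2_radial.
have fin := integrable_fin_num (@measurable_square R) (continuous_integrable2 cg).
rewrite -(fineK fin) lee_fin -[fine _]/(\int[mu2]_(t in square) sqnorm (poly2 s (radial r t))).
have hrs x : x \in [:: r] -> 0 <= x < 1 by rewrite inE => /eqP ->.
rewrite sqnorm_polyL; apply: le_trans (integral_radial_max s hrs).
rewrite le_eqVlt; apply/orP; left; apply/eqP; apply: eq_Rintegral => t _.
by rewrite /radial_max big_cons big_nil max_l// sqnorm_ge0.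
Qed.

(** The polynomial approximants have means bounded by the maximal inequality for a single radius,
    and Fatou's lemma carries the bound over to the extension. *)
Lemma szego_ext_hardy u F : analytic u -> (forall w, bidisk w -> szego_ext u w = F w) -> hardy_space F.
Proof.
move=> au hF; have dF w : bidisk w -> cdiff F w.
  move=> bw; have [A1 [A2 hA]] := szego_ext_cdiff u bw; exists A1, A2 => e e0.
  have [d d0 hd] := hA e e0; have [C [d' d'0 [_ hC]]] := szego_expansion bw.
  exists (Num.min d d'); first by rewrite lt_min d0.
  move=> h; rewrite lt_min => /andP[/hd + /hC[bwh _]].
  by rewrite !hF.
split=> [z bz|]; first by apply: cdiff_differentiable; exact: dF.
have e0 n : 0 < 2^-1 ^+ n :> R by rewrite exprn_gt0.
have [s hs] := analytic_fast au e0.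
have cs : hcvg (fun n => polyL (s n)) u.
  apply/hcvgP => e ep; have [|N hN] := @expr_small R 2^-1 e _ ep; first by apply/andP; split; lra.
  exists N => n Nn; rewrite hnorm_distC; apply: lt_le_trans (hs n) _; apply: le_trans (ltW hN).
  by apply: ler_wiXn2l => //; lra.
exists (maximal_constant R * (hnorm u + 1) ^+ 2) => r r01.
pose g n (t : angles R) := sqnorm (poly2 (s n) (radial r t)).
have mE (G : C2 R -> E) : (forall z, bidisk z -> cdiff G z) ->
    measurable_fun square (fun t : angles R => sqnorm (G (radial r t))).
  move=> cG; apply: measurable_funTS; apply: (@continuous_measurable2 R (fun t => sqnorm (G (radial r t)))) => t.
  by apply: continuous_sqnorm; exact: cdiff_radial.
apply: (@fatou_bound R g).
- by move=> n; apply: (mE (poly2 (s n))) => z _; exact: poly2_cdiff.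
- by move=> n t; exact: sqnorm_ge0.
- exact: mE.
- apply: aeW => t _; rewrite -hF; last exact: bidisk_radial.
  by apply: hcvg_sqnorm; apply: szego_ext_approx => //; exact: bidisk_radial.
- move=> n; apply: le_trans (poly2_means (s n) r01) _; rewrite lee_fin.
  apply: ler_wpM2l; first exact: ltW maximal_constant_gt0.
  have u1 : 0 <= hnorm u + 1 by rewrite addr_ge0 ?hnorm_ge0.
  rewrite -ler_hnorm//; have := hs n; rewrite hnorm_distC => h1.
  rewrite -[polyL (s n)](subrK u); apply: le_trans (ler_hnormD _ _) _; rewrite addrC lerD2l.
  by apply: le_trans (ltW h1) _; rewrite exprn_ile1//; lra.
Qed.

End Fatou.

Section HardyL2.
Context (R : realType) (E : sepHilbertType R).
Implicit Types (s d : seq (nat * nat * E)) (z w : C2 R) (u v : L2 E).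

Lemma radial_cvg_limit (F : R -> E) (x : E) : (forall e : R, 0 < e ->
    exists2 a : R, a < 1 & forall r, a < r < 1 -> hnorm (F r - x) < e) ->
  F r @[r --> 1^'-] --> x.
Proof.
move=> h; apply/cvgrPdist_lt => e /gt0_complexE[-> e0]; have [a a1 ha] := h _ e0.
apply: filterS2 (nbhs_left_gt a1) (nbhs_left_lt 1) => r ar r1.
by rewrite distrC normr_hnorm ltcR ha// ar.
Qed.

(** The rate is chosen so that two consecutive errors together satisfy [(2 e_n)^2 = 16^-n / (mc +
    1)^2 <= 8^-n / mc], as [fast_radial_bound] requires. *)
Lemma fast_rate (mc : R) (e : nat -> R) : 0 < mc -> (forall n, e n = 4^-1 ^+ n / (2 * (mc + 1))) ->
  [/\ forall n, 0 < e n, forall n, e n.+1 <= e n, forall n, e n <= 4^-1 ^+ n &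
      forall n, (e n + e n) ^+ 2 <= 8^-1 ^+ n / mc].
Proof.
move=> mc0 eE; have m1 : 0 < mc + 1 by lra.
have q0 : 0 < 2 * (mc + 1) by lra.
have x0 n : 0 < 4^-1 ^+ n :> R by rewrite exprn_gt0.
have y0 n : 0 < 8^-1 ^+ n :> R by rewrite exprn_gt0.
split=> n; rewrite ?eE.
- exact: divr_gt0.
- rewrite ler_pM2r ?invr_gt0// exprS; have := x0 n; lra.
- by rewrite ler_pdivrMr// ler_peMr ?ltW//; lra.
have -> : 4^-1 ^+ n / (2 * (mc + 1)) + 4^-1 ^+ n / (2 * (mc + 1)) = 4^-1 ^+ n / (mc + 1).
  by move: (4^-1 ^+ n) => x; field; rewrite gt_eqF.
rewrite exprMn -exprM mulnC exprM; apply: ler_pM.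
- exact: exprn_ge0 (exprn_ge0 _ _).
- by rewrite sqr_ge0.
- by apply: lerXn2r; rewrite ?nnegrE; lra.
- rewrite exprVn lef_pV2 ?posrE ?exprn_gt0//; nra.
Qed.

Lemma analytic_fast_seq u : analytic u -> exists s : nat -> seq (nat * nat * E),
  [/\ hcvg (fun n => polyL (s n)) u, (forall n, sqnorm (u - polyL (s n)) <= 4^-1 ^+ n) &
    (forall n, sqnorm (polyL (s n.+1) - polyL (s n)) <= 8^-1 ^+ n / maximal_constant R)].
Proof.
move=> au; pose e n : R := 4^-1 ^+ n / (2 * (maximal_constant R + 1)).
have [e0 edec ele esq] := fast_rate (maximal_constant_gt0 R) (fun n => erefl (e n)).
have [s hs] := analytic_fast au e0.
have half : 0 <= (4^-1 : R) < 1 by apply/andP; split; lra.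
have [h0 h1] := andP half; exists s; split.
- apply/hcvgP => b b0; have [N hN] := expr_small half b0.
  exists N => n Nn; rewrite hnorm_distC; apply: lt_le_trans (hs n) _; apply: le_trans (ltW hN).
  apply: le_trans (ele n) _; apply: ler_wiXn2l => //; exact: ltW.
- move=> n; rewrite -hnorm_sqr; apply: (@le_trans _ _ ((4^-1 ^+ n) ^+ 2)).
    apply: lerXn2r; rewrite ?nnegrE ?hnorm_ge0 ?exprn_ge0//.
    exact: le_trans (ltW (hs n)) (ele n).
  have x1 : (4^-1 : R) ^+ n <= 1 by rewrite exprn_ile1// ltW.
  by rewrite expr2 ler_piMr// exprn_ge0.
- move=> n; apply: le_trans (esq n); rewrite -hnorm_sqr.
  apply: lerXn2r; rewrite ?nnegrE; [exact: hnorm_ge0|by apply: addr_ge0; exact: ltW|].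
  apply: le_trans (ler_hnorm_distD _ u _) _; rewrite hnorm_distC; apply: lerD; last exact: ltW.
  exact: le_trans (ltW (hs _)) (edec n).
Qed.

(** Fatou's theorem, with three errors of size [b / 3]: extension against polynomial at radius [r],
    polynomial at [r] against polynomial on the torus, and polynomial against [u]. The maximal
    inequality makes the first one uniform in [r], so [n] can be fixed before [r] tends to 1. *)
Lemma szego_ext_radial u : analytic u ->
  {ae mu2, forall t, square t -> szego_ext u (radial r t) @[r --> 1^'-] --> L2fun u t}.
Proof.
move=> /analytic_fast_seq[s [cs us b1]].
have mg n : measurable_fun square (fun t => sqnorm (L2fun (u - polyL (s n)) t)).
  exact: measurable_sqnorm (L2funP _).1.
have ig n : (\int[mu2]_(t in square) (sqnorm (L2fun (u - polyL (s n)) t))%:E <= (4^-1 ^+ n)%:E)%E.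
  by rewrite integral_sqnorm_L2 lee_fin.
have A1 := ae_geometric_bound mg (fun n t => sqnorm_ge0 _) ig.
have A2 : {ae mu2, forall t, forall n, square t -> L2fun (u - polyL (s n)) t = L2fun u t - poly2 (s n) (torus t)}.
  apply: ae_foralln => n; move: (L2funB u (polyL (s n))) (toL2E (@polyL_square_integrable R E (s n))).
  by apply: filterS2 => t h1 h2 tS; rewrite h1// h2.
move: A1 A2 (fast_radial_bound b1); apply: filterS3 => t h1 h2 h3 tS.
have [C1 hC1] := h1 tS; have [C C0 hC] := h3 tS.
have half : 0 <= (2^-1 : R) < 1 by apply/andP; split; lra.
have [half0 half1] := andP half.
apply: radial_cvg_limit => b b0; have b3 : 0 < b / 3 by rewrite divr_gt0.
have C2 : 0 < 2 * C + 1 by rewrite ltr_wpDl// mulr_ge0.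
have C3 : 0 < `|C1| + 1 by rewrite ltr_wpDl.
have [N1 hN1] := expr_small half (divr_gt0 b3 C2).
have [N2 hN2] := expr_small half (divr_gt0 (exprn_gt0 2 b3) C3).
pose n := (N1 + N2)%N; have [L L0 hL] := poly2_lip (s n).
have n1 : 2 * C * 2^-1 ^+ n <= b / 3.
  move: hN1; rewrite ltr_pdivlMr// => /ltW; apply: le_trans; rewrite mulrC; apply: ler_pM.
  - exact: exprn_ge0.
  - exact: mulr_ge0.
  - by apply: ler_wiXn2l => //; [exact: ltW|exact: leq_addr].
  - by rewrite lerDl.
have n2 : hnorm (poly2 (s n) (torus t) - L2fun u t) <= b / 3.
  rewrite hnorm_distC ler_hnorm; [rewrite -h2//; apply: le_trans (hC1 n) _|exact: ltW].
  move: hN2; rewrite ltr_pdivlMr// => /ltW; apply: le_trans; rewrite mulrC.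
  apply: (@le_trans _ _ (2^-1 ^+ n * (`|C1| + 1))).
    by apply: ler_wpM2l; [exact: exprn_ge0|apply: le_trans (ler_norm _) _; rewrite lerDl].
  by apply: ler_wpM2r; [exact: ltW|apply: ler_wiXn2l => //; [exact: ltW|exact: leq_addl]].
exists (Num.max 0 (1 - b / (3 * L) / 2)); first by rewrite gt_max ltr01 gtrBl divr_gt0// divr_gt0// mulr_gt0.
move=> r; rewrite gt_max => /andP[/andP[r0 rb] r1].
have r01 : 0 <= r < 1 by rewrite ltW.
have n3 : hnorm (poly2 (s n) (radial r t) - poly2 (s n) (torus t)) < b / 3.
  rewrite -radial1; apply: le_lt_trans (hL r 1 t _ _) _; [by rewrite !ltW|by rewrite ler01 lexx|].
  rewrite distrC ger0_norm; last by rewrite subr_ge0 ltW.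
  have : 1 - r < b / (3 * L) / 2 by lra.
  rewrite -(ltr_pM2l L0) => /lt_trans; apply.
  have -> : L * (b / (3 * L) / 2) = b / 3 / 2 by field; rewrite gt_eqF.
  by rewrite ltr_pdivrMr// ltr_pMr//; lra.
have n4 : hnorm (szego_ext u (radial r t) - poly2 (s n) (radial r t)) <= b / 3.
  apply: le_trans n1; have cp := szego_ext_approx (bidisk_radial t r01) cs.
  apply/ler_addgt0Pr => e e0; have [N hN] := (hcvgP _ _).1 cp e e0.
  apply: le_trans (ler_hnorm_distD _ (poly2 (s (n + N)%N) (radial r t)) _) _.
  rewrite addrC; apply: lerD; first by apply: (@telescope_bound R E (fun k => poly2 (s k) (radial r t))) => k; exact: hC.
  by rewrite hnorm_distC ltW// hN// leq_addl.
apply: le_lt_trans (ler_hnorm_distD _ (poly2 (s n) (radial r t)) _) _.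
apply: le_lt_trans (lerD n4 (ler_hnorm_distD _ (poly2 (s n) (torus t)) _)) _.
have bE : b / 3 + (b / 3 + b / 3) = b by field.
by apply: (lt_le_trans (ler_ltD (lexx (b / 3)) (ltr_leD n3 n2))); rewrite bE.
Qed.

Lemma analytic_boundary u F : analytic u -> (forall w, bidisk w -> szego_ext u w = F w) ->
  boundary_function F u.
Proof.
move=> au hF; split; first exact: szego_ext_hardy au hF.
apply: filterS (szego_ext_radial au) => t h tS; apply: cvg_trans (h tS).
apply: near_eq_cvg; apply: filterS2 (@nbhs_left_gt R 1 0 ltr01) (nbhs_left_lt 1) => r r0 r1.
by apply: hF; apply: bidisk_radial; rewrite ltW.
Qed.

End HardyL2.

(** * Hardy functions as extensions of their boundary values *)

Section HardyFunctional.
Context (R : realType) (E : sepHilbertType R).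
Implicit Types (F : C2 R -> E) (z w : C2 R) (u v : L2 E).

Lemma hardy_cdiff F w : hardy_space F -> bidisk w -> cdiff F w.
Proof. by move=> [dF _] /dF; exact: differentiable_cdiff. Qed.

Lemma subspaceB (V : innerType R) (D : set V) x y : is_subspace D -> D x -> D y -> D (x - y).
Proof. by move=> [_ h] Dx Dy; rewrite -scaleN1r addrC; exact: h. Qed.

(** Projecting does not change the extension, because its values are inner products with Szego
    kernels and these are analytic. *)
Lemma analytic_projection u : exists v, [/\ analytic v, hnorm v <= hnorm u,
  forall d, analytic d -> inner (u - v) d = 0 & forall w, bidisk w -> szego_ext v w = szego_ext u w].
Proof.
have [p [pu po pc]] := orthogonal_projection u (@L2_complete R E) (@analytic_subspace R E).
have pI d : analytic d -> inner (u - p) d = 0.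
  move=> ad; rewrite innerC; suff -> : inner d (u - p) = 0 by rewrite rmorph0.
  apply: complex_eq; first exact: po.
  rewrite Im_inner_Rinl po//; have [h0 h] := @analytic_subspace R E.
  by rewrite -[_ *: d]addr0; exact: h.
exists p; split=> //.
  by apply: analytic_limit => e e0; have [d ad hd] := pc e e0; exists d.
move=> w bw; apply: szego_ext_eq => // y; rewrite -inner_szego_ext//.
have := pI _ (analytic_szego y bw); rewrite innerDl innerNl => /eqP.
by rewrite subr_eq0 => /eqP ->.
Qed.

(** A weak limit of the dilates [f n], obtained without compactness: the limit functional is
    represented only on the subspace where it exists, and this contains the Szego kernels by
    Cauchy's formula. *)
Lemma hardy_functional F : hardy_space F ->
  exists u, analytic u /\ forall w, bidisk w -> szego_ext u w = F w.
Proof.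
move=> hF; have cF z : bidisk z -> cdiff F z by exact: hardy_cdiff.
have [_ [M hM]] := hF; pose r n : R := 1 - n.+1%:R^-1.
have r01 n : 0 <= r n < 1.
  rewrite /r subr_ge0 gtrBl invr_gt0 ltr0n andbT invf_le1//; first by rewrite ler1n.
pose f n : L2 E := toL2 (fun t : angles R => F (radial (r n) t)).
have sf n : square_integrable (fun t : angles R => F (radial (r n) t)).
  by apply: continuous_square_integrable; exact: cdiff_radial.
have fM n : hnorm (f n) <= Num.sqrt M.
  have h : sqnorm (f n) <= M.
    rewrite sqnorm_toL2// -lee_fin; apply: le_trans (hM _ (r01 n)).
    rewrite /Rintegral fineK//; apply: integrable_fin_num => //.
    exact: integrable_sqnorm (sf n).
  by rewrite /hnorm ler_wsqrtr.
(* Quantifying over the multiples [a *: x] makes [D] a complex subspace although only real parts are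
   taken. *)
pose D (x : L2 E) := forall a : R[i], cvgn (fun n => Rin (a *: x) (f n)).
pose l (x : L2 E) := limn (fun n => Rin x (f n)).
have D1 x : D x -> (fun n => Rin x (f n)) @ \oo --> l x.
  by move=> /(_ 1); rewrite /l scale1r.
have DE (a : R[i]) x y : D x -> D y -> D (a *: x + y).
  move=> Dx Dy b; rewrite scalerDr scalerA.
  under eq_fun do rewrite RinDl; exact: (is_cvgD (Dx (b * a)) (Dy b)).
have D0 : D 0 by move=> b; under eq_fun do rewrite scaler0 Rin0l; exact: is_cvg_cst.
have ll (a : R) x y : D x -> D y -> l (a%:C%C *: x + y) = a * l x + l y.
  move=> Dx Dy; apply: cvg_lim => //; under eq_fun do rewrite RinDl RinZl.
  by apply: cvgD; [apply: cvgMr; exact: D1|exact: D1].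
have lb x : D x -> l x <= Num.sqrt M * hnorm x.
  move=> Dx; apply: (@closed_cvg _ _ _ eventually_filter (fun n => Rin x (f n)) [set y | y <= Num.sqrt M * hnorm x]).
  - exact: closed_le.
  - apply: nearW => n /=; apply: le_trans (Rin_le_hnorm _ _) _.
    by rewrite mulrC ler_wpM2r ?hnorm_ge0.
  - exact: D1.
have lid : linear (id : L2 E -> L2 E) by [].
have [p [_ hp _]] := @riesz_variational R (L2 E) (L2 E) D id l (Num.sqrt M) (@L2_complete R E)
  D0 DE lid ll lb (sqrtr_ge0 _).
have cR w y : bidisk w -> (fun n => Rin (szego w y) (f n)) @ \oo --> Rin y (F w).
  move=> bw; have E1 n : Rin (szego w y) (f n) = Rin (F ((r n)%:C%C * (w.1 : R[i]), (r n)%:C%C * (w.2 : R[i]))) y.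
    by rewrite RinC /Rin (cauchy_szego y cF (r01 n) bw).
  under eq_fun do rewrite E1; rewrite RinC.
  have cr : (fun n => (r n)%:C%C : R[i]^o) @ \oo --> (1 : R[i]^o).
    have cr0 : r @ \oo --> (1 : R).
      have h : (fun n => 1 - harmonic n : R) @ \oo --> (1 - 0 : R) by apply: cvgB; [exact: cvg_cst|exact: cvg_harmonic].
      by rewrite subr0 in h.
    exact: (cvg_comp _ _ cr0 (@continuous_real_complex R 1)).
  have cw : (fun n => ((r n)%:C%C * (w.1 : R[i]), (r n)%:C%C * (w.2 : R[i])) : C2 R) @ \oo --> (w : C2 R).
    have cm (a : R[i]^o) : (fun n => (r n)%:C%C * a : R[i]^o) @ \oo --> (a : R[i]^o).
      have h : (fun n => (r n)%:C%C * a : R[i]^o) @ \oo --> (1 * a : R[i]^o) by apply: cvgM; [exact: cr|exact: cvg_cst].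
      by rewrite mul1r in h.
    case: (w) => a b; exact: (cvg_pair (cm a) (cm b)).
  apply: (cvg_comp _ _ cw (_ : (fun z => Rin (F z) y) @ w --> Rin (F w) y)).
  by apply: continuous_Rin; apply: cdiff_continuous; exact: cF.
have Ds w y : bidisk w -> D (szego w y).
  move=> bw a; rewrite -(linear_scale a y (szego_linear bw)).
  by apply: cvgP; exact: cR.
have [u [au _ _ hu]] := analytic_projection p.
exists u; split=> // w bw; rewrite hu//; apply: Rin_inj => y.
have h := hp _ (Ds w y bw).
have -> : Rin y (szego_ext p w) = l (szego w y).
  by rewrite -h RinC [RHS]RinC; rewrite /Rin inner_szego_ext.
by apply: cvg_lim => //; exact: cR.
Qed.

(** [F] is the extension of some analytic [v], whose radial limits are [v] by Fatou's theorem;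
    uniqueness of limits gives [u = v]. *)
Lemma boundary_functionP F u : boundary_function F u ->
  analytic u /\ forall w, bidisk w -> szego_ext u w = F w.
Proof.
move=> [hF cF]; have [v [av hv]] := hardy_functional hF.
have [_ cv] := analytic_boundary av hv.
suff -> : u = v by [].
apply: L2ext; move: cF cv; apply: filterS2 => t h1 h2 tS.
exact: cvg_unique (h1 tS) (h2 tS).
Qed.

Lemma H2_subspaceP u : H2_subspace u <-> analytic u.
Proof.
split=> [[F /boundary_functionP[]] //|au].
by exists (szego_ext u); exact: (analytic_boundary au).
Qed.

End HardyFunctional.

(** * Boundary values of Schur functions *)

Section Multipliers.
Context (R : realType) (E Es : sepHilbertType R).
Implicit Types (A : angles R -> E -> Es) (u v : L2 E).

Lemma ae_and (P Q : angles R -> Prop) :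
  {ae mu2, forall t, P t} -> {ae mu2, forall t, Q t} -> {ae mu2, forall t, P t /\ Q t}.
Proof. by apply: filterS2 => t. Qed.

(** Everything is required only almost everywhere, because a boundary value is arbitrary at points
    where the radial limit fails to exist. *)
Definition multiplier A :=
  {ae mu2, forall t, square t -> linear (A t) /\ forall x, hnorm (A t x) <= hnorm x} /\
  forall u, exists2 h : angles R -> Es, weakly_measurable h &
    h = (fun t => A t (L2fun u t)) %[ae mu2 in square].

Lemma mulopE A u : multiplier A -> L2fun (mulop A u) = (fun t => A t (L2fun u t)) %[ae mu2 in square].
Proof.
move=> [aA /(_ u)[h mh hE]].
have sh : square_integrable h.
  split=> //; have [mu iu] := L2funP u; apply: le_lt_trans iu; apply: ae_ge0_le_integral => //.
  - by move=> t _; rewrite lee_fin sqnorm_ge0.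
  - by apply/measurable_EFinP; exact: measurable_sqnorm.
  - by move=> t _; rewrite lee_fin sqnorm_ge0.
  - by apply/measurable_EFinP; exact: measurable_sqnorm.
  - move: aA hE; apply: filterS2 => t h1 h2 tS; rewrite lee_fin h2// -!hnorm_sqr.
    by apply: lerXn2r; rewrite ?nnegrE ?hnorm_ge0//; exact: (h1 tS).2.
have -> : mulop A u = L2class sh.
  apply: toL2_eq; move: (L2fun_class sh) hE.
  by apply: filterS2 => t h1 h2 tS; rewrite h1// h2.
by move: (L2fun_class sh) hE; apply: filterS2 => t h1 h2 tS; rewrite h1// h2.
Qed.

Lemma mulop_linear A : multiplier A -> linear (mulop A).
Proof.
move=> mA a u v; apply: L2ext.
have h1 := ae_and (mulopE (a *: u + v) mA) (ae_and (L2funD (a *: u) v) (L2funZ a u)).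
have h2 := ae_and (L2funD (a *: mulop A u) (mulop A v)) (L2funZ a (mulop A u)).
have h3 := ae_and (mulopE u mA) (ae_and (mulopE v mA) mA.1).
move: h1 h2 h3; apply: filterS3 => t [k1 [k2 k3]] [k4 k5] [k6 [k7 k8]] tS.
have [lA _] := k8 tS.
by rewrite k1// k2// k3// k4// k5// k6// k7// lA.
Qed.

Lemma mulop_contraction A u : multiplier A -> hnorm (mulop A u) <= hnorm u.
Proof.
move=> mA; have iu := integral_sqnorm_L2 (mulop A u); have iv := integral_sqnorm_L2 u.
rewrite ler_hnorm ?hnorm_ge0// hnorm_sqr -lee_fin -iu -iv; apply: ae_ge0_le_integral => //.
- by move=> t _; rewrite lee_fin sqnorm_ge0.
- by apply/measurable_EFinP; apply: measurable_sqnorm; exact: (L2funP _).1.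
- by move=> t _; rewrite lee_fin sqnorm_ge0.
- by apply/measurable_EFinP; apply: measurable_sqnorm; exact: (L2funP _).1.
- move: mA.1 (mulopE u mA); apply: filterS2 => t h1 h2 tS; rewrite lee_fin h2// -!hnorm_sqr.
  by apply: lerXn2r; rewrite ?nnegrE ?hnorm_ge0//; exact: (h1 tS).2.
Qed.

End Multipliers.

Section ScalarMultipliers.
Context (R : realType) (E : sepHilbertType R).
Implicit Types (a : R * R -> R[i]^o) (u v : L2 E).

Lemma weakly_measurable_scale a (f : angles R -> E) : continuous a -> weakly_measurable f ->
  weakly_measurable (fun t : angles R => (a t : R[i]) *: f t).
Proof.
move=> ca mf; apply: weakly_measurable_Rin => y; have [m1 m2] := mf y.
have c1 : measurable_fun square (fun t : angles R => complex.Re (a t)).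
  apply: measurable_funTS; apply: (@continuous_measurable2 R (fun t => complex.Re (a t))) => t.
  by apply: continuous_comp; [exact: ca|exact: continuous_Re].
have c2 : measurable_fun square (fun t : angles R => complex.Im (a t)).
  apply: measurable_funTS; apply: (@continuous_measurable2 R (fun t => complex.Im (a t))) => t.
  by apply: continuous_comp; [exact: ca|exact: continuous_Im].
rewrite (_ : (fun t => _) = fun t : angles R => complex.Re (a t) * complex.Re (inner (f t) y) -
    complex.Im (a t) * complex.Im (inner (f t) y)); last first.
  by apply/funext => t; rewrite /Rin innerZl; case: (a t) (inner _ _) => ? ? [].
by apply: measurable_funB; exact: measurable_funM.
Qed.

Lemma scalar_multiplier a : continuous a -> (forall t, cabs (a t) <= 1) ->
  multiplier (fun t (x : E) => (a t : R[i]) *: x).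
Proof.
move=> ca a1; split.
  apply: aeW => t _; split=> [c x y|x]; first by rewrite scalerDr !scalerA mulrC.
  by rewrite hnormZ ler_piMl ?hnorm_ge0.
move=> u; exists (fun t : angles R => (a t : R[i]) *: L2fun u t).
  by apply: weakly_measurable_scale => //; exact: (L2funP u).1.
exact: ae_eq_refl.
Qed.

Definition scalar_mul a : L2 E -> L2 E := mulop (fun t x => (a t : R[i]) *: x).

Lemma L2_inner_ext (E1 E2 : sepHilbertType R) (u v : L2 E1) (u' v' : L2 E2) :
  {ae mu2, forall t, square t -> inner (L2fun u t) (L2fun v t) = inner (L2fun u' t) (L2fun v' t)} ->
  inner u v = inner u' v'.
Proof.
move=> h; have [i1 i2] := integrable_inner (L2funP u) (L2funP v).
have [j1 j2] := integrable_inner (L2funP u') (L2funP v').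
rewrite -[LHS]/(L2inner _ _) -[RHS]/(L2inner _ _); apply: complex_eq.
  by rewrite !Re_L2inner; apply: ae_eq_Rintegral => //; apply: filterS h => t ht tS; rewrite ht.
by rewrite !Im_L2inner; apply: ae_eq_Rintegral => //; apply: filterS h => t ht tS; rewrite ht.
Qed.

Lemma inner_scalar_mul a u v : continuous a -> (forall t, cabs (a t) = 1) ->
  inner (scalar_mul a u) (scalar_mul a v) = inner u v.
Proof.
move=> ca a1; have ma : multiplier (fun t (x : E) => (a t : R[i]) *: x).
  by apply: scalar_multiplier => // t; rewrite a1.
apply: L2_inner_ext; move: (mulopE u ma) (mulopE v ma); apply: filterS2 => t h1 h2 tS.
by rewrite h1// h2// innerZl innerZr mulrA -cabs_sqrJ a1 expr1n mul1r.
Qed.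

Lemma scalar_mulK a u : continuous a -> (forall t, cabs (a t) = 1) ->
  scalar_mul a (scalar_mul (fun t => (a t : R[i])^* : R[i]^o) u) = u.
Proof.
move=> ca a1; have ma : multiplier (fun t (x : E) => (a t : R[i]) *: x).
  by apply: scalar_multiplier => // t; rewrite a1.
have ma' : multiplier (fun t (x : E) => (a t : R[i])^* *: x).
  apply: (@scalar_multiplier (fun t => (a t : R[i])^* : R[i]^o)) => [t|t]; last by rewrite cabsJ a1.
  apply: (@continuous_comp _ _ _ a (fun z : R[i]^o => z^* : R[i]^o)); first exact: ca.
  exact: continuous_conj.
apply: L2ext; move: (mulopE (scalar_mul (fun t => (a t : R[i])^* : R[i]^o) u) ma) (mulopE u ma').
apply: filterS2 => t h1 h2 tS.
by rewrite h1// h2// scalerA -cabs_sqrJ a1 expr1n scale1r.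
Qed.

End ScalarMultipliers.

Section BoundaryMultiplier.
Context (R : realType) (E Es : sepHilbertType R) (Phi : C2 R -> E -> Es) (PhiS : Schur_class Phi).
Implicit Types (z w : C2 R) (x y : E) (u v : L2 E).

Lemma schur_bounded z : bidisk z -> bounded_operator (Phi z).
Proof. by move=> bz; exact: (PhiS.1 z bz).1. Qed.

Lemma schur_linear z : bidisk z -> linear (Phi z).
Proof. by move=> /schur_bounded[]. Qed.

Lemma schur_contraction z x : bidisk z -> hnorm (Phi z x) <= hnorm x.
Proof. by move=> bz; have := (PhiS.1 z bz).2 x; rewrite !normr_hnorm lecR. Qed.

Lemma cdiff_small (V : sepHilbertType R) (F : C2 R -> V) z (e : R) : cdiff F z -> 0 < e ->
  exists2 d : R, 0 < d & forall h, cnorm2 h < d -> hnorm (F (z + h) - F z) < e.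
Proof.
move=> /cdiff_continuous/cvgrPdist_lt cF e0; have e0' : 0 < e%:C%C by rewrite ltcR.
have [d d0 hd] := (nbhs_C2P _ _).1 (cF _ e0'); exists d => // h /hd.
by rewrite /= distrC normr_hnorm ltcR.
Qed.

Lemma bidisk_near z : bidisk z -> exists2 d : R, 0 < d & forall h, cnorm2 h < d -> bidisk (z + h).
Proof. by move=> bz; have [C [d d0 [_ h]]] := szego_expansion bz; exists d => // k /h[]. Qed.

Lemma schur_cdiff_cst z x : bidisk z -> cdiff (Phi ^~ x) z.
Proof.
move=> bz; have [A1 [A2 [_ _ hA]]] := PhiS.2 z bz.
exists (A1 x), (A2 x) => e e0; have x0 := hnorm_ge0 x.
have x1 : 0 < hnorm x + 1 by rewrite ltr_wpDl.
have d0 : 0 < (e / (hnorm x + 1))%:C%C by rewrite ltcR divr_gt0.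
have [d dp hd] := (nbhs_C2P _ _).1 (hA _ d0); exists d => // h /hd.
rewrite add0r => /(_ x); rewrite !normr_hnorm cnorm2E -!rmorphM lecR => /le_trans; apply.
rewrite mulrAC ler_wpM2r ?cnorm2_ge0// mulrAC ler_pdivrMr// ler_pM2l//; lra.
Qed.

Let regroup (V : zmodType) (p q r a b c d a' b' : V) :
  p + (q + (a + b)) - r - (c + a' + (d + b')) = p + (q - r - (c + d)) + (a - a') + (b - b').
Proof. by rewrite !opprD !addrA [LHS](ACl (1*2*5*6*8*3*7*4*9)). Qed.

(** Product rule. [Phi] is differentiated at the fixed vector [G z] and only continuous at the
    derivatives of [G], while contractivity of [Phi (z + h)] controls the remainder of [G]. *)
Lemma schur_cdiff (G : C2 R -> E) z : bidisk z -> cdiff G z -> cdiff (fun z => Phi z (G z)) z.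
Proof.
move=> bz [a1 [a2 ha]]; have [b1 [b2 hb]] := schur_cdiff_cst (G z) bz.
exists (b1 + Phi z a1), (b2 + Phi z a2) => e e0.
have e4 : 0 < e / 4 by rewrite divr_gt0.
have [d1 d10 h1] := ha _ e4; have [d2 d20 h2] := hb _ e4.
have [d3 d30 h3] := cdiff_small (schur_cdiff_cst a1 bz) e4.
have [d4 d40 h4] := cdiff_small (schur_cdiff_cst a2 bz) e4.
have [d5 d50 h5] := bidisk_near bz.
exists (Num.min d1 (Num.min d2 (Num.min d3 (Num.min d4 d5)))); first by rewrite !lt_min d10 d20 d30 d40.
move=> h; rewrite !lt_min => /andP[/h1 {}h1 /andP[/h2 {}h2 /andP[/h3 {}h3 /andP[/h4 {}h4 /h5 bzh]]]].
have lz := schur_linear bz; have lzh := schur_linear bzh.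
set D := G (z + h) - G z - _ in h1; set B := Phi (z + h) (G z) - _ - _ in h2.
have -> : Phi (z + h) (G (z + h)) - Phi z (G z) -
    ((h.1 : R[i]) *: (b1 + Phi z a1) + (h.2 : R[i]) *: (b2 + Phi z a2)) =
  Phi (z + h) D + B + (h.1 : R[i]) *: (Phi (z + h) a1 - Phi z a1) + (h.2 : R[i]) *: (Phi (z + h) a2 - Phi z a2).
  have -> : G (z + h) = D + (G z + ((h.1 : R[i]) *: a1 + (h.2 : R[i]) *: a2)).
    by rewrite /D addrACA addNr addr0 subrK.
  rewrite !(linear_add lzh) !(linear_scale _ _ lzh) /B !scalerBr !scalerDr.
  exact: regroup.
have n0 := cnorm2_ge0 h.
have k1 : hnorm (Phi (z + h) D) <= e / 4 * cnorm2 h by apply: le_trans (schur_contraction _ bzh) h1.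
have k3 : hnorm ((h.1 : R[i]) *: (Phi (z + h) a1 - Phi z a1)) <= e / 4 * cnorm2 h.
  by rewrite hnormZ mulrC; apply: ler_pM; [exact: hnorm_ge0|exact: cabs_ge0|exact: ltW|exact: cabs1_le].
have k4 : hnorm ((h.2 : R[i]) *: (Phi (z + h) a2 - Phi z a2)) <= e / 4 * cnorm2 h.
  by rewrite hnormZ mulrC; apply: ler_pM; [exact: hnorm_ge0|exact: cabs_ge0|exact: ltW|exact: cabs2_le].
have -> : e * cnorm2 h = e / 4 * cnorm2 h + e / 4 * cnorm2 h + e / 4 * cnorm2 h + e / 4 * cnorm2 h by field.
do 3![apply: le_trans (ler_hnormD _ _) _; apply: lerD => //].
Qed.

Lemma hardy_dominated (F : C2 R -> Es) (M : R) : (forall z, bidisk z -> cdiff F z) ->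
  (forall r : R, 0 <= r < 1 -> (\int[mu2]_(t in square) (sqnorm (F (radial r t)))%:E <= M%:E)%E) ->
  hardy_space F.
Proof. by move=> dF hM; split; [move=> z /dF; exact: cdiff_differentiable|exists M]. Qed.

Lemma le_sqnorm_means (V W : sepHilbertType R) (F : C2 R -> V) (G : C2 R -> W) (r : R) :
  (forall z, bidisk z -> cdiff F z) -> (forall z, bidisk z -> cdiff G z) -> 0 <= r < 1 ->
  (forall z, bidisk z -> hnorm (F z) <= hnorm (G z)) ->
  (\int[mu2]_(t in square) (sqnorm (F (radial r t)))%:E <=
   \int[mu2]_(t in square) (sqnorm (G (radial r t)))%:E)%E.
Proof.
move=> cF cG r01 FG.
have mE (U : sepHilbertType R) (H : C2 R -> U) : (forall z, bidisk z -> cdiff H z) ->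
    measurable_fun square (fun t : angles R => sqnorm (H (radial r t))).
  move=> cH; apply: measurable_funTS; apply: (@continuous_measurable2 R (fun t => sqnorm (H (radial r t)))) => t.
  by apply: continuous_sqnorm; exact: cdiff_radial.
apply: ge0_le_integral => //.
- by move=> t _; rewrite lee_fin sqnorm_ge0.
- by apply/measurable_EFinP; exact: mE.
- by apply/measurable_EFinP; exact: mE.
- move=> t _; rewrite lee_fin -!hnorm_sqr; apply: lerXn2r; rewrite ?nnegrE ?hnorm_ge0//.
  by apply: FG; exact: bidisk_radial.
Qed.

Lemma cdiff_cst (V : sepHilbertType R) (x : V) z : cdiff (fun=> x) z.
Proof.
exists 0, 0 => e e0; exists 1 => // h _; rewrite !scaler0 addr0 !subrr hnorm0.
by rewrite mulr_ge0 ?cnorm2_ge0// ltW.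
Qed.

Lemma schur_hardy_cst x : hardy_space (Phi ^~ x).
Proof.
apply: (@hardy_dominated _ (sqnorm x)) => [z bz|r r01]; first exact: schur_cdiff_cst.
apply: le_trans (@le_sqnorm_means Es E (Phi ^~ x) (fun=> x) r _ _ r01 _) _.
- by move=> z bz; exact: schur_cdiff_cst.
- by move=> z bz; exact: cdiff_cst.
- by move=> z bz; exact: schur_contraction.
- rewrite [leLHS](_ : _ = (sqnorm x)%:E * mu2 (square : set (angles R)))%E; last exact: integral_cst.
  by rewrite mu2_square mule1.
Qed.

Lemma radial_cvgP (V : sepHilbertType R) (F : R -> V) (x : V) :
  F r @[r --> 1^'-] --> x <-> (forall e : R, 0 < e -> \forall r \near (1 : R)^'-, hnorm (F r - x) < e).
Proof.
split=> [/cvgrPdist_lt h e e0|h].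
  have e0' : 0 < e%:C%C by rewrite ltcR.
  by apply: filterS (h _ e0') => r; rewrite /= distrC normr_hnorm ltcR.
apply/cvgrPdist_lt => e /gt0_complexE[-> e0].
by apply: filterS (h _ e0) => r; rewrite /= distrC normr_hnorm ltcR.
Qed.

Lemma radial_near : \forall r \near (1 : R)^'-, 0 <= r < 1.
Proof.
apply: filterS2 (@nbhs_left_gt R 1 0 ltr01) (nbhs_left_lt 1) => r r0 r1.
by rewrite ltW.
Qed.

Definition has_radial_limits (t : angles R) :=
  forall x, Phi (radial r t) x @[r --> 1^'-] --> boundary_value Phi t x.

(** A single null set must serve all vectors: it is found for a countable dense set, and
    contractivity carries the Cauchy property over to every [x]. *)
Lemma ae_radial_limits : {ae mu2, forall t, square t -> has_radial_limits t}.
Proof.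
have [d dd] := @separable _ E.
have A : {ae mu2, forall t, forall n, square t -> cvg (Phi (radial r t) (d n) @[r --> 1^'-])}.
  apply: ae_foralln => n; have [u [au hu]] := hardy_functional (schur_hardy_cst (d n)).
  have [_] := analytic_boundary au hu; apply: filterS => t h tS.
  by apply: cvgP; exact: h tS.
apply: filterS A => t ht tS x.
suff : cvg (Phi (radial r t) x @[r --> 1^'-]) by [].
apply: cauchy_cvg; apply: cauchy_exP => e /gt0_complexE[-> e0].
set e' := complex.Re e in e0 *; have e2 : 0 < e' / 2 by rewrite divr_gt0.
have [y [xy [n _ def_y]]] : (ball x (e' / 2)%:C%C) `&` (range d) !=set0.
  apply: dd; last exact: ball_open.
  by exists x; apply: ballxx; rewrite ltcR.
have [l hl] := (cvg_ex _).1 (ht n tS); exists l.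
apply: filterS2 ((radial_cvgP _ _).1 hl _ e2) radial_near => r h1 r01.
rewrite /= -ball_normE /= normr_hnorm ltcR hnorm_distC.
apply: le_lt_trans (ler_hnorm_distD _ (Phi (radial r t) (d n)) _) _.
have br := bidisk_radial t r01; have lr := schur_linear br.
rewrite -/e' (splitr e'); apply: ler_ltD => //; rewrite -(linear_sub lr).
apply: le_trans (schur_contraction _ br) _; apply: ltW.
by move: xy; rewrite -def_y -ball_normE /= normr_hnorm ltcR.
Qed.

End BoundaryMultiplier.

Section BoundaryOperator.
Context (R : realType) (E Es : sepHilbertType R) (Phi : C2 R -> E -> Es) (PhiS : Schur_class Phi).
Implicit Types (z w : C2 R) (x y : E) (u v : L2 E).

Lemma boundary_value_linear t : has_radial_limits Phi t -> linear (boundary_value Phi t).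
Proof.
move=> ht a x y; have h1 := ht (a *: x + y).
have h2 : (a *: Phi (radial r t) x + Phi (radial r t) y) @[r --> 1^'-] -->
    (a *: boundary_value Phi t x + boundary_value Phi t y).
  by apply: cvgD; [apply: cvgZ; [exact: cvg_cst|exact: ht]|exact: ht].
suff h3 : Phi (radial r t) (a *: x + y) @[r --> 1^'-] --> (a *: boundary_value Phi t x + boundary_value Phi t y).
  exact: cvg_unique h1 h3.
apply: cvg_trans h2; apply: near_eq_cvg.
by apply: filterS (radial_near R) => r r01; rewrite (schur_linear PhiS (bidisk_radial t r01)).
Qed.

Lemma boundary_value_contraction t x : has_radial_limits Phi t ->
  hnorm (boundary_value Phi t x) <= hnorm x.
Proof.
move=> ht; apply/ler_addgt0Pr => e e0.
have [r [r01 hr]] : exists r : R, 0 <= r < 1 /\ hnorm (Phi (radial r t) x - boundary_value Phi t x) < e.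
  have h : \forall r \near (1 : R)^'-, 0 <= r < 1 /\ hnorm (Phi (radial r t) x - boundary_value Phi t x) < e.
    by apply: filterS2 (radial_near R) ((radial_cvgP _ _).1 (ht x) _ e0).
  exact: filter_ex h.
rewrite -[boundary_value Phi t x](subrK (Phi (radial r t) x)).
apply: le_trans (ler_hnormD _ _) _; rewrite addrC; apply: lerD.
  exact: schur_contraction (bidisk_radial t r01).
by rewrite hnorm_distC ltW.
Qed.

Lemma measurable_Rin (V : sepHilbertType R) (f g : angles R -> V) :
  weakly_measurable f -> weakly_measurable g -> measurable_fun square (fun t => Rin (f t) (g t)).
Proof.
move=> mf mg; rewrite (_ : (fun t => _) = fun t => 4^-1 * (sqnorm ((f + g) t) - sqnorm ((f - g) t))).
  apply: measurable_funM => //; apply: measurable_funB; apply: measurable_sqnorm.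
    exact: weakly_measurableD.
  exact: weakly_measurableB.
by apply/funext => t; rewrite /Rin Re_polar.
Qed.

(** Against a fixed [y] the adjoint moves [Phi] off the varying vector: [Phi^* y] is weakly
    measurable because [Phi x] is continuous for each [x], and polarisation handles the pairing of
    two weakly measurable functions. *)
Lemma schur_measurable (r : R) (f : angles R -> E) : 0 <= r < 1 -> weakly_measurable f ->
  weakly_measurable (fun t : angles R => Phi (radial r t) (f t)).
Proof.
move=> r01 mf; apply: weakly_measurable_Rin => y.
have hE t : Rin (Phi (radial r t) (f t)) y = Rin (f t) (adjoint (Phi (radial r t)) y).
  apply: Rin_adjoint; first exact: hcomplete_hilbert.
  by apply: (schur_bounded PhiS); exact: bidisk_radial.
under eq_fun do rewrite hE; apply: measurable_Rin => //.
apply: weakly_measurable_Rin => x.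
have hE' t : Rin (adjoint (Phi (radial r t)) y) x = Rin (Phi (radial r t) x) y.
  rewrite RinC -Rin_adjoint//; first exact: hcomplete_hilbert.
  by apply: (schur_bounded PhiS); exact: bidisk_radial.
under eq_fun do rewrite hE'; apply: measurable_funTS.
apply: (@continuous_measurable2 R (fun t => Rin (Phi (radial r t) x) y)) => t.
apply: continuous_Rin; apply: (@cdiff_radial _ _ (Phi ^~ x)) => // z bz.
exact: (schur_cdiff_cst PhiS).
Qed.

Lemma boundary_multiplier : multiplier (boundary_value Phi).
Proof.
split.
  apply: filterS (ae_radial_limits PhiS) => t ht tS; split; first exact: boundary_value_linear (ht tS).
  by move=> x; exact: boundary_value_contraction (ht tS).
move=> u; pose r n : R := 1 - n.+1%:R^-1.
have r01 n : 0 <= r n < 1.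
  rewrite /r subr_ge0 gtrBl invr_gt0 ltr0n andbT invf_le1//; first by rewrite ler1n.
have cr0 : r @ \oo --> (1 : R).
  have h : (fun n => 1 - harmonic n : R) @ \oo --> (1 - 0 : R) by apply: cvgB; [exact: cvg_cst|exact: cvg_harmonic].
  by rewrite subr0 in h.
apply: (@weakly_measurable_lim R Es (fun n t => Phi (radial (r n) t) (L2fun u t))).
  by move=> n; apply: schur_measurable => //; exact: (L2funP u).1.
apply: filterS (ae_radial_limits PhiS) => t ht tS; have c := ht tS (L2fun u t).
apply/hcvg_cvg/hcvgP => e e0.
have := (radial_cvgP _ _).1 c e e0; rewrite near_withinE => h.
have [N _ hN] := cr0 _ h; exists N => n Nn; apply: (hN n Nn).
by have /andP[] := r01 n.
Qed.

Lemma bmul_linear : linear (bmul Phi).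
Proof. exact: mulop_linear boundary_multiplier. Qed.

Lemma bmul_contraction u : hnorm (bmul Phi u) <= hnorm u.
Proof. exact: mulop_contraction boundary_multiplier. Qed.

Lemma bmul_bounded : bounded_operator (bmul Phi).
Proof. by split; [exact: bmul_linear|exists 1 => u; rewrite mul1r bmul_contraction]. Qed.

Lemma bmul_scalar_mul (a : R * R -> R[i]^o) u : continuous a -> (forall t, cabs (a t) <= 1) ->
  bmul Phi (scalar_mul a u) = scalar_mul a (bmul Phi u).
Proof.
move=> ca a1; have mb := boundary_multiplier.
have ma := @scalar_multiplier R E a ca a1; have ma' := @scalar_multiplier R Es a ca a1.
apply: L2ext; have h1 := ae_and (mulopE (scalar_mul a u) mb) (mulopE u ma).
have h2 := ae_and (mulopE (bmul Phi u) ma') (mulopE u mb).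
move: h1 h2 mb.1; apply: filterS3 => t [k1 k2] [k3 k4] k5 tS.
rewrite k1// k2// k3// k4//; exact: (linear_scale _ _ (k5 tS).1).
Qed.

(** [Phi] times the extension of [u] is a Hardy function whose radial limits are [Phi u];
    [boundary_functionP] then gives both claims. *)
Lemma bmul_analytic u : analytic u ->
  analytic (bmul Phi u) /\ forall w, bidisk w -> szego_ext (bmul Phi u) w = Phi w (szego_ext u w).
Proof.
move=> au; apply: boundary_functionP; have hH := analytic_boundary au (fun w _ => erefl (szego_ext u w)).
have [[_ [M hM]] cu] := hH.
have cH z : bidisk z -> cdiff (szego_ext u) z by exact: szego_ext_cdiff.
have cF z : bidisk z -> cdiff (fun z => Phi z (szego_ext u z)) z.
  by move=> bz; apply: schur_cdiff => //; exact: cH.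
split.
  apply: (@hardy_dominated _ _ _ M) => // r r01; apply: le_trans (hM r r01).
  apply: (@le_sqnorm_means _ Es E (fun z => Phi z (szego_ext u z)) (szego_ext u)) => // z bz.
  exact: schur_contraction.
have h := ae_and (mulopE u boundary_multiplier) (ae_radial_limits PhiS).
move: h cu; apply: filterS2 => t [h1 h2] h3 tS; rewrite h1//.
apply/radial_cvgP => e e0; have e2 : 0 < e / 2 by rewrite divr_gt0.
have c1 := (radial_cvgP _ _).1 (h2 tS (L2fun u t)) _ e2.
have c2 := (radial_cvgP _ _).1 (h3 tS) _ e2.
move: c1 c2 (radial_near R); apply: filterS3 => r k1 k2 r01.
apply: le_lt_trans (ler_hnorm_distD _ (Phi (radial r t) (L2fun u t)) _) _.
have br := bidisk_radial t r01; rewrite -(linear_sub (schur_linear PhiS br)).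
rewrite (splitr e); apply: ltr_leD; last exact: ltW.
exact: le_lt_trans (schur_contraction PhiS _ br) k2.
Qed.

End BoundaryOperator.

(** * Multiplication by a coordinate *)

Section CoordinateMultiplication.
Context (R : realType) (E : sepHilbertType R) (p : C2 R -> R[i]^o).

Definition coordinate := p = fst \/ p = snd.

Context (pP : coordinate).

Lemma coordinate_cabs z : bidisk z -> cabs (p z) < 1.
Proof. by move=> /bidiskE[z1 z2]; case: pP => ->. Qed.

Lemma coordinate_torus t : cabs (p (torus t)) = 1.
Proof. by case: pP => -> /=; rewrite cabs_cis. Qed.

Lemma continuous_coordinate : continuous (fun t : R * R => p (torus t) : R[i]^o).
Proof. by case: pP => ->; [exact: continuous_cis_fst|exact: continuous_cis_snd]. Qed.

Lemma coordinate_radial (r : R) t : p (radial r t) = r%:C%C * (p (torus t) : R[i]).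
Proof. by case: pP => ->. Qed.

(** Regarding a coordinate as a Schur function makes the results on [bmul] available for [Zmul]. *)
Definition coordinate_op (z : C2 R) (x : E) : E := (p z : R[i]) *: x.

Lemma coordinate_schur : Schur_class coordinate_op.
Proof.
split=> z bz.
  have le1 x : hnorm (coordinate_op z x) <= hnorm x.
    by rewrite hnormZ ler_piMl ?hnorm_ge0// ltW// coordinate_cabs.
  split; last by move=> x; rewrite !normr_hnorm lecR.
  split; last by exists 1 => x; rewrite mul1r.
  by move=> a x y; rewrite /coordinate_op scalerDr !scalerA mulrC.
have bid : bounded_operator (id : E -> E) by split=> //; exists 1 => x; rewrite mul1r.
have b0 : bounded_operator (fun=> 0 : E).
  by split=> [a x y|]; [rewrite scaler0 addr0|exists 1 => x; rewrite hnorm0 mul1r hnorm_ge0].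
have key A1 A2 : (forall h x, coordinate_op (z + h) x - coordinate_op z x - ((h.1 : R[i]) *: A1 x + (h.2 : R[i]) *: A2 x) = 0) ->
    forall e : R[i], 0 < e -> \forall h \near (0 : C2 R), forall x : E,
      `|coordinate_op (z + h) x - coordinate_op z x - ((h.1 : R[i]) *: A1 x + (h.2 : R[i]) *: A2 x)| <= e * `|h| * `|x|.
  move=> hA e e0; apply/nbhs_C2P; exists 1 => // h _; rewrite add0r => x; rewrite hA normr0.
  by apply: mulr_ge0; [apply: mulr_ge0|]; rewrite ?normr_ge0// ltW.
case: pP key => pE key.
  exists id, (fun=> 0); split=> //; apply: key => h x.
  by rewrite /coordinate_op pE -scalerBl scaler0 addr0 /= addrAC subrr add0r subrr.
exists (fun=> 0), id; split=> //; apply: key => h x.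
by rewrite /coordinate_op pE -scalerBl scaler0 add0r /= addrAC subrr add0r subrr.
Qed.

Lemma Zmul_bmul : Zmul p = bmul coordinate_op :> (L2 E -> L2 E).
Proof.
apply/funext => u; rewrite /Zmul /bmul; congr (mulop _ u); apply/funext => t; apply/funext => x.
rewrite /boundary_value; apply/esym/cvg_lim => //.
have cr : (fun r : R => r%:C%C * (p (torus t) : R[i]) : R[i]^o) @ (1 : R)^'- --> ((p (torus t) : R[i]^o)).
  have h : (fun r : R => r%:C%C * (p (torus t) : R[i]) : R[i]^o) @ (1 : R)^'- --> (1 * (p (torus t) : R[i]) : R[i]^o).
    apply: cvgM; last exact: cvg_cst.
    by apply: cvg_within_filter; exact: (@continuous_real_complex R 1).
  by rewrite mul1r in h.
under eq_fun do rewrite /coordinate_op coordinate_radial.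
by apply: cvgZ; [exact: cr|exact: cvg_cst].
Qed.

Lemma Zmul_analytic (u : L2 E) : analytic u -> analytic (Zmul p u) /\
  forall w, bidisk w -> szego_ext (Zmul p u) w = (p w : R[i]) *: szego_ext u w.
Proof. by rewrite Zmul_bmul => /(bmul_analytic coordinate_schur). Qed.

Lemma inner_Zmul (u v : L2 E) : inner (Zmul p u) (Zmul p v) = inner u v.
Proof. exact: (inner_scalar_mul u v continuous_coordinate coordinate_torus). Qed.

Lemma Zmul_linear : linear (Zmul p : L2 E -> L2 E).
Proof. by rewrite Zmul_bmul; exact: bmul_linear coordinate_schur. Qed.

Lemma Zmul_surj (u : L2 E) : exists v : L2 E, Zmul p v = u.
Proof. by eexists; exact: (scalar_mulK u continuous_coordinate coordinate_torus). Qed.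

Lemma bmul_Zmul (Es : sepHilbertType R) (Phi : C2 R -> E -> Es) (u : L2 E) : Schur_class Phi ->
  bmul Phi (Zmul p u) = Zmul p (bmul Phi u).
Proof.
move=> PhiS; apply: (bmul_scalar_mul PhiS u continuous_coordinate) => t.
by rewrite coordinate_torus.
Qed.

End CoordinateMultiplication.

(** * The scattering space *)

Section OperatorRangeTheory.
Context (R : realType) (V : innerType R) (hV : hcomplete V).
Implicit Types (S : V -> V) (x y k p : V).

(** Polarisation: the imaginary part of [<S z, z>] vanishes for [z = x + i y], for [x] and for
    [y]. *)
Lemma positive_selfadjoint S x y : positive_operator S -> Rin (S x) y = Rin x (S y).
Proof.
move=> [[lS _] pS].
have im0 z : complex.Im (inner (S z) z) = 0 by have := pS z; rewrite lecE => /andP[/eqP].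
have := im0 (x + 'i%C *: y); rewrite (linear_add lS) (linear_scale _ _ lS).
rewrite innerDl !innerDr !innerZl !innerZr.
have := im0 x; have := im0 y; rewrite (RinC x) /Rin.
move: (inner (S x) x) (inner (S y) y) (inner (S x) y) (inner (S y) x).
move=> [a a'] [b b'] [c c'] [d d'] /=; lra.
Qed.

Lemma kernel_subspace S : linear S -> is_subspace [set k | S k = 0].
Proof.
move=> lS; split; first exact: linear_zero.
by move=> a x y /= Sx Sy; rewrite lS Sx Sy scaler0 addr0.
Qed.

Lemma Rin_inner0 (D : set V) x : is_subspace D -> (forall d, D d -> Rin d x = 0) ->
  forall d, D d -> inner d x = 0.
Proof.
move=> [D0 hD] h d Dd; apply: complex_eq; first exact: h.
by rewrite Im_inner_Rinl h// -[_ *: d]addr0; exact: hD.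
Qed.

(** The projection [q] of [x] is a priori in the closure of the kernel only; boundedness of [S]
    gives [S q = 0], and then [x - q] is the required vector. *)
Lemma proj_kerperpP S x : bounded_operator S ->
  S (x - proj_kerperp S x) = 0 /\ forall k, S k = 0 -> inner (proj_kerperp S x) k = 0.
Proof.
move=> [lS [M hM]].
have [q [_ qo qc]] := orthogonal_projection x hV (kernel_subspace lS).
have Sq : S q = 0.
  apply: hnorm_eq0; apply/eqP; rewrite eq_le hnorm_ge0 andbT; apply/ler_addgt0Pr => e e0.
  have M1 : 0 < `|M| + 1 by rewrite ltr_wpDl.
  have [d /= Sd hd] := qc _ (divr_gt0 e0 M1).
  have -> : S q = S (q - d) by rewrite (linear_sub lS) Sd subr0.
  apply: le_trans (hM _) _; rewrite add0r; move: hd; rewrite ltr_pdivlMr// => /ltW; apply: le_trans.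
  rewrite mulrC ler_wpM2l ?hnorm_ge0//; apply: le_trans (ler_norm M) _; rewrite lerDl.
  exact: ler01.
rewrite /proj_kerperp; case: xgetP => [p _ //|/(_ (x - q))[]]; split; first by rewrite opprD opprK addNKr.
move=> k Sk; rewrite innerC (Rin_inner0 (kernel_subspace lS) qo)//; exact: rmorph0.
Qed.

Lemma kerperp_unique S p p' : linear S -> S p = S p' ->
  (forall k, S k = 0 -> inner p k = 0) -> (forall k, S k = 0 -> inner p' k = 0) -> p = p'.
Proof.
move=> lS Spp hp hp'; apply/eqP; rewrite -subr_eq0; apply/eqP; apply: inner_eq0.
have K : S (p - p') = 0 by rewrite (linear_sub lS) Spp subrr.
by rewrite innerDl innerNl hp// hp'// subrr.
Qed.

(** A vector orthogonal to the kernel is the projection of every preimage of its image, so the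
    preimage picked by [preimage_choice] does not matter. *)
Lemma range_norm_kerperp S p : bounded_operator S -> (forall k, S k = 0 -> inner p k = 0) ->
  range_norm S (S p) = hnorm p.
Proof.
move=> bS hp; have [lS _] := bS; rewrite /range_norm /range_inner /hnorm.
have Sx : S (preimage_choice S (S p)) = S p.
  by rewrite /preimage_choice; case: xgetP => [x _ //|/(_ p)[]].
set x := preimage_choice S (S p) in Sx *.
have [P1 P2] := proj_kerperpP x bS.
have -> : proj_kerperp S x = p.
  apply: (kerperp_unique lS) => //; rewrite -Sx; apply/eqP; rewrite eq_sym -subr_eq0 -(linear_sub lS).
  exact/eqP.
have -> : inner p x = inner p p; last by [].
apply/eqP; rewrite -subr_eq0 -innerNr -innerDr hp//.
by rewrite (linear_sub lS) Sx subrr.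
Qed.

End OperatorRangeTheory.

Section Scattering.
Context (R : realType) (E Es : sepHilbertType R) (Phi : C2 R -> E -> Es) (PhiS : Schur_class Phi).

Let hW : hcomplete (L2 Es * L2 E)%type := hcomplete_pair (@L2_complete R Es) (@L2_complete R E).
Let S := scattering_root Phi.

Lemma Rin_pair (x y : L2 Es * L2 E) : Rin x y = Rin x.1 y.1 + Rin x.2 y.2.
Proof. by rewrite /Rin -[inner x y]/(inner x.1 y.1 + inner x.2 y.2) raddfD. Qed.

Lemma sqnorm_pair (x : L2 Es * L2 E) : sqnorm x = sqnorm x.1 + sqnorm x.2.
Proof. by rewrite -!Rinxx Rin_pair. Qed.

Lemma adjoint_bmul_contraction (f : L2 Es) : hnorm (adjoint (bmul Phi) f) <= hnorm f.
Proof.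
apply: adjoint_contraction; [exact: L2_complete|exact: bmul_linear|exact: bmul_contraction].
Qed.

Lemma scattering_rootP : positive_operator S /\ S \o S = scattering_block Phi.
Proof.
have lb := bmul_linear PhiS; have bb := bmul_bounded PhiS; have hE := @L2_complete R E.
(* The block operator is [I - B] with [B] a self-adjoint contraction, which is the situation of
   [sqrt_id_minus]. *)
pose B (F : L2 Es * L2 E) : L2 Es * L2 E := (- bmul Phi F.2, - adjoint (bmul Phi) F.1).
have la := adjoint_linear hE bb.
have lB : linear B.
  move=> a x y; rewrite /B /= lb la !opprD -!scalerN.
  by [].
have sB x y : Rin (B x) y = Rin x (B y).
  have h1 : Rin (bmul Phi x.2) y.1 = Rin x.2 (adjoint (bmul Phi) y.1) by exact: Rin_adjoint.
  have h2 : Rin (adjoint (bmul Phi) x.1) y.2 = Rin x.1 (bmul Phi y.2).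
    by rewrite RinC -Rin_adjoint// RinC.
  by rewrite !Rin_pair /= !RinNl !RinNr h1 h2 addrC.
have cB x : hnorm (B x) <= hnorm x.
  rewrite ler_hnorm ?hnorm_ge0// hnorm_sqr !sqnorm_pair /= !sqnormN addrC -!hnorm_sqr.
  by apply: lerD; apply: lerXn2r; rewrite ?nnegrE ?hnorm_ge0// ?adjoint_bmul_contraction ?bmul_contraction.
have [S0 [S1 S2]] := sqrt_id_minus hW lB sB cB.
have TE : (fun x => x - B x) = scattering_block Phi.
  apply/funext => x; rewrite /B /scattering_block [x in LHS]surjective_pairing.
  by congr (_, _); rewrite /= ?opprK // addrC.
rewrite /S /scattering_root /sqrt_operator; case: xgetP => [S' _ //|/(_ S0)[]].
by split=> //; rewrite S2.
Qed.

Lemma scattering_root_bounded : bounded_operator S.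
Proof. by have [[]] := scattering_rootP. Qed.

Lemma scattering_root_selfadjoint x y : Rin (S x) y = Rin x (S y).
Proof. exact: positive_selfadjoint scattering_rootP.1. Qed.

Lemma sqnorm_scattering_root x : sqnorm (S x) =
  sqnorm x.1 + sqnorm x.2 + 2 * Rin (bmul Phi x.2) x.1.
Proof.
rewrite -Rinxx -scattering_root_selfadjoint -[S (S x)]/((S \o S) x) scattering_rootP.2.
rewrite Rin_pair /= !RinDl !Rinxx.
have -> : Rin (adjoint (bmul Phi) x.1) x.2 = Rin (bmul Phi x.2) x.1.
  by rewrite RinC -Rin_adjoint//; [exact: L2_complete|exact: bmul_bounded].
by ring.
Qed.

End Scattering.

(** * Agler kernels *)

Section SzegoKernel.
Context (R : realType) (E : sepHilbertType R).
Implicit Types (z w : C2 R) (y : E) (u v : L2 E).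

Definition szego_kernel z w : R[i] :=
  (1 - (w.1 : R[i])^* * (z.1 : R[i]))^-1 * (1 - (w.2 : R[i])^* * (z.2 : R[i]))^-1.

Lemma szego_ext_szego w y z : bidisk w -> bidisk z -> szego_ext (szego w y) z = szego_kernel z w *: y.
Proof.
move=> bw bz; have h1 := szego_ext_approx bz (szego_partial_cvg y bw).
apply: hcvg_uniq h1 _; apply/hcvgP => e e0.
have [rho [r1 r2 r01]] := bidisk_radius bw; have [N hN] := geometric_rate_small r01 (hnorm_ge0 y) e0.
exists N => n Nn; rewrite poly2_szego_partial hnorm_distC -scalerBl hnormZ.
apply: le_lt_trans (hN n Nn); rewrite ler_wpM2r ?hnorm_ge0//; have /bidiskE[z1 z2] := bz.
by apply: geometric_tail => //; rewrite cabsM cabsJ -[leRHS]mulr1; apply: ler_pM; rewrite ?cabs_ge0// ltW.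
Qed.

Lemma analytic_eq0 u : analytic u -> (forall w, bidisk w -> szego_ext u w = 0) -> u = 0.
Proof.
move=> au u0; apply: L2ext; move: (@L2fun0 R E) (szego_ext_radial au); apply: filterS2 => t h1 h2 tS.
rewrite h1//=; have h := h2 tS.
suff h3 : szego_ext u (radial r t) @[r --> 1^'-] --> (0 : E) by exact: cvg_unique h h3.
apply/radial_cvgP => e e0; apply: filterS (radial_near R) => r r01.
by rewrite u0 ?subrr ?hnorm0//; exact: bidisk_radial.
Qed.

Implicit Types s : seq (C2 R * E).

Definition in_bidisk s := forall x, x \in s -> bidisk x.1.

Definition szego_sum s : L2 E := \sum_(x <- s) szego x.1 x.2.

Lemma analytic_szego_sum s : in_bidisk s -> analytic (szego_sum s).
Proof.
rewrite /szego_sum; elim: s => [|x s IH] hs; rewrite ?big_nil ?big_cons.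
  by rewrite -polyL_nil; exact: analytic_polyL.
have [_ h] := @analytic_subspace R E; rewrite -[szego _ _]scale1r; apply: h.
  by apply: analytic_szego; apply: hs; exact: mem_head.
by apply: IH => y ys; apply: hs; rewrite inE ys orbT.
Qed.

Lemma inner_szego_sum u s : in_bidisk s ->
  inner u (szego_sum s) = \sum_(x <- s) inner (szego_ext u x.1) x.2.
Proof.
rewrite /szego_sum; elim: s => [|x s IH] hs; rewrite ?big_nil ?big_cons.
  by rewrite innerC inner0l rmorph0.
rewrite innerDr IH; last by move=> y ys; apply: hs; rewrite inE ys orbT.
by rewrite inner_szego_ext//; apply: hs; exact: mem_head.
Qed.

Definition scale_points (c : C2 R -> R[i]) s := [seq (x.1, c x.1 *: x.2) | x <- s].

Lemma in_bidisk_scale c s : in_bidisk s -> in_bidisk (scale_points c s).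
Proof. by move=> hs x /mapP[y ys ->]; exact: (hs y ys). Qed.

Lemma in_bidisk_cat s s' : in_bidisk s -> in_bidisk s' -> in_bidisk (s ++ s').
Proof. by move=> hs hs' x; rewrite mem_cat => /orP[/hs|/hs']. Qed.

Lemma szego_sum_comb (a : R[i]) s s' : in_bidisk s ->
  szego_sum (scale_points (fun=> a) s ++ s') = a *: szego_sum s + szego_sum s'.
Proof.
move=> hs; rewrite /szego_sum big_cat big_map scaler_sumr; congr (_ + _).
rewrite big_seq [RHS]big_seq; apply: eq_bigr => x xs.
exact: (linear_scale a x.2 (szego_linear (hs x xs))).
Qed.

(** An analytic vector orthogonal to all Szego kernels has zero extension, hence zero radial limits,
    hence is zero. *)
Lemma szego_sum_dense u (e : R) : analytic u -> 0 < e ->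
  exists2 s, in_bidisk s & hnorm (u - szego_sum s) < e.
Proof.
move=> au e0; pose D : set (L2 E) := [set v | exists2 s, in_bidisk s & v = szego_sum s].
have sD : is_subspace D.
  split; first by exists [::] => //; rewrite /szego_sum big_nil.
  move=> a x y [s hs ->] [s' hs' ->]; exists (scale_points (fun=> a) s ++ s').
    by apply: in_bidisk_cat => //; exact: in_bidisk_scale.
  by rewrite szego_sum_comb.
have [p [_ po pc]] := orthogonal_projection u (@L2_complete R E) sD.
have ap : analytic p.
  apply: analytic_limit => d d0; have [_ [s hs ->] h] := pc d d0.
  by exists (szego_sum s) => //; exact: analytic_szego_sum.
have up0 : u - p = 0.
  apply: analytic_eq0 => [|w bw]; first exact: subspaceB (@analytic_subspace R E) au ap.
  apply: szego_ext_eq => // y; rewrite inner0l innerC.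
  rewrite (Rin_inner0 sD po) ?rmorph0//; exists [:: (w, y)].
    by move=> x; rewrite inE => /eqP ->.
  by rewrite /szego_sum big_seq1.
have -> : u = p by apply/eqP; rewrite -subr_eq0 up0.
by have [_ [s hs ->] h] := pc e e0; exists s.
Qed.

End SzegoKernel.

Lemma inner_suml (R : realType) (V : innerType R) (I : Type) (r : seq I) (F : I -> V) z :
  inner (\sum_(i <- r) F i) z = \sum_(i <- r) inner (F i) z.
Proof.
by elim: r => [|i r IH]; rewrite ?big_nil ?inner0l// !big_cons innerDl IH.
Qed.

Section KernelSums.
Context (R : realType) (Es : sepHilbertType R).
Implicit Types (K : C2 R -> C2 R -> Es -> Es) (s : seq (C2 R * Es)).

Definition kernel_form K s : R[i] :=
  \sum_(x <- s) \sum_(y <- s) inner (K x.1 y.1 y.2) x.2.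

Lemma kernel_form_ge0 K s : positive_kernel K -> in_bidisk s -> 0 <= kernel_form K s.
Proof.
move=> [_ pK] hs; rewrite /kernel_form big_tnth.
under eq_bigr do rewrite big_tnth.
by apply: (pK _ (fun i => (tnth (in_tuple s) i).1) (fun i => (tnth (in_tuple s) i).2)) => i; apply: hs; exact: mem_tnth.
Qed.

Lemma eq_kernel_form (F G : C2 R * Es -> C2 R * Es -> R[i]) s : in_bidisk s ->
  (forall x y, bidisk x.1 -> bidisk y.1 -> F x y = G x y) ->
  \sum_(x <- s) \sum_(y <- s) F x y = \sum_(x <- s) \sum_(y <- s) G x y.
Proof.
move=> hs FG; rewrite big_seq [RHS]big_seq; apply: eq_bigr => x xs.
by rewrite big_seq [RHS]big_seq; apply: eq_bigr => y ys; apply: FG; exact: hs.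
Qed.

End KernelSums.

(** * Kernel vectors of a reproducing kernel space *)

Section ReproducingSpace.
Context (R : realType) (Es : sepHilbertType R) (K : C2 R -> C2 R -> Es -> Es).
Context (H : hilbertType R) (ev : H -> C2 R -> Es) (HK : is_RKHS K ev).
Implicit Types (s : seq (C2 R * Es)) (f : H).

Definition kernel_vector w (eta : Es) : H :=
  xget 0 [set k | (forall z, bidisk z -> ev k z = K z w eta) /\
                  (forall f, inner f k = inner (ev f w) eta)].

Lemma kernel_vectorP w eta : bidisk w ->
  (forall z, bidisk z -> ev (kernel_vector w eta) z = K z w eta) /\
  (forall f, inner f (kernel_vector w eta) = inner (ev f w) eta).
Proof.
move=> bw; have [_ _ h] := HK; have [k hk] := h w eta bw.
by rewrite /kernel_vector; case: xgetP => [k' _ //|/(_ k)[]].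
Qed.

Lemma inner_kernel_vector f w eta : bidisk w -> inner f (kernel_vector w eta) = inner (ev f w) eta.
Proof. by move=> /(kernel_vectorP eta)[]. Qed.

Lemma kernel_vectorZ (c : R[i]) w eta : bidisk w ->
  kernel_vector w (c *: eta) = c *: kernel_vector w eta.
Proof.
move=> bw; apply: Rin_inj => f.
by rewrite /Rin inner_kernel_vector// !innerZr inner_kernel_vector.
Qed.

Definition kernel_sum s : H := \sum_(x <- s) kernel_vector x.1 x.2.

Lemma inner_kernel_sum f s : in_bidisk s -> inner f (kernel_sum s) = \sum_(x <- s) inner (ev f x.1) x.2.
Proof.
rewrite /kernel_sum; elim: s => [|x s IH] hs; rewrite ?big_nil ?big_cons.
  by rewrite innerC inner0l rmorph0.
rewrite innerDr IH; last by move=> y ys; apply: hs; rewrite inE ys orbT.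
by rewrite inner_kernel_vector//; apply: hs; exact: mem_head.
Qed.

Lemma kernel_sum_comb (a : R[i]) s s' : in_bidisk s ->
  kernel_sum (scale_points (fun=> a) s ++ s') = a *: kernel_sum s + kernel_sum s'.
Proof.
move=> hs; rewrite /kernel_sum big_cat big_map scaler_sumr; congr (_ + _).
by rewrite big_seq [RHS]big_seq; apply: eq_bigr => x xs; rewrite kernel_vectorZ//; exact: (hs x xs).
Qed.

Lemma inner_kernel_sums s : in_bidisk s -> inner (kernel_sum s) (kernel_sum s) = kernel_form K s.
Proof.
move=> hs; rewrite inner_kernel_sum// /kernel_form big_seq [RHS]big_seq; apply: eq_bigr => x xs.
have bx := hs x xs; rewrite -inner_kernel_vector// /kernel_sum inner_suml.
rewrite big_seq [RHS]big_seq; apply: eq_bigr => y ys; rewrite inner_kernel_vector//.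
by have [-> //] := kernel_vectorP y.2 (hs y ys).
Qed.

End ReproducingSpace.

(** * Powers of the shift *)

Section IteratedShift.
Context (R : realType) (E : sepHilbertType R) (p : C2 R -> R[i]^o) (pP : coordinate p).
Implicit Types (u v x y : L2 E).

Lemma iter_Zmul_inner k u v : inner (iter k (Zmul p) u) (iter k (Zmul p) v) = inner u v.
Proof. by elim: k => [//|k IH]; rewrite !iterS inner_Zmul. Qed.

Lemma iter_Zmul_linear k : linear (iter k (Zmul p) : L2 E -> L2 E).
Proof.
elim: k => [//|k IH] a u v; rewrite !iterS IH; exact: Zmul_linear.
Qed.

Lemma iter_Zmul_surj k u : exists v, iter k (Zmul p) v = u.
Proof.
elim: k u => [|k IH] u; first by exists u.
by have [v vu] := Zmul_surj pP u; have [x xv] := IH v; exists x; rewrite iterS xv.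
Qed.

Lemma iter_Zmul_analytic k u : analytic u -> analytic (iter k (Zmul p) u) /\
  forall w, bidisk w -> szego_ext (iter k (Zmul p) u) w = (p w : R[i]) ^+ k *: szego_ext u w.
Proof.
move=> au; elim: k => [|k [ak hk]]; first by split=> // w _; rewrite expr0 scale1r.
rewrite iterS; have [a1 h1] := Zmul_analytic pP ak; split=> // w bw.
by rewrite h1// hk// scalerA exprS.
Qed.

(* The union of the subspaces [Z^-k H2]. *)
Definition eventually_analytic y := exists k, analytic (iter k (Zmul p) y).

Lemma eventually_analytic_subspace : is_subspace eventually_analytic.
Proof.
have [a0 aD] := @analytic_subspace R E.
split; first by exists 0%N.
move=> a x y [k xk] [l yl]; exists (k + l)%N; rewrite iter_Zmul_linear; apply: aD.
  by rewrite addnC iterD; have [] := iter_Zmul_analytic l xk.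
by rewrite iterD; have [] := iter_Zmul_analytic k yl.
Qed.

Lemma H2perp_iter g : (forall k, H2perp (iter k (Zmul p) g)) <->
  (forall y, eventually_analytic y -> inner g y = 0).
Proof.
split=> [hg y [k yk]|hg k v /H2_subspaceP av].
  by rewrite -(iter_Zmul_inner k) (hg k)//; apply/H2_subspaceP.
have [y yv] := iter_Zmul_surj k v; rewrite -yv iter_Zmul_inner hg//; exists k.
by rewrite yv.
Qed.

Lemma bmul_iter_Zmul (Es : sepHilbertType R) (Phi : C2 R -> E -> Es) k u : Schur_class Phi ->
  bmul Phi (iter k (Zmul p) u) = iter k (Zmul p) (bmul Phi u).
Proof. by move=> PhiS; elim: k => [//|k IH]; rewrite !iterS bmul_Zmul// IH. Qed.

End IteratedShift.

Section ScatteringShift.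
Context (R : realType) (E Es : sepHilbertType R) (Phi : C2 R -> E -> Es) (PhiS : Schur_class Phi).
Context (p : C2 R -> R[i]^o) (pP : coordinate p).
Let W := (L2 Es * L2 E)%type.
Let S := scattering_root Phi.

Let hW : hcomplete W := hcomplete_pair (@L2_complete R Es) (@L2_complete R E).
Let bS : bounded_operator S := scattering_root_bounded PhiS.
Let lS : linear S := bS.1.

Lemma iter_Zpair k (F : W) : iter k (Zpair p) F = (iter k (Zmul p) F.1, iter k (Zmul p) F.2).
Proof. by elim: k => [|k IH]; rewrite ?iterS ?IH//; case: F. Qed.

Lemma sqnorm_scattering_root_iter k (z : W) :
  sqnorm (S (iter k (Zmul p) z.1, iter k (Zmul p) z.2)) = sqnorm (S z).
Proof.
rewrite !sqnorm_scattering_root//= bmul_iter_Zmul//.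
by rewrite /Rin /sqnorm !iter_Zmul_inner.
Qed.

(* Douglas' lemma: the preimage of [F] represents the functional [S z |-> <z, F>]. *)
Lemma scattering_range (F : W) (c : R) : 0 <= c -> (forall z, Rin z F <= c * hnorm (S z)) ->
  scattering_space Phi F.
Proof.
move=> c0 hF; have ll (a : R) (x y : W) : setT x -> setT y -> Rin (a%:C%C *: x + y) F = a * Rin x F + Rin y F.
  by move=> _ _; rewrite RinDl RinZl.
have [p0 [_ hp _]] := @riesz_variational R W W setT S (fun x => Rin x F) c hW I (fun _ _ _ _ _ => I) lS ll (fun z _ => hF z) c0.
exists p0 => //; apply: Rin_inj => z.
by rewrite -(scattering_root_selfadjoint PhiS) hp.
Qed.

Lemma scattering_range_iter k (F : W) : scattering_space Phi F -> scattering_space Phi (iter k (Zpair p) F).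
Proof.
move=> [q _ <-]; apply: (@scattering_range _ (hnorm q)) => [|z]; first exact: hnorm_ge0.
have [z1 e1] := iter_Zmul_surj pP k z.1; have [z2 e2] := iter_Zmul_surj pP k z.2.
have -> : z = (iter k (Zmul p) (z1, z2).1, iter k (Zmul p) (z1, z2).2) by rewrite e1 e2 -surjective_pairing.
have -> : hnorm (S (iter k (Zmul p) (z1, z2).1, iter k (Zmul p) (z1, z2).2)) = hnorm (S (z1, z2)).
  by rewrite /hnorm sqnorm_scattering_root_iter.
rewrite iter_Zpair Rin_pair /= /Rin !iter_Zmul_inner// -/(Rin _ _) -/(Rin _ _).
rewrite -[X in X <= _](Rin_pair (z1, z2) (S q)) -(scattering_root_selfadjoint PhiS).
by rewrite mulrC; exact: Rin_le_hnorm.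
Qed.

End ScatteringShift.

(** * The contractive containment *)

Section ContractiveContainment.
Context (R : realType) (E Es : sepHilbertType R) (Phi : C2 R -> E -> Es) (PhiS : Schur_class Phi).
(** Both values of [j] are treated at once: [p] is the coordinate of the space considered and [p']
    the other one, so in the Agler identity [K] carries the factor formed with [p']. *)
Context (p p' : C2 R -> R[i]^o) (K K' : C2 R -> C2 R -> Es -> Es).
Context (H H' : hilbertType R) (ev : H -> C2 R -> Es) (ev' : H' -> C2 R -> Es).
Context (pP : coordinate p).
Context (pP' : coordinate p').
Context (szego_kernelE : forall z w, szego_kernel z w =
  (1 - (p z : R[i]) * (p w : R[i])^*)^-1 * (1 - (p' z : R[i]) * (p' w : R[i])^*)^-1).
Context (K_pos : positive_kernel K).
Context (agler : forall z w, bidisk z -> bidisk w -> forall eta : Es,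
  eta - Phi z (adjoint (Phi w) eta) =
  (1 - (p' z : R[i]) * (p' w : R[i])^*) *: K z w eta + (1 - (p z : R[i]) * (p w : R[i])^*) *: K' z w eta).
Context (HK : is_RKHS (szego_quotient p K) ev).
Context (HK' : is_RKHS (szego_quotient p' K') ev').
Implicit Types s : seq (C2 R * Es).

Let ksum := kernel_sum (szego_quotient p K) ev.
Let ksum' := kernel_sum (szego_quotient p' K') ev'.

Lemma coordinate_neq0 (q : C2 R -> R[i]^o) z w : coordinate q -> bidisk z -> bidisk w ->
  1 - (q z : R[i]) * (q w : R[i])^* != 0.
Proof.
move=> cq bz bw; have z1 := coordinate_cabs cq bz; have w1 := coordinate_cabs cq bw.
rewrite subr_eq0 eq_sym; apply/negP => /eqP h.
have : cabs ((q z : R[i]) * (q w : R[i])^*) < 1.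
  rewrite cabsM cabsJ; apply: le_lt_trans z1; rewrite ler_piMr ?cabs_ge0//; exact: ltW.
by rewrite h cabs1 ltxx.
Qed.

(** From [K / (1 - a b) = K + a b K / (1 - a b)], with [a b] absorbed into the coefficients. *)
Lemma kernel_form_step s : in_bidisk s -> kernel_form (szego_quotient p K) s =
  kernel_form K s + kernel_form (szego_quotient p K) (scale_points (fun w => (p w : R[i])^*) s).
Proof.
move=> hs; rewrite /kernel_form big_map -big_split /=.
under [RHS]eq_bigr do rewrite big_map -big_split /=.
apply: eq_kernel_form => // x y bx by_; have [lK _] := K_pos.1 x.1 y.1 bx by_.
have n0 := coordinate_neq0 pP bx by_.
rewrite /szego_quotient (linear_scale _ _ lK) !innerZl innerZr conjCK.
move: (inner _ _) n0 => c; move: (p x.1 : R[i]) ((p y.1 : R[i])^*) => a b n0.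
by field; exact: n0.
Qed.

Lemma sqnorm_ksum_step s : in_bidisk s ->
  sqnorm (ksum (scale_points (fun w => (p w : R[i])^*) s)) <= sqnorm (ksum s).
Proof.
move=> hs; rewrite /sqnorm (inner_kernel_sums HK hs) (inner_kernel_sums HK (in_bidisk_scale hs)).
rewrite (kernel_form_step hs) raddfD /= lerDr.
by have := kernel_form_ge0 K_pos hs; rewrite lecE => /andP[].
Qed.

Lemma sqnorm_ksum_iter n s : in_bidisk s ->
  sqnorm (ksum (scale_points (fun w => (p w : R[i])^* ^+ n) s)) <= sqnorm (ksum s).
Proof.
move=> hs; elim: n => [|n IH].
  rewrite (_ : scale_points _ s = s)// -[RHS]map_id; apply: eq_map => x.
  by rewrite expr0 scale1r -surjective_pairing.
rewrite (_ : scale_points _ s = scale_points (fun w => (p w : R[i])^*) (scale_points (fun w => (p w : R[i])^* ^+ n) s)).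
  by apply: le_trans IH; apply: sqnorm_ksum_step; exact: in_bidisk_scale.
by rewrite /scale_points -map_comp; apply: eq_map => x /=; rewrite scalerA -exprS.
Qed.

Lemma inner_szego_sums (V : sepHilbertType R) (s : seq (C2 R * V)) : in_bidisk s ->
  inner (szego_sum s) (szego_sum s) =
  \sum_(x <- s) \sum_(y <- s) inner (szego_kernel x.1 y.1 *: y.2) x.2.
Proof.
move=> hs; rewrite inner_szego_sum// big_seq [RHS]big_seq; apply: eq_bigr => x xs.
have bx := hs x xs; rewrite -inner_szego_ext// /szego_sum inner_suml.
rewrite big_seq [RHS]big_seq; apply: eq_bigr => y ys.
by rewrite inner_szego_ext// szego_ext_szego//; exact: (hs y ys).
Qed.

Definition adjoint_points s : seq (C2 R * E) := [seq (x.1, adjoint (Phi x.1) x.2) | x <- s].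

Lemma in_bidisk_adjoint s : in_bidisk s -> in_bidisk (adjoint_points s).
Proof. by move=> hs x /mapP[y ys ->]; exact: (hs y ys). Qed.

Lemma inner_adjoint_schur w x y : bidisk w -> inner (Phi w x) y = inner x (adjoint (Phi w) y).
Proof. by move=> bw; apply: adjoint_bounded; [exact: hcomplete_hilbert|exact: (schur_bounded PhiS)]. Qed.

(** Multiplying the Agler identity by the Szego kernel cancels one of its two factors in each
    summand on the right, which leaves the two reproducing kernels. *)
Lemma agler_gap s : in_bidisk s ->
  sqnorm (szego_sum s) = sqnorm (szego_sum (adjoint_points s)) + (sqnorm (ksum s) + sqnorm (ksum' s)).
Proof.
move=> hs.
suff I : inner (szego_sum s) (szego_sum s) = inner (szego_sum (adjoint_points s)) (szego_sum (adjoint_points s)) +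
    (inner (ksum s) (ksum s) + inner (ksum' s) (ksum' s)) by rewrite /sqnorm I !raddfD.
rewrite (inner_kernel_sums HK hs) (inner_kernel_sums HK' hs) inner_szego_sums//.
rewrite (inner_szego_sums (in_bidisk_adjoint hs)) /kernel_form big_map -!big_split /=.
under [RHS]eq_bigr do rewrite big_map -!big_split /=.
apply: eq_kernel_form => // x y bx by_.
have n0 := coordinate_neq0 pP bx by_; have n1 := coordinate_neq0 pP' bx by_.
rewrite /szego_quotient !innerZl -inner_adjoint_schur// szego_kernelE.
have := congr1 (fun e => inner e x.2) (agler bx by_ y.2); rewrite !innerDl innerNl !innerZl.
move: (inner y.2 x.2) (inner (Phi _ _) _) (inner (K _ _ _) _) (inner (K' _ _ _) _) => a b c d.
move=> /eqP; rewrite subr_eq => /eqP ->.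
move: (1 - _) (1 - _) n0 n1 => q q' n0 n1; field; by rewrite n0 n1.
Qed.

Lemma kernel_root_bound n s (h : L2 E) : in_bidisk s -> analytic h ->
  hnorm (ksum (scale_points (fun w => (p w : R[i])^* ^+ n) s)) <=
  hnorm (scattering_root Phi (szego_sum s, h)).
Proof.
move=> hs ah; rewrite ler_hnorm ?hnorm_ge0// hnorm_sqr; apply: le_trans (sqnorm_ksum_iter n hs) _.
rewrite sqnorm_scattering_root//=.
have [ab hb] := bmul_analytic PhiS ah.
have E1 : Rin (bmul Phi h) (szego_sum s) = Rin h (szego_sum (adjoint_points s)).
  rewrite /Rin !inner_szego_sum//; last exact: in_bidisk_adjoint.
  congr complex.Re; rewrite big_map big_seq [RHS]big_seq; apply: eq_bigr => x xs /=.
  by have bx := hs x xs; rewrite hb// inner_adjoint_schur.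
(* Completing the square in [h]: the cross term pairs [h] with the Szego sum of the vectors
   [Phi(w)^* eta]. *)
have := sqnorm_ge0 (h + szego_sum (adjoint_points s)); rewrite sqnormD -/(Rin _ _) -E1.
have := sqnorm_ge0 (ksum' s); have := agler_gap hs; lra.
Qed.

Lemma kernel_szego_bound s : in_bidisk s -> hnorm (ksum s) <= hnorm (szego_sum s).
Proof.
move=> hs; rewrite ler_hnorm ?hnorm_ge0// !hnorm_sqr agler_gap// addrCA lerDl.
by rewrite addr_ge0 ?sqnorm_ge0.
Qed.

Let hW : hcomplete (L2 Es * L2 E)%type := hcomplete_pair (@L2_complete R Es) (@L2_complete R E).
Let S := scattering_root Phi.
Let bS : bounded_operator S := scattering_root_bounded PhiS.
Let lS : linear S := bS.1.

(** The functional is defined on the pairs in [D] and bounded through their second component, so no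
    map from Szego sums to kernel sums has to be shown well defined. *)
Lemma kernel_extension (f : H) : exists u : L2 Es,
  analytic u /\ forall w, bidisk w -> szego_ext u w = ev f w.
Proof.
pose D : set (H * L2 Es)%type := [set x | exists2 s, in_bidisk s & x = (ksum s, szego_sum s)].
have D0 : D 0 by exists [::] => //; rewrite /ksum /kernel_sum /szego_sum !big_nil.
have DE (a : R[i]) x y : D x -> D y -> D (a *: x + y).
  move=> [s hs ->] [s' hs' ->]; exists (scale_points (fun=> a) s ++ s').
    by apply: in_bidisk_cat => //; exact: in_bidisk_scale.
  by rewrite szego_sum_comb// /ksum (kernel_sum_comb HK).
have ls : linear (snd : H * L2 Es -> L2 Es) by [].
have ll (a : R) (x y : H * L2 Es) : D x -> D y -> Rin (a%:C%C *: x + y).1 f = a * Rin x.1 f + Rin y.1 f.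
  by move=> _ _; rewrite /= RinDl RinZl.
have lb x : D x -> Rin x.1 f <= hnorm f * hnorm x.2.
  move=> [s hs ->] /=; apply: le_trans (Rin_le_hnorm _ _) _; rewrite mulrC.
  by rewrite ler_wpM2l ?hnorm_ge0// kernel_szego_bound.
have [q [_ hq _]] := @riesz_variational R _ _ D snd (fun x => Rin x.1 f) (hnorm f) (@L2_complete R Es)
  D0 DE ls ll lb (hnorm_ge0 f).
have [u [au _ _ hu]] := analytic_projection q; exists u; split=> // w bw; rewrite hu//.
apply: Rin_inj => y; have hs : in_bidisk [:: (w, y)] by move=> x; rewrite inE => /eqP ->.
have := hq (ksum [:: (w, y)], szego_sum [:: (w, y)]) (ex_intro2 _ _ [:: (w, y)] hs erefl).
rewrite /ksum /kernel_sum /szego_sum !big_seq1 /= RinC [Rin (kernel_vector _ _ _ _) _]RinC /Rin.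
by rewrite inner_szego_ext// (inner_kernel_vector HK)// -!/(Rin _ _) RinC [RHS]RinC.
Qed.

Section Extension.
Context (f : H) (u : L2 Es).
Context (au : analytic u).
Context (uE : forall w, bidisk w -> szego_ext u w = ev f w).

Let shifted_sum_bound k s (h : L2 E) : in_bidisk s -> analytic h ->
  Rin (szego_sum s) (iter k (Zmul p) u) <= hnorm f * hnorm (S (szego_sum s, h)).
Proof.
move=> hs ah; have [ak hk] := iter_Zmul_analytic pP k au.
have E1 : inner (iter k (Zmul p) u) (szego_sum s) =
    inner f (ksum (scale_points (fun w => (p w : R[i])^* ^+ k) s)).
  rewrite inner_szego_sum// /ksum (inner_kernel_sum HK); last exact: in_bidisk_scale.
  rewrite big_map big_seq [RHS]big_seq; apply: eq_bigr => x xs; have bx := hs x xs.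
  by rewrite hk// uE//= innerZl innerZr rmorphXn /= conjCK.
rewrite RinC /Rin E1; apply: le_trans (Rin_le_hnorm _ _) _.
by rewrite ler_wpM2l ?hnorm_ge0// kernel_root_bound.
Qed.

Let shifted_analytic_bound k (x : L2 Es) (h : L2 E) : analytic x -> analytic h ->
  Rin x (iter k (Zmul p) u) <= hnorm f * hnorm (S (x, h)).
Proof.
move=> ax ah; pose U := iter k (Zmul p) u; have C0 : 0 < hnorm f + hnorm U + 1.
  by rewrite ltr_wpDl// addr_ge0 ?hnorm_ge0.
apply/ler_addgt0Pr => e e0; have [s hs hx] := szego_sum_dense ax (divr_gt0 e0 C0).
have h1 : Rin x U <= Rin (szego_sum s) U + hnorm (x - szego_sum s) * hnorm U.
  rewrite -[in leLHS](subrK (szego_sum s) x) RinDl addrC lerD2l; exact: Rin_le_hnorm.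
have h2 : hnorm (S (szego_sum s, h)) <= hnorm (S (x, h)) + hnorm (x - szego_sum s).
  have -> : S (szego_sum s, h) = S (x, h) + S (szego_sum s - x, 0).
    by rewrite -(linear_add lS); congr S; congr (_, _); rewrite /= ?addr0// addrC subrK.
  apply: le_trans (ler_hnormD _ _) _; rewrite lerD2l ler_hnorm ?hnorm_ge0// hnorm_sqr.
  rewrite sqnorm_scattering_root//= (linear_zero (bmul_linear PhiS)) Rin0l mulr0 sqnorm0 !addr0.
  by rewrite -sqnormN opprB.
have h3 := shifted_sum_bound k hs ah.
rewrite -/U in h3 *; apply: le_trans h1 _.
apply: le_trans (lerD (le_trans h3 (ler_wpM2l (hnorm_ge0 f) h2)) (lexx _)) _.
rewrite mulrDr -addrA lerD2l mulrC -mulrDr.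
move: hx; rewrite ltr_pdivlMr// => /ltW; apply: le_trans.
by rewrite ler_wpM2l ?hnorm_ge0// lerDl ler01.
Qed.

(** After shifting by [k], the first component may be replaced by its projection [q] onto the
    analytic vectors. The pairings with [Z^k u] and with [Phi h] are unchanged, both being analytic,
    and [|q| <= |x|], so the norm of the root does not increase. *)
Lemma extension_bound (z : L2 Es * L2 E) : eventually_analytic p z.2 ->
  Rin z.1 u <= hnorm f * hnorm (S z).
Proof.
move=> [k ah]; set h := iter k (Zmul p) z.2 in ah; pose x := iter k (Zmul p) z.1.
have [ak _] := iter_Zmul_analytic pP k au.
have [q [aq qx qo _]] := analytic_projection x.
have qE d : analytic d -> Rin x d = Rin q d.
  by move=> /qo; rewrite innerDl innerNl => /eqP; rewrite subr_eq0 /Rin => /eqP ->.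
have -> : Rin z.1 u = Rin q (iter k (Zmul p) u) by rewrite -qE// /Rin iter_Zmul_inner.
apply: le_trans (shifted_analytic_bound k aq ah) _; rewrite ler_wpM2l ?hnorm_ge0//.
rewrite ler_hnorm ?hnorm_ge0// hnorm_sqr -(sqnorm_scattering_root_iter PhiS pP k z) -/x -/h.
rewrite !sqnorm_scattering_root//=; have [ab _] := bmul_analytic PhiS ah.
rewrite (RinC _ q) (RinC _ x) qE// lerD2r lerD2r -!hnorm_sqr.
by apply: lerXn2r; rewrite ?nnegrE ?hnorm_ge0.
Qed.

Lemma extension_Hmax : Hmax Phi p u /\ exists c, is_Hmax_norm Phi p u c /\ c <= hnorm f.
Proof.
pose D : set (L2 Es * L2 E)%type := [set z | eventually_analytic p z.2].
have [D10 D1E] := eventually_analytic_subspace E pP.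
have DE (a : R[i]) x y : D x -> D y -> D (a *: x + y) by move=> Dx Dy; exact: D1E.
have ll (a : R) (x y : L2 Es * L2 E) : D x -> D y -> Rin (a%:C%C *: x + y).1 u = a * Rin x.1 u + Rin y.1 u.
  by move=> _ _; rewrite /= RinDl RinZl.
have [q [qf hq qc]] := @riesz_variational R _ _ D S (fun x => Rin x.1 u) (hnorm f) hW
  D10 DE lS ll (fun z Dz => extension_bound Dz) (hnorm_ge0 f).
have saS a b : Rin (S a) b = Rin a (S b) := scattering_root_selfadjoint PhiS a b.
have SqE z : D z -> Rin z (S q) = Rin z.1 u by move=> Dz; rewrite -saS hq.
have Sq1 : (S q).1 = u.
  (* The first component of a pair in [D] is unrestricted, so the pairs [(x, 0)] determine the first
     component of [S q]. *)
  apply: Rin_inj => x; have := SqE (x, 0) D10.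
  by rewrite Rin_pair /= Rin0l addr0.
(* [q] is in the closure of the range of the self-adjoint [S], hence orthogonal to its kernel; this
   makes [|q|] the range norm of [S q]. *)
have qker k : S k = 0 -> inner q k = 0.
  move=> Sk; have sk := kernel_subspace lS; rewrite innerC (Rin_inner0 sk _ Sk) ?rmorph0// => d Sd.
  rewrite RinC; apply: (@orthogonal_closure R _ [set S z | z in D] q d) => [e e0|_ [z Dz <-]].
    by have [z Dz hz] := qc e e0; exists (S z) => //; exists z.
  by rewrite saS (Sd : S d = 0) RinC Rin0l.
have Sq2 y : eventually_analytic p y -> inner (S q).2 y = 0.
  move=> hy; rewrite innerC (Rin_inner0 (conj D10 D1E) _ hy) ?rmorph0// => d hd.
  have := SqE (0, d) hd; rewrite Rin_pair /= !Rin0l add0r => ->//.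
have SqP : S q = (u, (S q).2) by rewrite -Sq1 -surjective_pairing.
have smax : Smax Phi p (u, (S q).2).
  have sk k : scattering_subspace Phi (iter k (Zpair p) (u, (S q).2)).
    split; first by rewrite -SqP; apply: scattering_range_iter => //; exists q.
      rewrite iter_Zpair; apply/H2_subspaceP; exact: (iter_Zmul_analytic pP k au).1.
    by rewrite iter_Zpair /=; move: k; apply/(H2perp_iter pP).
  by split=> //; exact: (sk 0%N).
split; first by exists (S q).2.
exists (hnorm q); split=> //; split.
  by exists (S q).2; split=> //; rewrite -SqP /scattering_norm; exact: range_norm_kerperp.
move=> g [[[x _ Sx] _ _] hk].
have gD : forall y, eventually_analytic p y -> inner g y = 0.
  by apply/(H2perp_iter pP) => k; have [_ _] := hk k; rewrite iter_Zpair.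
have [P1 P2] := proj_kerperpP hW x bS; set q' := proj_kerperp S x in P1 P2.
have Sq' : S q' = (u, g).
  by rewrite -Sx; apply/eqP; rewrite eq_sym -subr_eq0 -(linear_sub lS) P1.
rewrite /scattering_norm -Sq' range_norm_kerperp//.
(* For [z] in [D] both [<S z, q>] and [<S z, q'>] equal [<z.1, u>], as [g] is orthogonal to [z.2].
   So [q - q'] is orthogonal to the closure of the image of [D], which contains [q]. *)
have o : Rin q (q - q') = 0.
  apply: (@orthogonal_closure R _ [set S z | z in D]) => [e e0|_ [z Dz <-]].
    by have [z Dz hz] := qc e e0; exists (S z) => //; exists z.
  rewrite RinBr saS SqE// saS Sq' Rin_pair /=.
  by rewrite (RinC z.2) /Rin gD// addr0 subrr.
have : hnorm q ^+ 2 <= hnorm q * hnorm q'.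
  rewrite hnorm_sqr -Rinxx; move/eqP: o; rewrite RinBr subr_eq0 => /eqP ->; exact: Rin_le_hnorm.
have := hnorm_ge0 q'; have := hnorm_ge0 q; rewrite le_eqVlt => /orP[/eqP <- //|q0 _].
by rewrite expr2 ler_pM2l.
Qed.

End Extension.

Lemma contractive_containment (f : H) : exists u : L2 Es,
  [/\ boundary_function (ev f) u, Hmax Phi p u & exists c, is_Hmax_norm Phi p u c /\ c <= hnorm f].
Proof.
have [u [au uE]] := kernel_extension f; have [h1 h2] := extension_Hmax au uE.
by exists u; split=> //; exact: analytic_boundary.
Qed.

End ContractiveContainment.

Theorem theorem4p1 (R : realType) (E Es : sepHilbertType R)
  (Phi : C2 R -> E -> Es) (K1 K2 : C2 R -> C2 R -> Es -> Es)
  (PhiS : Schur_class Phi) (PhiK : Agler_kernels Phi K1 K2)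
  (H1 H2 : hilbertType R)
  (ev1 : H1 -> C2 R -> Es) (ev2 : H2 -> C2 R -> Es)
  (H1K : is_RKHS (szego_quotient fst K1) ev1)
  (H2K : is_RKHS (szego_quotient snd K2) ev2) :
  (forall f : H1, exists u : L2 Es,
    [/\ boundary_function (ev1 f) u, Hmax Phi fst u &
        exists c : R, is_Hmax_norm Phi fst u c /\ c <= hnorm f]) /\
  (forall f : H2, exists u : L2 Es,
    [/\ boundary_function (ev2 f) u, Hmax Phi snd u &
        exists c : R, is_Hmax_norm Phi snd u c /\ c <= hnorm f]).
Proof.
have [pK1 pK2 agler] := PhiK.
have c1 : coordinate (fst : C2 R -> R[i]^o) by left.
have c2 : coordinate (snd : C2 R -> R[i]^o) by right.
split=> f.
(* The roles are crossed: [K1] is paired with the second coordinate in the Agler identity, hence the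
   exchange of the two summands. *)
- apply: (contractive_containment PhiS c1 c2 _ pK1 _ H1K H2K) => [z w|z w bz bw eta].
    by rewrite /szego_kernel (mulrC _ (z.1 : R[i])) (mulrC _ (z.2 : R[i])).
  by rewrite agler// addrC.
- apply: (contractive_containment PhiS c2 c1 _ pK2 _ H2K H1K) => [z w|z w bz bw eta].
    rewrite /szego_kernel (mulrC _ (z.1 : R[i])) (mulrC _ (z.2 : R[i])); exact: mulrC.
  by rewrite agler.
Qed.
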